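(* Let $d,m\ge1$, $\alpha\ge0$, $\mathbb K=\mathbb R$ or $\mathbb T$. For $k\ge 1$ let $a_k=\mathrm{diag}(a_{k,1},\dots,a_{k,m})$ with real constants $a_{k,i}$ such that $\{a_{k,i}\}_{k\ge1}\in l^2$ for each $1\le i\le m$. Let $\mathcal A_k=\mathrm{diag}(\mathcal A_{k,1},\dots,\mathcal A_{k,m})$, where $\{\mathcal A_{k,i}\}_{k\ge1}\subset\mathrm{OP}\mathcal S_0^\alpha$ is bounded for each $1\le i\le m$, and suppose that $\mathcal A_k^*=\mathcal M_k-\mathcal A_k$ for all $k\ge1$, for some $\mathcal M_k=\mathrm{diag}(\mathcal M_{k,1},\dots,\mathcal M_{k,m})$ such that $\{\mathcal M_{k,i}\}_{k\ge1}\subset\mathrm{OP}\mathcal S_0^0$ is bounded for each $1\le i\le m$. Let $s\ge0$ and let $\{\mathcal P_n\}_{n\ge1}\subset\mathrm{OP}\mathcal S_0^s$ be bounded. Then there is a constant $C>0$ independent of $n$ (and of $f$) such that $$\sum_{k=1}^\infty\big\langle\mathcal P_n(a_k\mathcal A_k)f,\mathcal P_nf\big\rangle_{L^2}^2\le C\|a_k\|_{l^2}^2\|f\|_{H^s}^4,\qquad f\in H^{s+\alpha}(\mathbb K^d;\mathbb R^m),$$ and $$\sum_{k=1}^\infty\Big|\big\langle\mathcal P_n(a_k\mathcal A_k)^2f,\mathcal P_nf\big\rangle_{L^2}+\big\langle\mathcal P_n(a_k\mathcal A_k)f,\mathcal P_n(a_k\mathcal A_k)f\big\rangle_{L^2}\Big|\le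 C\|a_k\|_{l^2}^2\|f\|_{H^s}^2,\qquad f\in H^{s+2\alpha}(\mathbb K^d;\mathbb R^m).$$
   Context: $\mathbb T:=\mathbb R/\mathbb Z$. On $\mathbb R^d$, $\hat f(\xi)=\int_{\mathbb R^d}f(x)e^{-\mathrm i x\cdot\xi}\,dx$; on $\mathbb T^d$, $\hat f(k)=\int_{\mathbb T^d}f(x)e^{-2\pi\mathrm i x\cdot k}\,dx$, $k\in\mathbb Z^d$. $\mathcal D^s=(\mathbf I-\Delta)^{s/2}$ is the Fourier multiplier with symbol $(1+|\xi|^2)^{s/2}$ (resp. $(1+|k|^2)^{s/2}$); $\langle f,g\rangle_{L^2}=\sum_i\int_{\mathbb K^d}f_i\overline{g_i}\,dx$, $\|f\|_{H^s}=\|\mathcal D^sf\|_{L^2}$. $\mathcal S_0^r$ ($r\in\mathbb R$) is the space of scalar symbols independent of $x$: for $\mathbb K=\mathbb R$, smooth $\mathfrak p:\mathbb R^d\to\mathbb C$ with $\mathfrak p(-\xi)=\overline{\mathfrak p(\xi)}$ and all seminorms $\sup_\xi|\partial_\xi^\mu\mathfrak p(\xi)|(1+|\xi|)^{-(r-|\mu|_1)}$, $\mu\in\mathbb N_0^d$, finite; for $\mathbb K=\mathbb T$, $\mathfrak p:\mathbb Z^d\to\mathbb C$ with $\mathfrak p(-k)=\overline{\mathfrak p(k)}$ and all seminorms $\sup_k|\triangle_k^\mu\mathfrak p(k)|(1+|k|)^{-(r-|\mu|_1)}$ finite, where $(\triangle^\mu g)(k)=\sum_{\gamma\le\mu}(-1)^{|\mu-\gamma|_1}\binom\mu\gamma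 g(k+\gamma)$. $\mathrm{OP}(\mathfrak p)$ is the Fourier multiplier with symbol $\mathfrak p$; $\mathrm{OP}\mathcal S_0^r=\{\mathrm{OP}(\mathfrak p):\mathfrak p\in\mathcal S_0^r\}$; a family in $\mathrm{OP}\mathcal S_0^r$ is bounded if every seminorm is bounded on the set of its symbols. Scalar operators act componentwise on vector-valued functions. $\mathcal A^*$ is the $L^2$-adjoint, $a_k\mathcal A_k:=(a_k\mathbf I)\mathcal A_k$, and $\|a_k\|_{l^2}^2:=\sum_{k=1}^\infty\sum_{i=1}^m a_{k,i}^2$. *)

(* Defs.v *)
From HB Require Import structures.
From mathcomp Require Import all_boot all_order all_algebra complex.
From mathcomp Require Import all_classical all_reals all_analysis.

Set Implicit Arguments.
Unset Strict Implicit.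
Unset Printing Implicit Defensive.
Import Order.TTheory GRing.Theory Num.Theory.
Import numFieldNormedType.Exports.

Local Open Scope classical_set_scope.
Local Open Scope ring_scope.

Fact rV_display : measure_display.
Proof. exact: default_measure_display. Qed.

Section measurable_rV.
Context (R : realType) (d : nat).

(* Generated by the coordinates, i.e. the Borel sigma-algebra of R^d. *)
Definition rV_measurable : set (set 'rV[R]_d) :=
  g_sigma_preimage (fun (i : 'I_d) (x : 'rV[R]_d) => x 0 i : measurableTypeR R).

Let rV_measurable0 : rV_measurable set0.
Proof. exact: sigma_algebra0. Qed.

Let rV_measurableC A : rV_measurable A -> rV_measurable (~` A).
Proof. exact: sigma_algebraC. Qed.

Let rV_measurable_bigcup (F : (set 'rV[R]_d)^nat) :
  (forall i, rV_measurable (F i)) -> rV_measurable (\bigcup_i F i).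
Proof. exact: sigma_algebra_bigcup. Qed.

HB.instance Definition _ := @isMeasurable.Build rV_display 'rV[R]_d
  rV_measurable rV_measurable0 rV_measurableC rV_measurable_bigcup.

Lemma measurable_rV_coord (i : 'I_d) :
  measurable_fun setT (fun x : 'rV[R]_d => x 0 i : measurableTypeR R).
Proof.
move=> _ Y mY; rewrite setTI; apply: sub_sigma_algebra => /=.
rewrite -bigcup_seq/=; exists i => /=; first by rewrite mem_index_enum.
by exists Y => //; rewrite setTI.
Qed.

End measurable_rV.

Lemma measurable_fun_rV (R : realType) d1 (T1 : measurableType d1) (d : nat)
    (f : T1 -> 'rV[R]_d) :
  (forall i, measurable_fun setT (fun t => f t 0 i : measurableTypeR R)) ->
  measurable_fun setT f.
Proof.
move=> mf _ A mA; rewrite setTI.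
suff : measurable `<=` [set B : set 'rV[R]_d | measurable (f @^-1` B)] by exact.
apply: smallest_sub.
  split=> [|B mB|F mF] /=.
  - by rewrite preimage_set0.
  - by rewrite setTD preimage_setC; exact: measurableC.
  - by rewrite preimage_bigcup; exact: bigcupT_measurable.
rewrite -bigcup_seq => B [i _ [Y mY <-]] /=.
by rewrite setTI -[X in measurable X]setTI; exact: mf.
Qed.

Section lebesgue_rV.
Context (R : realType).

Definition rV_cons d (p : 'rV[R]_d * measurableTypeR R) : 'rV[R]_d.+1 :=
  row_mx (p.2%:M : 'rV_1) p.1.

Lemma measurable_rV_cons d : measurable_fun setT (@rV_cons d).
Proof.
apply: measurable_fun_rV => i.
case: (fintype.split_ordP (i : 'I_(1 + d))) => j ->.
- rewrite (_ : (fun _ => _) = snd); first exact: measurable_snd.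
  apply/funext => p; apply: etrans (row_mxEl _ _ _ _) _.
  by rewrite mxE !ord1 mulr1n.
- rewrite (_ : (fun _ => _) = (fun x : 'rV[R]_d => x 0 j) \o fst).
    exact: (measurableT_comp (measurable_rV_coord j) measurable_fst).
  by apply/funext => p; exact: etrans (row_mxEr _ _ _ _) _.
Qed.


Section step.
Variables (d : nat) (m : {measure set 'rV[R]_d -> \bar R}).

Definition lebesgue_rV_step : set 'rV[R]_d.+1 -> \bar R :=
  pushforward (m \x lebesgue_measure)%E (@rV_cons d).

Let pushforward_measure :=
  measure_function_pushforward__canonical__measure_function_Measure
    (m \x lebesgue_measure)%E (@measurable_rV_cons d).

HB.instance Definition _ := isMeasure.Build _ _ _ lebesgue_rV_step
  (measure0 pushforward_measure) (measure_ge0 pushforward_measure)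
  (@measure_semi_sigma_additive _ _ _ pushforward_measure).

End step.

Fixpoint lebesgue_rV (d : nat) : {measure set 'rV[R]_d -> \bar R} :=
  if d is d'.+1 then lebesgue_rV_step (lebesgue_rV d') else dirac (0 : 'rV[R]_0).

Lemma measurable_box d (A : 'I_d -> set (measurableTypeR R)) :
  (forall i, measurable (A i)) ->
  measurable [set x : 'rV[R]_d | forall i, A i (x 0 i)].
Proof.
move=> mA.
rewrite (_ : [set x : 'rV[R]_d | _] =
    \big[setI/setT]_(i < d) [set x : 'rV[R]_d | A i (x 0 i)]).
  apply: bigsetI_measurable => i _.
  by rewrite -[X in measurable X]setTI; exact: measurable_rV_coord.
rewrite -bigcap_seq; apply/seteqP; split => x /= Ax i; first by move=> _.
by apply: Ax; rewrite /= mem_index_enum.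
Qed.

Lemma lebesgue_rV_box d (A : 'I_d -> set (measurableTypeR R)) :
  (forall i, measurable (A i)) ->
  lebesgue_rV d [set x | forall i, A i (x 0 i)] =
  (\prod_(i < d) lebesgue_measure (A i))%E.
Proof.
elim: d A => [|d IHd] A mA.
  rewrite big_ord0 /= diracE.
  have : (0 : 'rV[R]_0) \in [set x : 'rV[R]_0 | forall i : 'I_0, A i (x 0 i)].
    by rewrite inE => -[].
  by move=> ->.
rewrite big_ord_recl /= /lebesgue_rV_step /pushforward.
rewrite (_ : _ @^-1` _ =
    [set x : 'rV[R]_d | forall i, A (lift ord0 i) (x 0 i)] `*` A ord0).
  rewrite product_measure1E//.
    by rewrite (IHd (fun i => A (lift ord0 i)))// muleC.
  by apply: (@measurable_box d (fun i => A (lift ord0 i))) => i; exact: mA.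
have cons0 (p : 'rV[R]_d * measurableTypeR R) : rV_cons p 0 ord0 = p.2.
  have /= := row_mxEl (p.2%:M : 'rV_1) p.1 0 0.
  by rewrite [X in _ = X]mxE mulr1n (_ : lshift d 0 = ord0) //; exact/val_inj.
have consS (p : 'rV[R]_d * measurableTypeR R) i :
    rV_cons p 0 (lift ord0 i) = p.1 0 i.
  have /= := row_mxEr (p.2%:M : 'rV_1) p.1 0 i.
  by rewrite (_ : rshift 1 i = lift ord0 i) //; exact/val_inj.
apply/seteqP; split => p /=.
  move=> Ap; split=> [i|]; first by rewrite -consS.
  by rewrite -[p.2]cons0.
move=> [Ap1 Ap2] i; have [j ->|->] := unliftP ord0 i; first by rewrite consS.
by rewrite cons0.
Qed.

End lebesgue_rV.

(* RR stands for K = R and TT for K = T = R/Z. *)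
Variant base_space := RR | TT.

(* Points of K^d are vectors of R^d in both cases: a function on T^d is a
   function on R^d that is 1-periodic in each coordinate, and it is integrated
   over the fundamental domain [0, 1)^d. *)
Section function_spaces.
Context (R : realType) (K : base_space) (d : nat).

Definition unit_cube : set 'rV[R]_d :=
  [set x | forall i, [set` `[0%R, 1%R[] (x 0 i)].

Lemma measurable_unit_cube : measurable unit_cube.
Proof. by apply: (@measurable_box R d (fun=> [set` `[0%R, 1%R[])). Qed.

Definition vol : {measure set 'rV[R]_d -> \bar R} :=
  match K with
  | RR => lebesgue_rV R d
  | TT => mrestr (lebesgue_rV R d) measurable_unit_cube
  end.

Definition periodic (f : 'rV[R]_d -> R) : Prop :=
  forall (x : 'rV[R]_d) (i : 'I_d), f (x + delta_mx 0 i) = f x.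

Definition L2 : set ('rV[R]_d -> R) :=
  [set f | f \in Lfun vol 2%:E /\ (K = TT -> periodic f)].

(* All the functions are real-valued, so the conjugation in the inner product
   disappears. *)
Definition vfun (m : nat) := 'I_m -> 'rV[R]_d -> R.

Definition L2v m : set (vfun m) := [set f | forall i, L2 (f i)].

Definition ip m (f g : vfun m) : R :=
  \sum_(i < m) \int[vol]_x (f i x * g i x).

Definition norm_L2 m (f : vfun m) : R := Num.sqrt (ip f f).

End function_spaces.

Section fourier.
Context (R : realType) (d : nat).

(* The dual group: R^d for K = R and Z^d for K = T. *)
Definition freq (K : base_space) : zmodType :=
  match K with RR => 'rV[R]_d | TT => 'rV[int]_d end.

Definition freq_vec K : freq K -> 'rV[R]_d :=
  match K return freq K -> 'rV[R]_d with
  | RR => fun xi => xi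
  | TT => fun k => map_mx intr (k : 'rV[int]_d)
  end.

Definition sqnorm K (xi : freq K) : R := \sum_(i < d) (freq_vec xi) 0 i ^+ 2.

Definition eucl K (xi : freq K) : R := Num.sqrt (sqnorm xi).

(* x . xi for K = R and 2 pi x . k for K = T *)
Definition phase K (xi : freq K) (x : 'rV[R]_d) : R :=
  (if K is TT then 2 * pi else 1) * \sum_(i < d) x 0 i * (freq_vec xi) 0 i.

(* The integral of f(x) exp(- i phase(x)), with f real-valued. *)
Definition fourier_integral K (f : 'rV[R]_d -> R) (xi : freq K) : R[i] :=
  Complex (\int[vol R K d]_x (f x * cos (phase xi x)))
          (- \int[vol R K d]_x (f x * sin (phase xi x))).

(* F is the Fourier transform of f in L^2(K^d). On T^d, L^2 is contained in L^1
   and F is given by the integral. On R^d, F is the L^2 limit of the Fourier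
   integrals of some functions of L^1 and L^2 converging to f in L^2
   (Plancherel). *)
Definition is_fourier K (f : 'rV[R]_d -> R) : (freq K -> R[i]) -> Prop :=
  match K return (freq K -> R[i]) -> Prop with
  | RR => fun F : 'rV[R]_d -> R[i] =>
      [/\ (fun xi => complex.Re (F xi)) \in Lfun (lebesgue_rV R d) 2%:E,
          (fun xi => complex.Im (F xi)) \in Lfun (lebesgue_rV R d) 2%:E &
          exists u : nat -> 'rV[R]_d -> R,
          [/\ forall n, u n \in Lfun (lebesgue_rV R d) 1%:E /\
                        u n \in Lfun (lebesgue_rV R d) 2%:E,
              Lnorm (lebesgue_rV R d) 2%:E (fun x => (u n x - f x)%:E)
                @[n --> \oo] --> 0%E &
              Lnorm (lebesgue_rV R d) 2%:E (fun xi =>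
                  (Normc.normc (@fourier_integral RR (u n) xi - F xi))%:E)
                @[n --> \oo] --> 0%E]]
  | TT => fun F => F = @fourier_integral TT f
  end.

End fourier.

Section symbols.
Context (R : realType) (d : nat).

Definition multi_index := 'I_d -> nat.

Definition mabs (mu : multi_index) : nat := (\sum_(i < d) mu i)%N.

Definition partials (l : seq 'I_d) (u : 'rV[R]_d -> R) : 'rV[R]_d -> R :=
  foldr (fun i v xi => 'D_(delta_mx 0 i) v xi) u l.

Definition smooth (u : 'rV[R]_d -> R) : Prop :=
  forall l : seq 'I_d, continuous (partials l u) /\
    (forall (i : 'I_d) xi, derivable (partials l u) xi (delta_mx 0 i)).

Definition partial (mu : multi_index) (p : 'rV[R]_d -> R[i]) : 'rV[R]_d -> R[i] :=
  let l := flatten [seq nseq (mu i) i | i <- enum 'I_d] in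
  fun xi => Complex (partials l (fun eta => complex.Re (p eta)) xi)
                    (partials l (fun eta => complex.Im (p eta)) xi).

(* The values of the gamma <= mu are at most |mu|_1. *)
Definition difference (mu : multi_index) (p : 'rV[int]_d -> R[i]) :
    'rV[int]_d -> R[i] := fun k =>
  \sum_(gamma : {ffun 'I_d -> 'I_(mabs mu).+1} | [forall i, gamma i <= mu i]%N)
    (-1) ^+ (\sum_(i < d) (mu i - gamma i))%N
    * (\prod_(i < d) 'C(mu i, gamma i))%N%:R
    * p (k + \row_i (gamma i : nat)%:Z).

Definition symbol_diff K (mu : multi_index) :
    (freq R d K -> R[i]) -> freq R d K -> R[i] :=
  match K return (freq R d K -> R[i]) -> freq R d K -> R[i] with
  | RR => partial mu
  | TT => difference mu
  end.

Definition symbol_smooth K : (freq R d K -> R[i]) -> Prop :=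
  match K return (freq R d K -> R[i]) -> Prop with
  | RR => fun p : 'rV[R]_d -> R[i] =>
      smooth (fun xi => complex.Re (p xi)) /\ smooth (fun xi => complex.Im (p xi))
  | TT => fun=> True
  end.

Definition seminorm K (r : R) (mu : multi_index) (p : freq R d K -> R[i]) :
    \bar R :=
  ereal_sup (range (fun xi : freq R d K =>
    (Normc.normc (symbol_diff mu p xi)
      * (1 + eucl xi) `^ (- (r - (mabs mu)%:R)))%:E)).

Definition S0 K (r : R) : set (freq R d K -> R[i]) :=
  [set p | [/\ symbol_smooth p,
               forall xi, p (- xi) = conjc (p xi) &
               forall mu, (seminorm r mu p < +oo)%E]].

End symbols.

Section operators.
Context (R : realType) (K : base_space) (d : nat).
Implicit Types p : freq R d K -> R[i].

Definition operator := ('rV[R]_d -> R) -> 'rV[R]_d -> R.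

(* h is the image of f under the multiplier with symbol p, seen as an operator
   of L^2 with its maximal domain. *)
Definition is_multiplier p (f h : 'rV[R]_d -> R) : Prop :=
  [/\ L2 K f, L2 K h &
      exists F, is_fourier f F /\ is_fourier h (fun xi => p xi * F xi)].

(* A representative of the image, which is determined up to equality almost
   everywhere; the value outside the domain is irrelevant. *)
Definition OP p : operator :=
  fun f => xget (fun=> 0) [set h | is_multiplier p f h].

(* {T_k} is included in OP S_0^r and bounded. *)
Definition bounded_OPS0 (r : R) (T : nat -> operator) : Prop :=
  exists p : nat -> freq R d K -> R[i],
    [/\ forall k, S0 r (p k),
        forall mu, exists B : R, forall k, (seminorm r mu (p k) <= B%:E)%E &
        forall k, T k = OP (p k)].

Definition bessel (s : R) : freq R d K -> R[i] :=
  fun xi => Complex ((1 + sqnorm xi) `^ (s / 2)) 0.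

(* H^s(K^d; R^m) for s >= 0: the f in L^2 such that D^s f is in L^2. *)
Definition Hs m (s : R) : set (vfun R d m) :=
  [set f | forall i, exists h, is_multiplier (bessel s) (f i) h].

Definition norm_Hs m (s : R) (f : vfun R d m) : R :=
  norm_L2 K (fun i => OP (bessel s) (f i)).

Definition diag_op m (T : 'I_m -> operator) (f : vfun R d m) : vfun R d m :=
  fun i => T i (f i).

Definition scalar_op m (T : operator) (f : vfun R d m) : vfun R d m :=
  fun i => T (f i).

Definition scale_op m (a : 'I_m -> R) (T : vfun R d m -> vfun R d m)
    (f : vfun R d m) : vfun R d m :=
  fun i x => a i * T f i x.

Definition sub_op m (S T : vfun R d m -> vfun R d m) (f : vfun R d m) :
    vfun R d m :=
  fun i x => S f i x - T f i x.

(* The L^2-adjoint T^* of T with domain D: g is in the domain of T^* and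
   h = T^* g. *)
Definition adjoint_rel m (D : set (vfun R d m)) (T : vfun R d m -> vfun R d m)
    (g h : vfun R d m) : Prop :=
  [/\ L2v K g, L2v K h & forall f, D f -> ip K (T f) g = ip K f h].

End operators.

Definition sqnorm_l2 (R : realType) m (a : nat -> 'I_m -> R) : \bar R :=
  (\sum_(k <oo) (\sum_(i < m) a k i ^+ 2)%:E)%E.

(* Main.v *)
From HB Require Import structures.
Require Import Defs.
From mathcomp Require Import all_boot all_order all_algebra complex.
From mathcomp Require Import all_classical all_reals all_analysis.
From mathcomp Require Import ring lra measurable_realfun.

Set Implicit Arguments.
Unset Strict Implicit.
Unset Printing Implicit Defensive.
Import Order.TTheory GRing.Theory Num.Theory.
Import numFieldNormedType.Exports.

Local Open Scope classical_set_scope.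
Local Open Scope ring_scope.

(* Put phi = P_n f_i and drop the indices. Fourier multipliers commute, so P_n A f = A phi, and
   the adjoint relation A^* = M - A gives 2 <A phi, phi> = <phi, M phi> and
   <A A phi, phi> + <A phi, A phi> = <A phi, M phi>. Moreover M = A + A^* is symmetric and
   commutes with A, whence 2 <A phi, M phi> = <M phi, M phi>. Both quantities lose no
   derivative: M has order 0, so they are at most a constant times |phi|^2 <= C |f_i|_{H^s}^2, and
   the weights a_{k,i}, respectively a_{k,i}^2, are summed with Cauchy-Schwarz.

   Commutation and boundedness of multipliers rest on the L^2 theory of the Fourier transform.
   On R^d, the transform is isometric up to a constant on indicators of boxes (in one dimension,
   by polarization from the integral of (1 - cos(t xi)) / xi^2, which is proportional to |t|),
   hence on L^2 by density; it is onto because the Hartley transform, with kernel cos + sin, is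
   symmetric. On T^d, coefficients are determined by orthogonality and realized by the
   Riesz-Fischer theorem; they determine the function because indicators of boxes are bounded
   limits of trigonometric polynomials, built from (1 - y^n)^(n 2^n), which tends to the indicator
   of y < 1/2 on [0, 1]. *)

(** * Square-integrable functions *)

(** Instead, every function of the argument is described by its symbol relative to one fixed
    transform F of f_i, and functions with equal symbols are exchanged inside inner products.
    Whether a composition is defined is a matter of orders: a symbol of order at most t is dominated
    by (1 + |xi|^2)^(t/2), hence attained on H^t. This is where s + alpha and s + 2 alpha enter: A A
    P_n f must lie in L^2, although the final bounds see the H^s norm alone.

    All functions are real, so a transform is a pair: an even cosine part and an odd sine part. The
    symmetry p(-xi) = conj p(xi) preserves this parity, and the multiplier theory needs surjectivity
    onto such pairs (on T^d, onto Hermitian coefficients). The Hartley transform packs the pair into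
    one real function, and parity unpacks it.

    The adjoint relation is given for vector-valued functions; testing it on functions with one
    nonzero component makes it scalar. *)

Section square_integrable.
Context d (T : measurableType d) (R : realType) (mu : {measure set T -> \bar R}).
Implicit Types f g h : T -> R.

Local Notation sq := (Lfun mu 2%:E).

Lemma Lfun2P f : f \in sq <-> measurable_fun setT f /\
  mu.-integrable setT (EFin \o (fun x => f x ^+ 2)).
Proof.
split=> [fL|[mf intf]].
  split; last exact: Lfun2_integrable_sqr.
  by move: fL; rewrite inE => /andP[/[!inE]].
rewrite inE; apply/andP; split; rewrite inE//= /finite_norm unlock /Lnorm.
rewrite poweR_lty//; move/integrableP : intf => [_]; apply: le_lt_trans.
by rewrite le_eqVlt; apply/orP; left; apply/eqP/eq_integral => x _ /=; rewrite powR_mulrn// normrX.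
Qed.

Lemma Lfun2_measurable f : f \in sq -> measurable_fun setT f.
Proof. by case/Lfun2P. Qed.

Let one_le_two : (1 <= 2%:E :> \bar R)%E.
Proof. by rewrite lee_fin ler1n. Qed.

Lemma Lfun2D f g : f \in sq -> g \in sq -> (fun x => f x + g x) \in sq.
Proof. exact: (Lfun_addr_closed mu one_le_two).2. Qed.

Lemma Lfun2Z f (c : R) : f \in sq -> (fun x => c * f x) \in sq.
Proof.
move=> /(@Lfun_scale _ _ _ mu f c 2); rewrite ler1n => /(_ isT).
by rewrite (_ : c \o* f = fun x => c * f x)//; apply/funext => x /=; rewrite mulrC.
Qed.

Lemma Lfun2B f g : f \in sq -> g \in sq -> (fun x => f x - g x) \in sq.
Proof.
move=> fL gL; rewrite (_ : (fun x => _) = fun x => f x + -1 * g x).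
  exact: Lfun2D fL (Lfun2Z (-1) gL).
by apply/funext => x; rewrite mulN1r.
Qed.

Lemma Lfun2_0 : (fun=> 0) \in sq.
Proof. exact: (Lfun_addr_closed mu one_le_two).1. Qed.

Lemma Lfun2_sum I (s : seq I) (F : I -> T -> R) :
  (forall i, F i \in sq) -> (fun x => \sum_(i <- s) F i x) \in sq.
Proof.
move=> FL; elim: s => [|i s IH].
  by under [X in X \in _]eq_fun do rewrite big_nil; exact: Lfun2_0.
under [X in X \in _]eq_fun do rewrite big_cons.
exact: Lfun2D.
Qed.

Lemma le_Lfun2 f g : measurable_fun setT f -> g \in sq ->
  (forall x, `|f x| <= `|g x|) -> f \in sq.
Proof.
move=> mf /Lfun2P[mg ig] fg; apply/Lfun2P; split=> //.
apply: le_integrable ig => //.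
  by apply/measurable_EFinP; exact: measurable_funX.
by move=> x _ /=; rewrite lee_fin !normrX lerXn2r// nnegrE.
Qed.

Definition dot f g : R := \int[mu]_x (f x * g x).

Lemma dot_integrable f g : f \in sq -> g \in sq ->
  mu.-integrable setT (EFin \o (fun x => f x * g x)).
Proof. by move=> fL gL; apply/Lfun1_integrable; exact: Lfun2_mul_Lfun1. Qed.

Lemma dotC f g : dot f g = dot g f.
Proof. by rewrite /dot; under eq_Rintegral do rewrite mulrC. Qed.

Lemma dotDl f g h : f \in sq -> g \in sq -> h \in sq ->
  dot (fun x => f x + g x) h = dot f h + dot g h.
Proof.
move=> fL gL hL; rewrite /dot; under eq_Rintegral do rewrite mulrDl.
by rewrite RintegralD//; exact: dot_integrable.
Qed.

Lemma dotDr f g h : f \in sq -> g \in sq -> h \in sq ->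
  dot h (fun x => f x + g x) = dot h f + dot h g.
Proof. by move=> *; rewrite dotC dotDl// !(dotC h). Qed.

Lemma dotZl c f g : f \in sq -> g \in sq ->
  dot (fun x => c * f x) g = c * dot f g.
Proof.
move=> fL gL; rewrite /dot; under eq_Rintegral do rewrite -mulrA.
by rewrite RintegralZl//; exact: dot_integrable.
Qed.

Lemma dotZr c f g : f \in sq -> g \in sq ->
  dot g (fun x => c * f x) = c * dot g f.
Proof. by move=> *; rewrite dotC dotZl// dotC. Qed.

Lemma dotBl f g h : f \in sq -> g \in sq -> h \in sq ->
  dot (fun x => f x - g x) h = dot f h - dot g h.
Proof.
move=> fL gL hL; rewrite /dot; under eq_Rintegral do rewrite mulrBl.
by rewrite RintegralB//; exact: dot_integrable.
Qed.

Lemma dotBr f g h : f \in sq -> g \in sq -> h \in sq ->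
  dot h (fun x => f x - g x) = dot h f - dot h g.
Proof. by move=> *; rewrite dotC dotBl// !(dotC h). Qed.

Lemma dot0l g : dot (fun=> 0) g = 0.
Proof.
by rewrite /dot; under eq_Rintegral do rewrite mul0r; rewrite Rintegral_cst// mul0r.
Qed.

Lemma dot0r g : dot g (fun=> 0) = 0.
Proof. by rewrite dotC dot0l. Qed.

Lemma dot_suml I (s : seq I) (F : I -> T -> R) g :
  (forall i, F i \in sq) -> g \in sq ->
  dot (fun x => \sum_(i <- s) F i x) g = \sum_(i <- s) dot (F i) g.
Proof.
move=> FL gL; elim: s => [|i s IH].
  by rewrite big_nil -[RHS](dot0l g); congr dot; apply/funext => x; rewrite big_nil.
rewrite big_cons -IH -dotDl//; last exact: Lfun2_sum.
by congr dot; apply/funext => x; rewrite big_cons.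
Qed.

Lemma dot_sumr I (s : seq I) (F : I -> T -> R) g :
  (forall i, F i \in sq) -> g \in sq ->
  dot g (fun x => \sum_(i <- s) F i x) = \sum_(i <- s) dot g (F i).
Proof.
by move=> FL gL; rewrite dotC dot_suml//; apply: eq_bigr => i _; exact: dotC.
Qed.

Lemma dot_ge0 f : 0 <= dot f f.
Proof. by apply: Rintegral_ge0 => x _; rewrite -expr2 sqr_ge0. Qed.

Lemma dotE f : f \in sq -> (dot f f)%:E = (\int[mu]_x (f x ^+ 2)%:E)%E.
Proof.
move=> fL; rewrite /dot /Rintegral fineK.
  by apply: eq_integral => x _; rewrite expr2.
by apply: integrable_fin_num => //; exact: dot_integrable.
Qed.

Lemma dotBB f g : f \in sq -> g \in sq ->
  dot (fun x => f x - g x) (fun x => f x - g x) =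
  dot f f - 2 * dot f g + dot g g.
Proof.
move=> fL gL; rewrite dotBl ?Lfun2B// !dotBr// (dotC g f).
ring.
Qed.

Lemma dotDD f g : f \in sq -> g \in sq ->
  dot (fun x => f x + g x) (fun x => f x + g x) =
  dot f f + 2 * dot f g + dot g g.
Proof.
move=> fL gL; rewrite dotDl ?Lfun2D// !dotDr// (dotC g f).
ring.
Qed.

Lemma dotDD_le f g : f \in sq -> g \in sq ->
  dot (fun x => f x + g x) (fun x => f x + g x) <= 2 * dot f f + 2 * dot g g.
Proof.
move=> fL gL; have := dot_ge0 (fun x => f x - g x).
by rewrite dotBB// dotDD//; lra.
Qed.

Lemma cauchy_schwarz f g : f \in sq -> g \in sq ->
  dot f g ^+ 2 <= dot f f * dot g g.
Proof.
move=> fL gL.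
have q t : 0 <= dot f f - 2 * t * dot f g + t ^+ 2 * dot g g.
  have := dot_ge0 (fun x => f x - t * g x).
  rewrite dotBB// ?Lfun2Z// dotZr// dotZl// ?Lfun2Z// dotZr//.
  by congr (_ <= _); ring.
have [g0|g0] := eqVneq (dot g g) 0.
  rewrite g0 mulr0; have [->|fg0] := eqVneq (dot f g) 0; first by rewrite expr0n.
  (* With |g| = 0 the quadratic is affine in t; at this t its value is -1. *)
  have := q ((dot f f + 1) / (2 * dot f g)).
  rewrite g0 mulr0 addr0 (_ : _ * _ * _ = dot f f + 1); last by field.
  by move=> ?; exfalso; lra.
have gp : 0 < dot g g by rewrite lt_neqAle eq_sym g0 dot_ge0.
(* The minimizer of the quadratic q. *)
have := q (dot f g / dot g g).
rewrite (_ : _ - _ + _ = (dot f f * dot g g - dot f g ^+ 2) / dot g g); last by field.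
by rewrite pmulr_lge0 ?invr_gt0// subr_ge0.
Qed.

Lemma eq_ae_dot f f' g : f \in sq -> f' \in sq -> g \in sq ->
  f = f' %[ae mu] -> dot f g = dot f' g.
Proof.
move=> fL f'L gL ff'; congr fine; apply: ae_eq_integral => //.
- by case/integrableP: (dot_integrable fL gL).
- by case/integrableP: (dot_integrable f'L gL).
- by apply: filterS ff' => x /= + _ => /(_ Logic.I) ->.
Qed.

Lemma dot0_ae f : f \in sq -> dot f f = 0 -> f = (fun=> 0) %[ae mu].
Proof.
move=> fL f0; have [mf _] := (Lfun2P f).1 fL.
have /ae_eq_integral_abs : (\int[mu]_x `|(f x ^+ 2)%:E| = 0)%E.
  rewrite -[RHS]/(0%:E) -f0 dotE//; apply: eq_integral => x _.
  by rewrite gee0_abs// lee_fin sqr_ge0.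
move=> /(_ measurableT) H.
have {}H : ae_eq mu setT (EFin \o (fun x => f x ^+ 2)) (cst 0%E).
  by apply: H; apply/measurable_EFinP; exact: measurable_funX.
apply: filterS H => x /= + _ => /(_ Logic.I) /eqP.
by rewrite eqe sqrf_eq0 => /eqP.
Qed.

End square_integrable.

Lemma cvg0_le (R : realType) (x y : nat -> R) : (forall n, `|x n| <= y n) ->
  y @ \oo --> (0 : R) -> x @ \oo --> (0 : R).
Proof.
move=> xy y0; apply/norm_cvg0P.
apply: (@squeeze_cvgr _ _ _ _ (fun=> 0) y) => //; last exact: cvg_cst.
by near=> n; rewrite normr_ge0 xy.
Unshelve. all: by end_near. Qed.

Lemma cvg0_sqr_le (R : realType) (x y : nat -> R) :
  (forall n, x n ^+ 2 <= y n) -> y @ \oo --> (0 : R) -> x @ \oo --> (0 : R).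
Proof.
move=> xy y0; apply: (@cvg0_le _ _ (fun n => Num.sqrt (y n))).
  by move=> n; rewrite -sqrtr_sqr ler_sqrt// (le_trans _ (xy n))// sqr_ge0.
rewrite -sqrtr0.
by apply: (@cvg_comp _ _ _ y Num.sqrt _ _ _ y0); exact: sqrt_continuous.
Qed.

(** * Convergence and completeness in L^2 *)

Section L2_limits.
Context d (T : measurableType d) (R : realType) (mu : {measure set T -> \bar R}).
Implicit Types (f g : T -> R) (u v : nat -> T -> R).

Local Notation sq := (Lfun mu 2%:E).
Local Notation dot := (dot mu).

Definition cvg2 u f :=
  (fun n => dot (fun x => u n x - f x) (fun x => u n x - f x)) @ \oo --> (0 : R).

Definition cauchy2 u := forall e, 0 < e -> exists N, forall m n, (N <= m)%N ->
  (N <= n)%N -> dot (fun x => u m x - u n x) (fun x => u m x - u n x) <= e.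

Lemma dotBBC f g : dot (fun x => f x - g x) (fun x => f x - g x) =
  dot (fun x => g x - f x) (fun x => g x - f x).
Proof. by apply: eq_Rintegral => x _; ring. Qed.

Lemma cvg2_cauchy u f : (forall n, u n \in sq) -> f \in sq -> cvg2 u f ->
  cauchy2 u.
Proof.
move=> uL fL uf e e0.
have e4 : 0 < e / 4 by rewrite divr_gt0.
have /cvgr0Pnorm_le/(_ _ e4)[N _ NP] := uf.
exists N => m n Nm Nn.
have := dotDD_le (Lfun2B (uL m) fL) (Lfun2B fL (uL n)).
under [X in dot X _]eq_fun do rewrite subrKA.
under [X in dot _ X]eq_fun do rewrite subrKA.
move=> /le_trans; apply; rewrite (dotBBC f).
by have := NP _ Nm; have := NP _ Nn; rewrite /= !ger0_norm ?dot_ge0//; lra.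
Qed.

(** Applied with v a sequence of transforms and c the Plancherel constant: the isometry carries
    Cauchy sequences to Cauchy sequences. *)
Lemma cauchy2_dominated u v (c : R) : 0 < c ->
  (forall m n, dot (fun x => v m x - v n x) (fun x => v m x - v n x) <=
    c * dot (fun x => u m x - u n x) (fun x => u m x - u n x)) ->
  cauchy2 u -> cauchy2 v.
Proof.
move=> c0 uv uc e e0; have [N NP] := uc _ (divr_gt0 e0 c0).
exists N => m n Nm Nn; apply: le_trans (uv m n) _.
by rewrite mulrC -ler_pdivlMr// NP.
Qed.

Lemma cvg2_dot u v f g : (forall n, u n \in sq) -> (forall n, v n \in sq) ->
  f \in sq -> g \in sq -> cvg2 u f -> cvg2 v g ->
  (fun n => dot (u n) (v n)) @ \oo --> dot f g.
Proof.
move=> uL vL fL gL uf vg.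
have dL n := Lfun2B (uL n) fL; have eL n := Lfun2B (vL n) gL.
(* Bilinear expansion around (f, g); Cauchy-Schwarz then kills the three error terms. *)
have -> : (fun n => dot (u n) (v n)) = (fun n => dot f g +
    (dot (fun x => u n x - f x) (fun x => v n x - g x) +
     dot (fun x => u n x - f x) g + dot f (fun x => v n x - g x))).
  apply/funext => n; rewrite dotBl// ?dotBr// dotBl//; ring.
rewrite -[X in _ --> X]addr0; apply: cvgD; first exact: cvg_cst.
rewrite -[X in _ --> X](addr0 0); apply: cvgD; last first.
  apply: (cvg0_sqr_le (fun n => cauchy_schwarz fL (eL n))).
  by rewrite -(mulr0 (dot f f)); apply: cvgMr.
rewrite -[X in _ --> X](addr0 0); apply: cvgD; last first.
  apply: (cvg0_sqr_le (fun n => cauchy_schwarz (dL n) gL)).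
  by rewrite -(mul0r (dot g g)); apply: cvgMl.
apply: (cvg0_sqr_le (fun n => cauchy_schwarz (dL n) (eL n))).
by rewrite -(mulr0 0); exact: cvgM.
Qed.

Lemma cvg2_cst f : cvg2 (fun=> f) f.
Proof.
rewrite /cvg2 (_ : (fun x => f x - f x) = fun=> 0); last first.
  by apply/funext => x; rewrite subrr.
by rewrite dot0l; exact: cvg_cst.
Qed.

Lemma cvg2D u v f g : (forall n, u n \in sq) -> (forall n, v n \in sq) ->
  f \in sq -> g \in sq -> cvg2 u f -> cvg2 v g ->
  cvg2 (fun n x => u n x + v n x) (fun x => f x + g x).
Proof.
move=> uL vL fL gL uf vg; rewrite /cvg2.
apply: (@cvg0_le _ _ (fun n =>
  2 * dot (fun x => u n x - f x) (fun x => u n x - f x) +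
  2 * dot (fun x => v n x - g x) (fun x => v n x - g x))); last first.
  rewrite -[X in _ --> X](addr0 0); apply: cvgD; rewrite -(mulr0 2);
  by apply: cvgMr.
move=> n; rewrite ger0_norm ?dot_ge0//.
apply: le_trans (dotDD_le (Lfun2B (uL n) fL) (Lfun2B (vL n) gL)).
by rewrite le_eqVlt; apply/orP; left; apply/eqP/eq_Rintegral => x _; ring.
Qed.

Lemma cvg2Z c u f : (forall n, u n \in sq) -> f \in sq -> cvg2 u f ->
  cvg2 (fun n x => c * u n x) (fun x => c * f x).
Proof.
move=> uL fL uf; rewrite /cvg2.
rewrite (_ : (fun _ => _) = (fun n => c ^+ 2 *
    dot (fun x => u n x - f x) (fun x => u n x - f x))); last first.
  apply/funext => n; have dL := Lfun2B (uL n) fL.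
  transitivity (dot (fun x => c * (u n x - f x)) (fun x => c * (u n x - f x))).
    by apply: eq_Rintegral => x _; ring.
  by rewrite dotZl ?Lfun2Z// dotZr// mulrA expr2.
by rewrite -(mulr0 (c ^+ 2)); apply: cvgMr.
Qed.

(** Fatou along the subsequence: for fixed n, the squared distance from [u n] to v is at most the
    lower limit of the squared distances from [u n] to [u (phi m)], which the Cauchy condition
    bounds. Besides completeness, this identifies an L^2 limit with a limit known pointwise. *)
Lemma cvg2_fatou u (v : T -> R) (phi : nat -> nat) : (forall n, u n \in sq) -> cauchy2 u ->
  (forall n, (n <= phi n)%N) -> measurable_fun setT v ->
  {ae mu, forall x, u (phi n) x @[n --> \oo] --> v x} ->
  v \in sq /\ cvg2 u v.
Proof.
move=> uL uc phin mv uv.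
have mu_ n : measurable_fun setT (u n) by exact: (Lfun2_measurable (uL n)).
have key e N : 0 < e -> (forall m n, (N <= m)%N -> (N <= n)%N ->
    dot (fun x => u m x - u n x) (fun x => u m x - u n x) <= e) ->
    forall n, (N <= n)%N ->
    (\int[mu]_x ((u n x - v x) ^+ 2)%:E <= e%:E)%E.
  move=> e0 NP n Nn.
  (* The shift by N puts every index [phi (m + N)] past N, so that the bound e holds for all m. *)
  pose F m x := ((u n x - u (phi (m + N)%N) x) ^+ 2)%:E.
  have mF m : measurable_fun setT (F m).
    by apply/measurable_EFinP; apply: measurable_funX; exact: measurable_funB.
  have F0 m x : setT x -> (0 <= F m x)%E by rewrite lee_fin sqr_ge0.
  apply: (@le_trans _ _ (\int[mu]_x limn_einf (F^~ x))%E).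
    apply: ae_ge0_le_integral => //.
    - by move=> x _; rewrite lee_fin sqr_ge0.
    - by apply/measurable_EFinP; apply: measurable_funX; exact: measurable_funB.
    - move=> x _; rewrite limn_einf_lim; apply: lime_ge; first exact: is_cvg_einfs.
      by near=> m; apply: le_ereal_inf_tmp => _ [k /= _ <-]; exact: F0.
    - under eq_fun do rewrite limn_einf_lim.
      apply: (emeasurable_fun_cvg (fun m x => einfs (F^~ x) m)).
        exact: measurable_fun_einfs.
      by move=> x _; exact: is_cvg_einfs.
    - apply: filterS uv => x ux _.
      have /cvg_limn_einf_sup[-> _] // : F ^~ x @ \oo --> ((u n x - v x) ^+ 2)%:E.
      apply: cvg_EFin; first by near=> m.
      have {}ux : u (phi (m + N)%N) x @[m --> \oo] --> v x.
        by rewrite (cvg_shiftn N (fun m => u (phi m) x)).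
      rewrite /comp/= (_ : (fun _ => _) =
        (fun m => (u n x - u (phi (m + N)%N) x) * (u n x - u (phi (m + N)%N) x)));
        last by apply/funext => m; rewrite expr2.
      by rewrite expr2; apply: cvgM; apply: cvgB => //; exact: cvg_cst.
  apply: le_trans (fatou _ measurableT mF F0) _.
  rewrite limn_einf_lim; apply: lime_le; first exact: is_cvg_einfs.
  near=> m; apply: ereal_inf_le; exists (\int[mu]_x F m x)%E; first by exists m => /=.
  rewrite -dotE ?Lfun2B// lee_fin NP// (leq_trans _ (phin _))//.
  by rewrite leq_addl.
have vL : v \in sq.
  have [N NP] := uc 1 ltr01.
  have mw : measurable_fun setT (fun x => u N x - v x) by exact: measurable_funB.
  have wL : (fun x => u N x - v x) \in sq.
    apply/Lfun2P; split=> //; apply/integrableP; split.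
      by apply/measurable_EFinP; exact: measurable_funX.
    apply: le_lt_trans (ltry 1); apply: le_trans (key _ _ ltr01 NP _ (leqnn N)).
    rewrite le_eqVlt; apply/orP; left; apply/eqP/eq_integral => x _ /=.
    by rewrite ger0_norm// sqr_ge0.
  rewrite (_ : v = fun x => u N x - (u N x - v x)); first exact: Lfun2B.
  by apply/funext => x; rewrite subKr.
split=> //; apply/cvgr0Pnorm_le => e e0; have [N NP] := uc _ e0.
exists N => // n /= Nn; rewrite ger0_norm ?dot_ge0//.
by rewrite -lee_fin dotE ?Lfun2B//; exact: key NP _ _.
Unshelve. all: by end_near. Qed.

End L2_limits.

Section L2_complete.
Context d (T : measurableType d) (R : realType) (mu : {measure set T -> \bar R}).
Local Notation sq := (Lfun mu 2%:E).
Local Notation dot := (dot mu).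

Let a (k : nat) : R := 2^-1 ^+ k.

Let a_gt0 k : 0 < a k. Proof. by rewrite exprn_gt0// invr_gt0. Qed.

Let sum_a n : \sum_(k < n) a k <= 2.
Proof.
suff -> : \sum_(k < n) a k = 2 - 2 * a n by rewrite gerBl mulr_ge0// ltW.
elim: n => [|n IH]; first by rewrite big_ord0 /a expr0 mulr1 subrr.
by rewrite big_ord_recr/= IH /a exprS; field.
Qed.

Let fast_subsequence (u : nat -> T -> R) : cauchy2 mu u ->
  exists phi : nat -> nat, (forall n, (n <= phi n)%N) /\
    forall k, dot (fun x => u (phi k.+1) x - u (phi k) x)
                  (fun x => u (phi k.+1) x - u (phi k) x) <= a k ^+ 2.
Proof.
move=> uc.
have /choice[N NP] : forall k, exists N, forall m n, (N <= m)%N -> (N <= n)%N ->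
    dot (fun x => u m x - u n x) (fun x => u m x - u n x) <= a k ^+ 2.
  by move=> k; apply: uc; rewrite exprn_gt0.
(* Cumulative sums are strictly increasing and lie above each [N k]. *)
pose phi n := (\sum_(k < n.+1) (N k).+1)%N.
have phiS n : phi n.+1 = (phi n + (N n.+1).+1)%N by rewrite /phi big_ord_recr.
have phiN k : (N k <= phi k)%N.
  by rewrite /phi big_ord_recr/=; apply: leq_trans (leq_addl _ _).
exists phi; split=> [n|k].
  by elim: n => // n IH; rewrite phiS addnS ltnS (leq_trans IH)// leq_addr.
by apply: NP => //; rewrite phiS (leq_trans (phiN k))// leq_addr.
Qed.

(* The limit at x is computed from the values at x alone, so it inherits the
   symmetries of the sequence. *)
Lemma L2_complete (u : nat -> T -> R) : (forall n, u n \in sq) ->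
  cauchy2 mu u -> exists Phi : (nat -> R) -> R,
    (fun x => Phi (u ^~ x)) \in sq /\ cvg2 mu u (fun x => Phi (u ^~ x)).
Proof.
move=> uL uc.
have [phi [phin phiP]] := fast_subsequence uc.
pose delta (s : nat -> R) k := s (phi k.+1) - s (phi k).
(* Squared increments weighted by 1 / a_k. Along u, the integral of G is at most the sum of the a_k,
   so G is finite almost everywhere; where it is finite, |delta| <= a + delta^2 / a makes the
   increments absolutely summable. *)
pose G (s : nat -> R) := (\sum_(k <oo) (delta s k ^+ 2 / a k)%:E)%E.
pose Phi (s : nat -> R) : R :=
  if (G s < +oo)%E then limn (fun n => s (phi n)) else 0.
have cvgPhi s : (G s < +oo)%E -> s (phi n) @[n --> \oo] --> Phi s.
  move=> Gs; rewrite /Phi Gs.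
  have -> : (fun n => s (phi n)) = (fun n => s (phi 0%N) + series (delta s) n).
    apply/funext => n; rewrite /series/= telescope_sumr//.
    by rewrite addrC subrK.
  suff /normed_cvg cvs : cvgn [normed series (delta s)].
    apply: cvgP; apply: cvgD; first exact: cvg_cst.
    exact: cvs.
  apply: nondecreasing_is_cvgn.
    by apply: nondecreasing_series => k _ _; exact: normr_ge0.
  exists (2 + fine (G s)) => _ [n _ <-].
  rewrite [leLHS](_ : _ = \sum_(0 <= k < n) `|delta s k|)// big_mkord.
  apply: (@le_trans _ _ (\sum_(k < n) (a k + delta s k ^+ 2 / a k))).
    apply: ler_sum => k _.
    have := sqr_ge0 (`|delta s k| - a k); rewrite sqrrB real_normK ?num_real//.
    rewrite -(ler_pM2r (a_gt0 k)) mulrDl mulfVK ?gt_eqF//.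
    have := a_gt0 k; have := normr_ge0 (delta s k); nra.
  rewrite big_split/=; apply: lerD; first exact: sum_a.
  rewrite -lee_fin fineK.
    rewrite -sumEFin; have := @nneseries_lim_ge _ (fun k => (delta s k ^+ 2 / a k)%:E) xpredT 0%N n.
    rewrite /= big_mkord; apply=> k _.
    by rewrite lee_fin mulr_ge0 ?sqr_ge0// invr_ge0 ltW.
  rewrite ge0_fin_numE//; apply: nneseries_ge0 => k _ _.
  by rewrite lee_fin mulr_ge0 ?sqr_ge0// invr_ge0 ltW.
have mu_ n : measurable_fun setT (u n) by exact: Lfun2_measurable (uL n).
have mt k : measurable_fun setT (fun x => (delta (u ^~ x) k ^+ 2 / a k)%:E).
  apply/measurable_EFinP; apply: measurable_funM => //.
  by apply: measurable_funX; exact: measurable_funB.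
have t0 k x : (0 <= (delta (u ^~ x) k ^+ 2 / a k)%:E)%E.
  by rewrite lee_fin mulr_ge0 ?sqr_ge0// invr_ge0 ltW.
have mG : measurable_fun setT (fun x => G (u ^~ x)).
  by apply: ge0_emeasurable_sum => //.
pose A := [set x | (G (u ^~ x) < +oo)%E].
have mA : measurable A.
  by rewrite -[A]setTI; exact: emeasurable_fun_infty_o.
have mPhi : measurable_fun setT (fun x => Phi (u ^~ x)).
  (* The factor \1_A makes the sequence converge everywhere, to [Phi] with its default value 0 off
     A. *)
  apply: (@measurable_fun_cvg _ _ _ _ (fun n x => \1_A x * u (phi n) x)).
    by move=> m; apply: measurable_funM.
  move=> x _; have [Gx|Gx] := boolP (G (u ^~ x) < +oo)%E.
    have -> : (fun n => \1_A x * u (phi n) x) = fun n => u (phi n) x.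
      apply/funext => n.
      by rewrite indicE mem_set// mul1r.
    exact: cvgPhi.
  rewrite /Phi (negbTE Gx).
  have -> : (fun n => \1_A x * u (phi n) x) = fun=> 0.
    by apply/funext => n; rewrite indicE memNset ?mul0r//=; exact/negP.
  exact: cvg_cst.
have aeG : {ae mu, forall x, setT x -> G (u ^~ x) \is a fin_num}.
  apply: integrable_ae => //; apply/integrableP; split=> //.
  have -> : (\int[mu]_x `|G (u ^~ x)| = \int[mu]_x G (u ^~ x))%E.
    by apply: eq_integral => x _; rewrite gee0_abs// nneseries_ge0.
  rewrite integral_nneseries//.
  have sa : (\sum_(k <oo) (a k)%:E <= 2%:E)%E.
    apply: lime_le; first by apply: is_cvg_nneseries => k _ _; rewrite lee_fin ltW.
    by near=> n; rewrite big_mkord sumEFin lee_fin.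
  apply: le_lt_trans (ltry 2); apply: le_trans sa.
  apply: lee_nneseries => [k _ _|k _]; first by apply: integral_ge0 => x _; exact: t0.
  have dL : (fun x => delta (u ^~ x) k) \in sq by exact: Lfun2B.
  under eq_integral do rewrite EFinM muleC.
  rewrite ge0_integralZl_EFin//.
  - rewrite -dotE// -EFinM lee_fin ler_pdivrMl// -expr2.
    exact: phiP.
  - by move=> x _; rewrite lee_fin sqr_ge0.
  - by apply/measurable_EFinP; apply: measurable_funX; exact: Lfun2_measurable dL.
  - by rewrite invr_ge0 ltW.
exists Phi; apply: (cvg2_fatou uL uc phin mPhi).
apply: filterS aeG => x /(_ Logic.I) Gx; apply: cvgPhi.
by rewrite ltey_eq Gx.
Unshelve. all: by end_near. Qed.

End L2_complete.

(** * Integration on R^d *)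

Section lebesgue_rV_theory.
Context (R : realType).

Definition cube d (n : nat) : set 'rV[R]_d :=
  [set x | forall i, `]- n%:R, n%:R]%classic (x 0 i)].

Lemma measurable_cube d n : measurable (@cube d n).
Proof. by apply: (@measurable_box R d (fun=> `]- n%:R, n%:R]%classic)). Qed.

Lemma lebesgue_cube_lty d n : (lebesgue_rV R d (@cube d n) < +oo)%E.
Proof.
rewrite (@lebesgue_rV_box R d (fun=> `]- n%:R, n%:R]%classic))//.
rewrite (eq_bigr (fun=> (n%:R - - n%:R)%:E)); last first.
  move=> i _; rewrite lebesgue_measure_itv/= lte_fin; case: ltP => // n0.
  congr EFin; suff -> : n%:R = 0 :> R by rewrite oppr0 subr0.
  by apply/eqP; rewrite eq_le ler0n andbT; lra.
by rewrite prodEFin ltry.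
Qed.

Lemma bigcup_cube d : \bigcup_n (@cube d n) = setT.
Proof.
apply/seteqP; split=> // x _.
pose N := (\sum_(i < d) Num.bound `|x 0%R i|%R)%N.
exists N => // i /=.
have xi : `|x 0 i| < N%:R.
  rewrite /N (bigD1 i)//= natrD ltr_wpDr//.
  exact: archi_boundP.
by move: xi; rewrite in_itv/= ltr_norml => /andP[-> /ltW].
Qed.

Lemma sigma_finite_lebesgue_rV d : sigma_finite setT (lebesgue_rV R d).
Proof.
exists (@cube d); first by rewrite bigcup_cube.
by move=> n; split; [exact: measurable_cube|exact: lebesgue_cube_lty].
Qed.

(* [lebesgue_rV] is a bundled measure, which blocks further instances; this
   unbundled copy carries the sigma-finite structure. *)
Definition lebesgue_sf d : set 'rV[R]_d -> \bar R := lebesgue_rV R d.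

HB.instance Definition _ d := isMeasure.Build _ _ _ (@lebesgue_sf d)
  (measure0 (lebesgue_rV R d)) (measure_ge0 (lebesgue_rV R d))
  (@measure_semi_sigma_additive _ _ _ (lebesgue_rV R d)).

HB.instance Definition _ d := Measure_isSigmaFinite.Build _ _ _ (@lebesgue_sf d)
  (@sigma_finite_lebesgue_rV d).

Lemma integral_rV_cons d (f : 'rV[R]_d.+1 -> \bar R) :
  measurable_fun setT f -> (forall x, 0 <= f x)%E ->
  (\int[lebesgue_rV R d.+1]_x f x =
   \int[lebesgue_rV R d]_x \int[lebesgue_measure]_t f (rV_cons (x, t)))%E.
Proof.
move=> mf f0.
have mc := @measurable_rV_cons R d.
transitivity (\int[(lebesgue_rV R d \x lebesgue_measure)%E]_p f (rV_cons p))%E.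
  by apply: (ge0_integral_pushforward mc).
rewrite (@fubini_tonelli1 _ _ _ _ _ (@lebesgue_sf d) lebesgue_measure
  (fun p => f (rV_cons p)))//.
exact: measurableT_comp mf mc.
Qed.

End lebesgue_rV_theory.

(** * Integrals of products over the coordinates *)

Section complex_integral.
Context (R : realType).

(** Complex values are used for tensor products: one complex product replaces the expansion of cos
    and sin of a sum over the coordinates. *)
Definition cint d (T : measurableType d) (mu : {measure set T -> \bar R})
    (f : T -> R[i]) : R[i] :=
  Complex (\int[mu]_x complex.Re (f x)) (\int[mu]_x complex.Im (f x)).

Definition cintegrable d (T : measurableType d) (mu : {measure set T -> \bar R})
    (f : T -> R[i]) : Prop :=
  mu.-integrable setT (EFin \o (fun x => complex.Re (f x))) /\
  mu.-integrable setT (EFin \o (fun x => complex.Im (f x))).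

Lemma Re_mulc (x y : R[i]) : complex.Re (x * y) =
  complex.Re x * complex.Re y - complex.Im x * complex.Im y.
Proof. by case: x; case: y. Qed.

Lemma Im_mulc (x y : R[i]) : complex.Im (x * y) =
  complex.Re x * complex.Im y + complex.Im x * complex.Re y.
Proof. by case: x; case: y. Qed.

Section product.
Context d1 d2 (T1 : measurableType d1) (T2 : measurableType d2)
  (m1 : {sigma_finite_measure set T1 -> \bar R})
  (m2 : {sigma_finite_measure set T2 -> \bar R}).

Lemma integrable_tensor (f : T1 -> R) (g : T2 -> R) :
  m1.-integrable setT (EFin \o f) -> m2.-integrable setT (EFin \o g) ->
  (m1 \x m2)%E.-integrable setT (fun p => (f p.1 * g p.2)%:E).
Proof.
move=> /integrableP[mf If] /integrableP[mg Ig].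
apply/integrable12ltyP.
  apply/measurable_EFinP; apply: measurable_funM.
    by apply: measurableT_comp (measurable_fst); exact/measurable_EFinP.
  by apply: measurableT_comp (measurable_snd); exact/measurable_EFinP.
rewrite (_ : (\int[m1]_x _)%E =
    ((\int[m1]_x `|(f x)%:E|) * (\int[m2]_y `|(g y)%:E|))%E).
  by rewrite lte_mul_pinfty// ?integral_ge0// ge0_fin_numE// integral_ge0.
rewrite -ge0_integralZr//; last 2 first.
- by apply: measurableT_comp => //.
- exact: integral_ge0.
apply: eq_integral => x _ /=.
rewrite -ge0_integralZl//.
  by apply: eq_integral => y _ /=; rewrite normrM.
by have := measurableT_comp (@abse_measurable R setT) mg.
Qed.

Lemma integral_tensor (f : T1 -> R) (g : T2 -> R) :
  m1.-integrable setT (EFin \o f) -> m2.-integrable setT (EFin \o g) ->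
  \int[(m1 \x m2)%E]_p (f p.1 * g p.2) = \int[m1]_x f x * \int[m2]_y g y.
Proof.
move=> If Ig; rewrite /Rintegral.
rewrite -integral12_prod_meas1; last exact: integrable_tensor.
rewrite -fineM; last 2 first.
- exact: integrable_fin_num.
- exact: integrable_fin_num.
rewrite -(fineK (integrable_fin_num measurableT Ig)) -integralZr//.
congr fine; apply: eq_integral => x _ /=.
rewrite (fineK (integrable_fin_num measurableT Ig)) -integralZl//.
Qed.

Lemma cint_tensor (f : T1 -> R[i]) (g : T2 -> R[i]) :
  cintegrable m1 f -> cintegrable m2 g ->
  cintegrable (m1 \x m2)%E (fun p => f p.1 * g p.2) /\
  cint (m1 \x m2)%E (fun p => f p.1 * g p.2) = cint m1 f * cint m2 g.
Proof.
move=> [f1 f2] [g1 g2].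
have I11 := integrable_tensor f1 g1; have I12 := integrable_tensor f1 g2.
have I21 := integrable_tensor f2 g1; have I22 := integrable_tensor f2 g2.
split.
  split; rewrite /comp/=.
    under eq_fun do rewrite Re_mulc EFinB.
    exact: integrableB.
  under eq_fun do rewrite Im_mulc EFinD.
  exact: integrableD.
rewrite /cint; apply/eqP; rewrite eq_complex/=; apply/andP; split; apply/eqP.
  rewrite -!integral_tensor// -RintegralB//.
  by apply: eq_Rintegral => p _; rewrite Re_mulc.
rewrite -!integral_tensor// -RintegralD//.
by apply: eq_Rintegral => p _; rewrite Im_mulc.
Qed.

End product.

Definition cmeasurable d (T : measurableType d) (f : T -> R[i]) :=
  measurable_fun setT (fun x => complex.Re (f x)) /\
  measurable_fun setT (fun x => complex.Im (f x)).

Lemma cmeasurableM d (T : measurableType d) (f g : T -> R[i]) :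
  cmeasurable f -> cmeasurable g -> cmeasurable (fun x => f x * g x).
Proof.
move=> [f1 f2] [g1 g2]; split.
  under eq_fun do rewrite Re_mulc.
  by apply: measurable_funB; exact: measurable_funM.
under eq_fun do rewrite Im_mulc.
by apply: measurable_funD; exact: measurable_funM.
Qed.

Lemma cmeasurable_prod d (T : measurableType d) I (s : seq I) (f : I -> T -> R[i]) :
  (forall i, cmeasurable (f i)) -> cmeasurable (fun x => \prod_(i <- s) f i x).
Proof.
move=> mf; elim: s => [|i s IH].
  rewrite (_ : (fun x => _) = fun=> 1); last by apply/funext => x; rewrite big_nil.
  by split; exact: measurable_cst.
rewrite (_ : (fun x => _) = fun x => f i x * \prod_(j <- s) f j x).
  exact: cmeasurableM.
by apply/funext => x; rewrite big_cons.
Qed.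

Lemma cmeasurable_coord d (i : 'I_d) (f : R -> R[i]) :
  cmeasurable (f : measurableTypeR R -> R[i]) ->
  cmeasurable (fun x : 'rV[R]_d => f (x 0 i)).
Proof.
move=> [f1 f2]; split.
  exact: (measurableT_comp f1 (measurable_rV_coord i)).
exact: (measurableT_comp f2 (measurable_rV_coord i)).
Qed.

Lemma cintegrable_measurable d (T : measurableType d)
    (mu : {measure set T -> \bar R}) (f : T -> R[i]) :
  cintegrable mu f -> cmeasurable f.
Proof.
by move=> [/integrableP[m1 _] /integrableP[m2 _]]; split; exact/measurable_EFinP.
Qed.

Lemma rV_cons0 d (p : 'rV[R]_d * measurableTypeR R) : rV_cons p 0 ord0 = p.2.
Proof.
have /= := row_mxEl (p.2%:M : 'rV_1) p.1 0 0.
by rewrite [X in _ = X]mxE mulr1n (_ : lshift d 0 = ord0) //; exact/val_inj.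
Qed.

Lemma rV_consS d (p : 'rV[R]_d * measurableTypeR R) i :
  rV_cons p 0 (lift ord0 i) = p.1 0 i.
Proof.
have /= := row_mxEr (p.2%:M : 'rV_1) p.1 0 i.
by rewrite (_ : rshift 1 i = lift ord0 i) //; exact/val_inj.
Qed.

Lemma cint_prod d (phi : 'I_d -> R -> R[i]) :
  (forall j, cintegrable (@lebesgue_measure R) (phi j)) ->
  cintegrable (lebesgue_rV R d) (fun x => \prod_(j < d) phi j (x 0 j)) /\
  cint (lebesgue_rV R d) (fun x => \prod_(j < d) phi j (x 0 j)) =
  \prod_(j < d) cint (@lebesgue_measure R) (phi j).
Proof.
elim: d phi => [|d IH] phi Iphi.
  rewrite big_ord0 (_ : (fun x => _) = fun=> 1); last first.
    by apply/funext => x; rewrite big_ord0.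
  have D (f : 'rV[R]_0 -> \bar R) : measurable_fun setT f ->
      (\int[lebesgue_rV R 0]_x f x = f 0%R)%E.
    by move=> mf; rewrite [LHS](@integral_dirac _ 'rV[R]_0 0%R)// diracT mul1e.
  split.
    by split; apply/integrableP; (split; first exact: measurable_cst);
      rewrite D// ltry.
  rewrite -[RHS]/(Complex 1 0) /cint /Rintegral; congr Complex.
    by rewrite D.
  by rewrite D.
have [If Ef] := IH (fun j => phi (lift ord0 j)) (fun j => Iphi _).
have [Ip Ep] := @cint_tensor _ _ _ _ (@lebesgue_sf R d) (@lebesgue_measure R) _ _
  If (Iphi ord0).
have mphi : cmeasurable (fun x : 'rV[R]_d.+1 => \prod_(j < d.+1) phi j (x 0 j)).
  apply: cmeasurable_prod => i; apply: cmeasurable_coord.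
  exact: cintegrable_measurable (Iphi i).
set F := (fun x : 'rV[R]_d.+1 => _) in mphi *.
set G := (fun p : 'rV[R]_d * R => _) in Ip Ep.
have FG : F \o @rV_cons R d = G.
  apply/funext => p; rewrite /F /G/= big_ord_recl rV_cons0 mulrC.
  by congr (_ * _); apply: eq_bigr => j _; rewrite rV_consS.
have mc := @measurable_rV_cons R d.
have [mF1 mF2] := mphi; have [IG1 IG2] := Ip.
have IF1 : (lebesgue_rV R d.+1).-integrable setT (EFin \o (fun x => complex.Re (F x))).
  apply: (integrable_pushforward mc) => //; first exact/measurable_EFinP.
  by move: IG1; rewrite -FG.
have IF2 : (lebesgue_rV R d.+1).-integrable setT (EFin \o (fun x => complex.Im (F x))).
  apply: (integrable_pushforward mc) => //; first exact/measurable_EFinP.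
  by move: IG2; rewrite -FG.
split=> //.
rewrite big_ord_recl mulrC -Ef -[RHS]Ep /cint -FG; congr Complex.
  congr fine; apply: (integral_pushforward mc) => //; first exact/measurable_EFinP.
  by move: IG1; rewrite -FG.
congr fine; apply: (integral_pushforward mc) => //; first exact/measurable_EFinP.
by move: IG2; rewrite -FG.
Qed.

End complex_integral.

(** * Behaviour of the Lebesgue measure under reflection and scaling *)

Section reflection.
Context (R : realType).

Lemma ge0_integral_opp (g : R -> \bar R) :
  measurable_fun (setT : set (measurableTypeR R)) g -> (forall x, 0 <= g x)%E ->
  (\int[@lebesgue_measure R]_t g (- t)%R = \int[@lebesgue_measure R]_t g t)%E.
Proof.
move=> mg g0.
have mo : measurable_fun setT (-%R : measurableTypeR R -> measurableTypeR R).
  exact: oppr_measurable.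
rewrite -[LHS](@ge0_integral_pushforward _ _ _ _ R _ mo lebesgue_measure setT)//.
apply: eq_measure_integral => A mA _.
exact: lebesgue_measureN.
Qed.

Lemma measurable_rV_opp d :
  measurable_fun setT (fun x : 'rV[R]_d => - x).
Proof.
apply: measurable_fun_rV => i.
rewrite (_ : (fun _ => _) = (-%R : measurableTypeR R -> measurableTypeR R) \o
   (fun x : 'rV[R]_d => x 0 i)).
  by apply: measurableT_comp (measurable_rV_coord i); exact: oppr_measurable.
by apply/funext => x /=; rewrite mxE.
Qed.

Lemma rV_consN d (x : 'rV[R]_d) (t : R) : rV_cons (- x, - t) = - rV_cons (x, t).
Proof.
apply/rowP => j; rewrite [RHS]mxE; have [i ->|->] := unliftP ord0 j.
  by rewrite !rV_consS/= mxE.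
by rewrite !rV_cons0.
Qed.

Lemma measurable_fun_rV_cons d (g : 'rV[R]_d.+1 -> \bar R) (x : 'rV[R]_d) :
  measurable_fun setT g ->
  measurable_fun (setT : set (measurableTypeR R)) (fun t => g (rV_cons (x, t))).
Proof.
move=> mg; apply: (measurableT_comp mg).
by apply: (measurableT_comp (@measurable_rV_cons R d)); exact: measurable_fun_pair.
Qed.

Lemma ge0_integral_rV_opp d (g : 'rV[R]_d -> \bar R) :
  measurable_fun setT g -> (forall x, 0 <= g x)%E ->
  (\int[lebesgue_rV R d]_x g (- x)%R = \int[lebesgue_rV R d]_x g x)%E.
Proof.
elim: d g => [|d IH] g mg g0.
  by apply: eq_integral => x _; congr g; apply/rowP => -[].
have mo := @measurable_rV_opp d.+1.
rewrite integral_rV_cons//; last exact: measurableT_comp mg mo.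
rewrite [RHS](integral_rV_cons mg g0).
transitivity (\int[lebesgue_rV R d]_x \int[lebesgue_measure]_t
    g (rV_cons (- x, t))%R)%E.
  apply: eq_integral => x _.
  rewrite -[RHS]ge0_integral_opp//; last exact: measurable_fun_rV_cons.
  by apply: eq_integral => t _; rewrite rV_consN.
apply: (IH (fun x => \int[lebesgue_measure]_t g (rV_cons (x, t)))%E).
  apply: (@measurable_fun_fubini_tonelli_F _ _ _ _ _ lebesgue_measure
    (fun p => g (rV_cons p))) => //.
  exact: measurableT_comp mg (@measurable_rV_cons R d).
by move=> x; exact: integral_ge0.
Qed.

Lemma integral_rV_opp d (g : 'rV[R]_d -> \bar R) : measurable_fun setT g ->
  (\int[lebesgue_rV R d]_x g (- x)%R = \int[lebesgue_rV R d]_x g x)%E.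
Proof.
move=> mg; rewrite integralE [RHS]integralE.
congr (_ - _)%E.
  rewrite -[RHS]ge0_integral_rV_opp//; last exact: measurable_funepos.
  by apply: eq_integral => x _; rewrite (funepos_comp g).
rewrite -[RHS]ge0_integral_rV_opp//; last exact: measurable_funeneg.
by apply: eq_integral => x _; rewrite (funeneg_comp g).
Qed.

Lemma ae_rV_opp d (Q : 'rV[R]_d -> Prop) :
  {ae lebesgue_rV R d, forall x, Q x} -> {ae lebesgue_rV R d, forall x, Q (- x)}.
Proof.
move=> [N [mN N0 QN]].
have mo := @measurable_rV_opp d.
have mN' : measurable ((fun x => - x) @^-1` N).
  by rewrite -[X in measurable X]setTI; exact: mo.
have E A : measurable A -> (\int[lebesgue_rV R d]_x (\1_A x)%:E = lebesgue_rV R d A)%E.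
  by move=> mA; rewrite integral_indic// setIT.
exists ((fun x => - x) @^-1` N); split=> //.
- rewrite -N0 -E// -(E N)// -[RHS]ge0_integral_rV_opp//.
  by apply/measurable_EFinP; exact: measurable_indic.
- by move=> x /= nQ; apply: QN.
Qed.

End reflection.

Section one_dimension.
Context (R : realType).
Local Notation leb := (@lebesgue_measure R).

(** By Tonelli, the integrals of the positive and negative parts are measurable in y; [fine] sends
    the values that are not finite to 0, so f may fail to be integrable for some y. *)
Lemma measurable_fun_param d1 d2 (T1 : measurableType d1) (T2 : measurableType d2)
    (m1 : {sigma_finite_measure set T1 -> \bar R}) (f : T1 * T2 -> R) :
  measurable_fun setT f -> measurable_fun setT (fun y => \int[m1]_x f (x, y)).
Proof.
move=> mf; rewrite /Rintegral; apply: (measurableT_comp (fine_measurable measurableT)).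
have mF : measurable_fun setT (EFin \o f) by exact/measurable_EFinP.
rewrite (_ : (fun y => _) = (fun y => fubini_G m1 (EFin \o f)^\+%E y -
    fubini_G m1 (EFin \o f)^\-%E y)%E); last first.
  apply/funext => y; rewrite integralE /fubini_G; congr (_ - _)%E.
    by apply: eq_integral => x _; exact: (congr1 (@^~ x) (funepos_comp (EFin \o f) (pair^~ y))).
  by apply: eq_integral => x _; exact: (congr1 (@^~ x) (funeneg_comp (EFin \o f) (pair^~ y))).
apply: emeasurable_funB.
  apply: measurable_fun_fubini_tonelli_G => //; exact: measurable_funepos.
apply: measurable_fun_fubini_tonelli_G => //; exact: measurable_funeneg.
Qed.

(** Uniqueness of the Lebesgue measure: t times its image under x -> t x has the right value on
    half-open intervals. *)
Lemma lebesgue_scale (t : R) (g : R -> \bar R) : 0 < t ->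
  measurable_fun (setT : set (measurableTypeR R)) g -> (forall x, 0 <= g x)%E ->
  (\int[leb]_x g x = t%:E * \int[leb]_x g (t * x)%R)%E.
Proof.
move=> t0 mg g0.
have mt : measurable_fun setT ((fun x => t * x) : measurableTypeR R -> measurableTypeR R).
  exact: mulrl_measurable.
have tn : 0 <= t by exact: ltW.
pose pf : {measure set (measurableTypeR R) -> \bar R} :=
  measure_function_pushforward__canonical__measure_function_Measure leb mt.
pose tm := mscale (NngNum tn) pf.
transitivity (\int[tm]_x g x)%E.
  apply: eq_measure_integral => A mA _.
  apply: lebesgue_measure_unique => // X [[a b]] _ <-.
  change (leb `]a, b]%classic = (t%:E * leb ((fun x => t * x)%R @^-1` `]a, b]%classic))%E).
  rewrite (_ : _ @^-1` _ = `]a / t, b / t]%classic); last first.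
    apply/seteqP; split => x /=; rewrite !in_itv/= ltr_pdivrMr// ler_pdivlMr//;
    by rewrite (mulrC x).
  rewrite !lebesgue_measure_itv/= !lte_fin ltr_pM2r ?invr_gt0//.
  case: ifP => _; last by rewrite mule0.
  by rewrite -!EFinB -EFinM -mulrBl mulrCA mulfV ?gt_eqF// mulr1.
rewrite ge0_integral_mscale//=; congr (_ * _)%E.
by rewrite (ge0_integral_pushforward mt).
Qed.

End one_dimension.

(** * Fourier transform of an interval *)

Section interval_transform.
Context (R : realType).
Local Notation leb := (@lebesgue_measure R).
Implicit Types a b c e t xi : R.

Definition cos_itv a b xi : R := \int[leb]_x (\1_(`]a, b]%classic) x * cos (x * xi)).
Definition sin_itv a b xi : R := \int[leb]_x (\1_(`]a, b]%classic) x * sin (x * xi)).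

Let Rintegral_indic a b (f : R -> R) : continuous f ->
  \int[leb]_x (\1_(`]a, b]%classic) x * f x) = \int[leb]_(x in `[a, b]) f x.
Proof.
move=> cf; have [ba|ab] := ltP b a.
  rewrite [X in \1_X]set_itv_ge ?bnd_simp -?leNgt ?ltW//.
  rewrite set_itv_ge ?bnd_simp -?ltNge// Rintegral_set0.
  rewrite -[RHS](dot0l leb f) /dot.
  by apply: eq_Rintegral => x _; rewrite indicE in_set0.
rewrite -[RHS]Rintegral_itv_obnd_cbnd; last first.
  have ic : leb.-integrable `[a, b]%classic (EFin \o f).
    apply: continuous_compact_integrable; first exact: segment_compact.
    exact: continuous_subspaceT.
  by apply: integrableS ic => //; apply: subset_itvr; rewrite bnd_simp.
rewrite [RHS]Rintegral_mkcond; apply: eq_Rintegral => x _.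
by rewrite indicE patchE; case: ifP => _; rewrite ?mul1r ?mul0r.
Qed.

Lemma continuous_cosM xi : continuous (fun x : R => cos (x * xi)).
Proof.
move=> x; apply: (@cvg_comp _ _ _ ( *%R^~ xi) cos); last exact: continuous_cos.
exact: mulrr_continuous.
Qed.

Lemma continuous_sinM xi : continuous (fun x : R => sin (x * xi)).
Proof.
move=> x; apply: (@cvg_comp _ _ _ ( *%R^~ xi) sin); last exact: continuous_sin.
exact: mulrr_continuous.
Qed.

Let FTC a b (f F : R -> R) : a <= b -> continuous f ->
  (forall x : R, is_derive x 1 F (f x)) ->
  \int[leb]_(x in `[a, b]) f x = F b - F a.
Proof.
rewrite le_eqVlt => /predU1P[->|ab] cf dF.
  by rewrite set_itv1 Rintegral_set1 subrr.
have cF : continuous F.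
  by move=> x; apply/differentiable_continuous/derivable1_diffP; exact: ex_derive.
rewrite /Rintegral (continuous_FTC2 ab (F := F))//.
- exact: continuous_subspaceT.
- split.
  + by move=> x _; exact: ex_derive.
  + by apply: cvg_at_right_filter; exact: cF.
  + by apply: cvg_at_left_filter; exact: cF.
- by move=> x _; rewrite derive1E; exact: derive_val.
Qed.

Lemma cos_itvE a b xi : a <= b -> xi != 0 ->
  cos_itv a b xi = (sin (b * xi) - sin (a * xi)) / xi.
Proof.
move=> ab xi0; rewrite /cos_itv Rintegral_indic; last exact: continuous_cosM.
apply: (@etrans _ _ (sin (b * xi) / xi - sin (a * xi) / xi)); last by rewrite mulrBl.
apply: (FTC ab (continuous_cosM (xi := xi)) (F := fun x => sin (x * xi) / xi)) => x.
apply: is_derive_eq.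
by rewrite /GRing.scale/=; field.
Qed.

Lemma sin_itvE a b xi : a <= b -> xi != 0 ->
  sin_itv a b xi = (cos (a * xi) - cos (b * xi)) / xi.
Proof.
move=> ab xi0; rewrite /sin_itv Rintegral_indic; last exact: continuous_sinM.
apply: (@etrans _ _ (- cos (b * xi) / xi - - cos (a * xi) / xi)); last by field.
apply: (FTC ab (continuous_sinM (xi := xi)) (F := fun x => - cos (x * xi) / xi)) => x.
apply: is_derive_eq.
by rewrite /GRing.scale/=; field.
Qed.

End interval_transform.

Section interval_isometry.
Context (R : realType).
Local Notation leb := (@lebesgue_measure R).
Implicit Types a b c e t xi : R.

Lemma measurable_invr :
  measurable_fun (setT : set (measurableTypeR R)) (fun x : R => x^-1).
Proof.
have m0 : measurable ([set 0] : set (measurableTypeR R)) by exact: measurable_set1.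
rewrite -(setvU [set 0]); apply/measurable_funU => //.
  exact: measurableC.
split; last exact: measurable_fun_set1.
apply: open_continuous_measurable_fun.
  by rewrite openC; exact: closed_eq.
by move=> x /set_mem/eqP x0; exact: inv_continuous.
Qed.

Lemma integrable_indicM a b (f : R -> R) :
  measurable_fun (setT : set (measurableTypeR R)) f -> (forall x, `|f x| <= 1) ->
  leb.-integrable setT (EFin \o (fun x => \1_(`]a, b]%classic) x * f x)).
Proof.
move=> mf f1.
apply: (le_integrable _ _ _ (@integrable_indic_itv R a b false false)) => //.
  by apply/measurable_EFinP; apply: measurable_funM => //; exact: measurable_indic.
move=> x _ /=; rewrite lee_fin normrM.
by rewrite ler_piMr.
Qed.

Lemma Rintegral_indic_itv a b : a <= b ->
  \int[leb]_x (\1_(`]a, b]%classic) x : R) = b - a.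
Proof.
move=> ab; rewrite /Rintegral integral_indic// setIT.
apply: (@etrans _ _ (fine (b%:E - a%:E)%E)) => //; congr fine.
apply: (etrans (lebesgue_measure_itv _)) => /=; rewrite lte_fin.
by move: ab; rewrite le_eqVlt => /predU1P[->|->//]; rewrite ltxx subee.
Qed.

Let measurable_cosM xi : measurable_fun (setT : set (measurableTypeR R))
  (fun x => cos (x * xi)).
Proof. by apply: continuous_measurable_fun; exact: continuous_cosM. Qed.

Let measurable_sinM xi : measurable_fun (setT : set (measurableTypeR R))
  (fun x => sin (x * xi)).
Proof. by apply: continuous_measurable_fun; exact: continuous_sinM. Qed.

Lemma norm_Rintegral_indicM a b (f : R -> R) : a <= b ->
  measurable_fun (setT : set (measurableTypeR R)) f -> (forall x, `|f x| <= 1) ->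
  `|\int[leb]_x (\1_(`]a, b]%classic) x * f x)| <= b - a.
Proof.
move=> ab mf f1.
apply: le_trans (le_normr_Rintegral _ (integrable_indicM a b mf f1)) _ => //.
apply: (@le_trans _ _ (\int[leb]_x (\1_(`]a, b]%classic) x : R))).
  apply: le_Rintegral => //.
  - exact: integrable_norm (integrable_indicM a b mf f1).
  - exact: integrable_indic_itv.
  - move=> x _; rewrite normrM ger0_norm//.
    by rewrite ler_piMr.
by rewrite Rintegral_indic_itv.
Qed.

Lemma measurable_cos_itv a b :
  measurable_fun (setT : set (measurableTypeR R)) (cos_itv a b).
Proof.
apply: (@measurable_fun_param _ _ _ (measurableTypeR R) (measurableTypeR R) leb
  (fun p => \1_(`]a, b]%classic) p.1 * cos (p.1 * p.2))).
apply: measurable_funM.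
  by apply: measurableT_comp (measurable_fst); exact: measurable_indic.
apply: (@measurableT_comp _ _ _ _ _ _ (@cos R)).
  by apply: continuous_measurable_fun; exact: continuous_cos.
by apply: measurable_funM.
Qed.

Lemma measurable_sin_itv a b :
  measurable_fun (setT : set (measurableTypeR R)) (sin_itv a b).
Proof.
apply: (@measurable_fun_param _ _ _ (measurableTypeR R) (measurableTypeR R) leb
  (fun p => \1_(`]a, b]%classic) p.1 * sin (p.1 * p.2))).
apply: measurable_funM.
  by apply: measurableT_comp (measurable_fst); exact: measurable_indic.
apply: (@measurableT_comp _ _ _ _ _ _ (@sin R)).
  by apply: continuous_measurable_fun; exact: continuous_sin.
by apply: measurable_funM.
Qed.

Lemma integrable_oneDsqrV : leb.-integrable setT (fun x : R => ((oneDsqr x)^-1)%:E).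
Proof.
have V0 (x : R) : 0 <= (oneDsqr x)^-1 by rewrite invr_ge0 (le_trans ler01) ?oneDsqr_ge1.
apply/integrableP; split.
  apply/measurable_EFinP; apply: continuous_measurable_fun.
  exact: continuous_oneDsqrV.
under eq_integral do rewrite gee0_abs ?lee_fin//.
rewrite ge0_symfun_integralT//.
- by rewrite -set_itvcy integral0y_oneDsqr -EFinM ltry.
- exact: continuous_oneDsqrV.
- by move=> x /=; rewrite /oneDsqr sqrrN.
Qed.

(** Adding f^2 <= M^2 and xi^2 f^2 <= N^2 gives f^2 <= (M^2 + N^2) / (1 + xi^2), which is
    integrable. *)
Let Lfun2_decay (f : R -> R) (M N : R) :
  measurable_fun (setT : set (measurableTypeR R)) f ->
  (forall xi, `|f xi| <= M) -> (forall xi, xi != 0 -> `|f xi| <= N / `|xi|) ->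
  f \in Lfun leb 2%:E.
Proof.
move=> mf fM fN; apply/Lfun2P; split=> //.
have I : leb.-integrable setT (fun x : R => ((M ^+ 2 + N ^+ 2)%:E * ((oneDsqr x)^-1)%:E)%E).
  by apply: integrableZl => //; exact: integrable_oneDsqrV.
apply: (le_integrable _ _ _ I) => //.
  by apply/measurable_EFinP; exact: measurable_funX.
move=> x _ /=; rewrite lee_fin ger0_norm ?sqr_ge0//.
apply: le_trans (ler_norm _).
have o0 : 0 < oneDsqr x by rewrite (lt_le_trans ltr01) ?oneDsqr_ge1.
rewrite ler_pdivlMr// /oneDsqr mulrDr mulr1.
apply: lerD.
  rewrite -(real_normK (num_real (f x))) lerXn2r// nnegrE.
  exact: le_trans (normr_ge0 _) (fM x).
have [->|x0] := eqVneq x 0; first by rewrite expr0n mulr0 sqr_ge0.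
rewrite -exprMn -(real_normK (num_real (f x * x))) lerXn2r ?nnegrE//.
  have := fN _ x0; rewrite ler_pdivlMr ?normr_gt0// => /(le_trans _); apply.
  by rewrite mulr_ge0.
by rewrite normrM -ler_pdivlMr ?normr_gt0// fN.
Qed.

Lemma cos_itv_Lfun2 a b : a <= b -> cos_itv a b \in Lfun leb 2%:E.
Proof.
move=> ab; apply: (@Lfun2_decay _ (b - a) 2); first exact: measurable_cos_itv.
  move=> xi; apply: norm_Rintegral_indicM => // x.
  by rewrite ler_norml cos_geN1 cos_le1.
move=> xi xi0; rewrite cos_itvE// normrM normfV ler_pM2r ?invr_gt0 ?normr_gt0//.
apply: le_trans (ler_normB _ _) _.
by apply: (@le_trans _ _ (1 + 1)) => //; apply: lerD; exact: sin_max.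
Qed.

Lemma sin_itv_Lfun2 a b : a <= b -> sin_itv a b \in Lfun leb 2%:E.
Proof.
move=> ab; apply: (@Lfun2_decay _ (b - a) 2); first exact: measurable_sin_itv.
  move=> xi; apply: norm_Rintegral_indicM => // x; exact: sin_max.
move=> xi xi0; rewrite sin_itvE// normrM normfV ler_pM2r ?invr_gt0 ?normr_gt0//.
apply: le_trans (ler_normB _ _) _.
have c1 (x : R) : `|cos x| <= 1 by rewrite ler_norml cos_geN1 cos_le1.
by apply: (@le_trans _ _ (1 + 1)) => //; exact: lerD.
Qed.

(* The value (which is pi) of the integral of [versin_sq 1] is never needed: up
   to this constant, the integral of [versin_sq t] is given by scaling. *)
Definition versin_sq t xi : R := (1 - cos (t * xi)) / xi ^+ 2.

Definition versin_cst : R := \int[leb]_xi versin_sq 1 xi.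

Lemma versin_sq_ge0 t xi : 0 <= versin_sq t xi.
Proof. by rewrite mulr_ge0 ?subr_ge0 ?cos_le1// invr_ge0 sqr_ge0. Qed.

Lemma measurable_versin_sq t :
  measurable_fun (setT : set (measurableTypeR R)) (versin_sq t).
Proof.
apply: measurable_funM.
  apply: measurable_funB => //.
  apply: continuous_measurable_fun => x.
  apply: (@cvg_comp _ _ _ ( *%R t) cos); last exact: continuous_cos.
  exact: mulrl_continuous.
by apply: (measurableT_comp measurable_invr); exact: measurable_funX.
Qed.

(** Off 0, the squared modulus of the transform of ]0, 1] is 2 (1 - cos xi) / xi^2, and it is
    already known to be integrable. *)
Let integrable_versin_sq1 : leb.-integrable setT (EFin \o versin_sq 1).
Proof.
have cL : cos_itv 0 1 \in Lfun leb 2%:E by apply: cos_itv_Lfun2; exact: ler01.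
have sL : sin_itv 0 1 \in Lfun leb 2%:E by apply: sin_itv_Lfun2; exact: ler01.
have I := integrableD measurableT (dot_integrable cL cL) (dot_integrable sL sL).
apply: (le_integrable _ _ _ I) => //.
  by apply/measurable_EFinP; exact: measurable_versin_sq.
move=> x _.
change (`|versin_sq 1 x|%:E <= `|cos_itv 0 1 x * cos_itv 0 1 x +
  sin_itv 0 1 x * sin_itv 0 1 x|%:E)%E.
rewrite lee_fin (ger0_norm (versin_sq_ge0 _ _)).
apply: le_trans (ler_norm _).
have [->|x0] := eqVneq x 0.
  rewrite /versin_sq expr0n/= invr0 mulr0.
  by rewrite -!expr2 addr_ge0// sqr_ge0.
rewrite cos_itvE// sin_itvE// !mul0r sin0 subr0 cos0 mul1r /versin_sq mul1r.
rewrite -!expr2 !expr_div_n -mulrDl ler_pM2r; last by rewrite invr_gt0 exprn_even_gt0.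
have := cos2Dsin2 x; have := cos_le1 x; nra.
Qed.

Lemma integral_versin_sq t : leb.-integrable setT (EFin \o versin_sq t) /\
  \int[leb]_xi versin_sq t xi = `|t| * versin_cst.
Proof.
wlog t0 : t / 0 < t.
  move=> H; have [t0|t0|->] := ltgtP t 0; last 1 first.
  - rewrite (_ : versin_sq 0 = fun=> 0); last first.
      by apply/funext => xi; rewrite /versin_sq mul0r cos0 subrr mul0r.
    rewrite normr0 mul0r; split; first exact: integrable0.
    by rewrite Rintegral_cst// mul0r.
  - rewrite -normrN (_ : versin_sq t = versin_sq (- t)); last first.
      by apply/funext => xi; rewrite /versin_sq mulNr cosN.
    by apply: H; rewrite oppr_gt0.
  - exact: H.
have E xi : versin_sq t xi = t ^+ 2 * versin_sq 1 (t * xi).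
  have [->|x0] := eqVneq xi 0; first by rewrite /versin_sq !mulr0 cos0 subrr !mul0r mulr0.
  by rewrite /versin_sq mul1r; field; rewrite x0 gt_eqF.
have I1 : (\int[leb]_xi (versin_sq 1 xi)%:E = versin_cst%:E)%E.
  by rewrite /versin_cst /Rintegral fineK//; exact: integrable_fin_num.
have I : (\int[leb]_xi (versin_sq t xi)%:E = (t * versin_cst)%:E)%E.
  have m1 : measurable_fun (setT : set (measurableTypeR R)) (fun x => (versin_sq 1 x)%:E).
    by apply/measurable_EFinP; exact: measurable_versin_sq.
  have mt : measurable_fun (setT : set (measurableTypeR R))
      (fun x => (versin_sq 1 (t * x))%:E).
    by apply: (measurableT_comp m1); exact: mulrl_measurable.
  have v0 x : (0 <= (versin_sq 1 x)%:E)%E by rewrite lee_fin versin_sq_ge0.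
  have S := lebesgue_scale t0 m1 v0.
  transitivity ((t ^+ 2)%:E * \int[leb]_x (versin_sq 1 (t * x))%:E)%E.
    rewrite -ge0_integralZl_EFin// ?sqr_ge0//.
    by apply: eq_integral => x _; rewrite E EFinM.
  by rewrite expr2 (EFinM t t) -muleA -S I1 -EFinM.
split; last by rewrite /Rintegral I gtr0_norm.
apply/integrableP; split; first by apply/measurable_EFinP; exact: measurable_versin_sq.
under eq_integral do rewrite /= ger0_norm ?versin_sq_ge0//.
by rewrite I ltry.
Qed.

(** On ]pi / 2, pi] the cosine is nonpositive, so the integrand is at least 1 / pi^2 there. *)
Lemma versin_cst_gt0 : 0 < versin_cst.
Proof.
have pp := @pi_gt0 R.
have I : leb.-integrable setT
    (EFin \o (fun x => (pi ^+ 2)^-1 * \1_(`]pi / 2, pi]%classic) x)).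
  rewrite /comp; under eq_fun do rewrite EFinM.
  by apply: integrableZl => //; exact: integrable_indic_itv.
apply: (@lt_le_trans _ _
    (\int[leb]_x ((pi ^+ 2)^-1 * \1_(`]pi / 2, pi]%classic) x))).
  rewrite RintegralZl//; last exact: integrable_indic_itv.
  rewrite mulr_gt0 ?invr_gt0 ?exprn_gt0//.
  by rewrite Rintegral_indic_itv; lra.
apply: le_Rintegral => // x _.
rewrite indicE; case: (boolP (x \in _)) => [|_]; last by rewrite mulr0 versin_sq_ge0.
rewrite inE/= in_itv/= => /andP[x1 x2].
have x0 : 0 < x by lra.
rewrite mulr1 /versin_sq -[leLHS]mul1r ler_pM//.
- by rewrite invr_ge0 sqr_ge0.
- have : 0 <= sin (x - pi / 2) by apply: sin_ge0_pi; lra.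
  by rewrite mul1r sinBpihalf; lra.
- by rewrite lef_pV2 ?posrE ?exprn_gt0// lerXn2r// nnegrE ltW.
Qed.

End interval_isometry.

Section interval_inner_products.
Context (R : realType).
Local Notation leb := (@lebesgue_measure R).
Implicit Types a b c e t xi : R.

Definition fourier_itv a b xi : R[i] := Complex (cos_itv a b xi) (- sin_itv a b xi).

(** The right-hand side is the combination of absolute values produced by the integrals of
    [versin_sq] at the four differences of endpoints. *)
Lemma overlap_itv a b c e : a <= b -> c <= e ->
  2 * \int[leb]_x (\1_(`]a, b]%classic) x * \1_(`]c, e]%classic) x) =
  `|a - e| + `|b - c| - `|a - c| - `|b - e|.
Proof.
move=> ab ce; set l := Num.max a c; set r := Num.min b e.
rewrite (_ : \int[leb]_x _ = if l <= r then r - l else 0); last first.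
  transitivity (\int[leb]_x (\1_(`]l, r]%classic) x : R)).
    apply: eq_Rintegral => x _.
    rewrite -[LHS]/((\1_(`]a, b]%classic) \* \1_(`]c, e]%classic)) x) -indicI.
    congr (\1_ _ _).
    apply/seteqP; split => y /=; rewrite !in_itv/= /l /r gt_max le_min.
      by move=> [/andP[-> ->] /andP[-> ->]].
    by move=> /andP[/andP[-> ->] /andP[-> ->]].
  case: ifP => lr; first exact: Rintegral_indic_itv.
  rewrite set_itv_ge ?bnd_simp -?leNgt; last first.
    by move/negbT : lr; rewrite -ltNge => /ltW.
  rewrite -[RHS](dot0l leb (fun=> 0)) /dot.
  by apply: eq_Rintegral => x _; rewrite indicE in_set0 mul0r.
rewrite /l /r; case: (leP a c) => ac; case: (leP b e) => be;
case: ifPn => lr; rewrite -?ltNge in lr;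
case: (ger0P (a - e)) => ?; case: (ger0P (b - c)) => ?;
case: (ger0P (a - c)) => ?; case: (ger0P (b - e)) => ?; lra.
Qed.

Lemma cos_itvN a b xi : cos_itv a b (- xi) = cos_itv a b xi.
Proof. by apply: eq_Rintegral => x _; rewrite mulrN cosN. Qed.

Lemma sin_itvN a b xi : sin_itv a b (- xi) = - sin_itv a b xi.
Proof.
rewrite /sin_itv -[RHS]mulN1r -RintegralZl//; last first.
  by apply: integrable_indicM => [|x]; [|exact: sin_max];
    apply: continuous_measurable_fun; exact: continuous_sinM.
by apply: eq_Rintegral => x _; rewrite mulrN sinN mulN1r mulrN.
Qed.

Lemma Rintegral_odd (h : R -> R) :
  measurable_fun (setT : set (measurableTypeR R)) h ->
  (forall x, h (- x) = - h x) -> \int[leb]_x h x = 0.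
Proof.
move=> mh hN.
have mo : measurable_fun setT (-%R : measurableTypeR R -> measurableTypeR R).
  exact: oppr_measurable.
have mH : measurable_fun (setT : set (measurableTypeR R)) (EFin \o h).
  exact/measurable_EFinP.
have -> : \int[leb]_x h x =
    fine (\int[leb]_x (EFin \o h)^\+ x - \int[leb]_x (EFin \o h)^\- x)%E.
  by rewrite -integralE.
suff -> : (\int[leb]_t (EFin \o h)^\+ t = \int[leb]_x (EFin \o h)^\- x)%E.
  by case: (\int[leb]_x _)%E => //= r; rewrite subrr.
rewrite -ge0_integral_opp//; last exact: measurable_funepos.
by apply: eq_integral => x _; rewrite funeposE funenegE/= hN EFinN.
Qed.

Lemma fourier_itv_isometry a b c e : a <= b -> c <= e ->
  cintegrable leb (fun xi => fourier_itv a b xi * conjc (fourier_itv c e xi)) /\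
  cint leb (fun xi => fourier_itv a b xi * conjc (fourier_itv c e xi)) =
  Complex (2 * versin_cst R *
    \int[leb]_x (\1_(`]a, b]%classic) x * \1_(`]c, e]%classic) x)) 0.
Proof.
move=> ab ce.
have c1 := cos_itv_Lfun2 ab; have s1 := sin_itv_Lfun2 ab.
have c2 := cos_itv_Lfun2 ce; have s2 := sin_itv_Lfun2 ce.
have Icc := dot_integrable c1 c2; have Iss := dot_integrable s1 s2.
have Ics := dot_integrable c1 s2; have Isc := dot_integrable s1 c2.
have reE xi : complex.Re (fourier_itv a b xi * conjc (fourier_itv c e xi)) =
    cos_itv a b xi * cos_itv c e xi + sin_itv a b xi * sin_itv c e xi.
  by rewrite /fourier_itv Re_mulc/=; ring.
have imE xi : complex.Im (fourier_itv a b xi * conjc (fourier_itv c e xi)) =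
    cos_itv a b xi * sin_itv c e xi - sin_itv a b xi * cos_itv c e xi.
  by rewrite /fourier_itv Im_mulc/=; ring.
have IR : leb.-integrable setT (EFin \o (fun xi =>
    cos_itv a b xi * cos_itv c e xi + sin_itv a b xi * sin_itv c e xi)).
  exact: (integrableD measurableT Icc Iss).
have II : leb.-integrable setT (EFin \o (fun xi =>
    cos_itv a b xi * sin_itv c e xi - sin_itv a b xi * cos_itv c e xi)).
  exact: (integrableB measurableT Ics Isc).
split.
  by split; rewrite /comp; [under eq_fun do rewrite reE|under eq_fun do rewrite imE].
rewrite /cint; congr Complex; last first.
  (* The cosine transform is even in xi and the sine transform odd, so the imaginary part is odd. *)
  under eq_Rintegral do rewrite imE.
  apply: Rintegral_odd; first by case/integrableP : II => /measurable_EFinP.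
  by move=> x; rewrite !cos_itvN !sin_itvN; ring.
under eq_Rintegral do rewrite reE.
pose V t := versin_sq t.
(* Polarization: the formula for the cosine of a difference turns the products of the endpoint terms
   into four cosines, and the constants 1 cancel. It holds off the null set {0}, as the closed forms
   divide by xi. *)
transitivity (\int[leb]_xi ((versin_sq (a - e) xi + versin_sq (b - c) xi) -
    (versin_sq (a - c) xi + versin_sq (b - e) xi))).
  have IV t := (integral_versin_sq t).1.
  congr fine; apply: ae_eq_integral => //.
  - by case/integrableP : IR.
  - apply/measurable_EFinP.
    by apply: measurable_funB; apply: measurable_funD; exact: measurable_versin_sq.
  - exists [set 0]; split => //; first exact: lebesgue_measure_set1.
    move=> xi /= /not_implyP[_]; apply: contra_notP => /eqP xi0.
    congr EFin; rewrite !cos_itvE// !sin_itvE// /versin_sq !mulrBl !cosB.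
    by field.
have IV t := integral_versin_sq t.
have IVD s t : leb.-integrable setT (EFin \o (fun xi => versin_sq s xi + versin_sq t xi)).
  exact: (integrableD measurableT (IV s).1 (IV t).1).
rewrite RintegralB// !RintegralD//; try exact: (IV _).1.
rewrite !(fun t => (IV t).2).
rewrite (mulrC 2) -mulrA overlap_itv//; ring.
Qed.

End interval_inner_products.

(** * Monotone class argument in L^1 and L^2 *)

Section density.
Context d (T : measurableType d) (R : realType) (mu : {measure set T -> \bar R}).
Implicit Types (f g : T -> R) (u v : nat -> T -> R) (A B : set T).

(** Integrability gives meaning to the transform integrals, square-integrability to the isometry. *)
Definition L12 f := mu.-integrable setT (EFin \o f) /\ f \in Lfun mu 2%:E.

(** Both modes are needed later: L^1 convergence controls transforms at each frequency, L^2
    convergence makes them Cauchy in L^2. *)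
Definition cvg12 u f :=
  (fun n => \int[mu]_x `|u n x - f x|) @ \oo --> (0 : R) /\ cvg2 mu u f.

Lemma L12_measurable f : L12 f -> measurable_fun setT f.
Proof. by case=> _ /Lfun2_measurable. Qed.

Lemma L12D f g : L12 f -> L12 g -> L12 (fun x => f x + g x).
Proof.
move=> [f1 f2] [g1 g2]; split; last exact: Lfun2D.
exact: (integrableD measurableT f1 g1).
Qed.

Lemma L12Z (c : R) f : L12 f -> L12 (fun x => c * f x).
Proof.
move=> [f1 f2]; split; last exact: Lfun2Z.
exact: (integrableZl measurableT c f1).
Qed.

Lemma L12B f g : L12 f -> L12 g -> L12 (fun x => f x - g x).
Proof.
move=> [f1 f2] [g1 g2]; split; last exact: Lfun2B.
exact: (integrableB measurableT f1 g1).
Qed.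

Lemma le_L12 f g : measurable_fun setT f -> L12 g ->
  (forall x, `|f x| <= `|g x|) -> L12 f.
Proof.
move=> mf [g1 g2] fg; split; last exact: le_Lfun2 fg.
apply: (le_integrable _ _ _ g1) => //; first exact/measurable_EFinP.
by move=> x _; rewrite lee_fin fg.
Qed.

Lemma L12_indic A : measurable A -> (mu A < +oo)%E -> L12 (\1_A : T -> R).
Proof.
move=> mA Afin.
have IA : mu.-integrable setT (EFin \o (\1_A : T -> R)).
  apply/integrableP; split; first by apply/measurable_EFinP; exact: measurable_indic.
  rewrite (eq_integral (EFin \o \1_A)) ?integral_indic// ?setIT//.
  by move=> x _ /=; rewrite ger0_norm.
split=> //; apply/Lfun2P; split; first exact: measurable_indic.
rewrite (_ : (fun x => _) = \1_A)//.
by apply/funext => x; rewrite indicE; case: (x \in A); rewrite ?expr1n ?expr0n.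
Qed.

Lemma dominated_cvg12 u f g : (forall n, measurable_fun setT (u n)) ->
  L12 f -> L12 g -> (forall x, u ^~ x @ \oo --> f x) ->
  (forall n x, `|u n x - f x| <= `|g x|) -> cvg12 u f.
Proof.
move=> mu_ [f1 f2] [g1 g2] uf ug.
have mf := Lfun2_measurable f2.
have md n : measurable_fun setT (fun x => u n x - f x) by exact: measurable_funB.
have uf0 x : (u n x - f x) @[n --> \oo] --> (0 : R).
  by rewrite -(subrr (f x)); apply: cvgB => //; exact: cvg_cst.
split.
  have -> : (0 : R) = fine (\int[mu]_x (cst 0%E) x)%E by rewrite integral0.
  apply: fine_cvg; rewrite integral0.
  rewrite -[X in _ --> X](@integral0 _ _ _ mu setT).
  apply: (@dominated_cvg _ _ _ mu setT measurableT _ _ (fun x => `|g x|%:E)) => //.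
  - by move=> n; apply/measurable_EFinP; exact: measurableT_comp.
  - move=> x _; apply: cvg_EFin; first by near=> n.
    by rewrite -[X in _ --> X](@normr0 _ R); apply: cvg_norm; exact: uf0.
  - exact: integrable_abse g1.
  - by move=> n x _; rewrite lee_fin normr_id.
rewrite /cvg2 /dot /Rintegral.
apply: fine_cvg.
rewrite -[X in _ --> X](@integral0 _ _ _ mu setT).
apply: (@dominated_cvg _ _ _ mu setT measurableT _ _ (fun x => (g x ^+ 2)%:E)) => //.
- by move=> n; apply/measurable_EFinP; exact: measurable_funM.
- move=> x _; apply: cvg_EFin; first by near=> n.
  by rewrite -[X in _ --> X](mulr0 (0 : R)); apply: cvgM; exact: uf0.
- by case/Lfun2P : g2.
- move=> n x _; rewrite lee_fin normrM -expr2 -(real_normK (num_real (g x))).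
  by rewrite lerXn2r// nnegrE.
Unshelve. all: by end_near. Qed.

Import HBNNSimple.

(* Functional monotone class argument: indicators of the generating pi-system
   determine everything in L1 and L2. *)
Context (G : set (set T)).
Context (GI : setI_closed G).
Context (Gm : G `<=` measurable).
Context (Gfin : forall A, G A -> (mu A < +oo)%E).
Context (Ggen : measurable `<=` <<s G >>).
Context (Q : nat -> set T).
Context (GQ : forall n, G (Q n)).
Context (Qnd : nondecreasing_seq Q).
Context (QT : \bigcup_n Q n = setT).

Lemma L12_ind (V : (T -> R) -> Prop) :
  (forall A, G A -> V \1_A) ->
  (forall f g, L12 f -> L12 g -> V f -> V g -> V (fun x => f x + g x)) ->
  (forall (c : R) f, L12 f -> V f -> V (fun x => c * f x)) ->
  (forall u f, (forall n, L12 (u n)) -> (forall n, V (u n)) -> L12 f ->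
    cvg12 u f -> V f) ->
  forall f, L12 f -> V f.
Proof.
move=> VG VD VZ Vlim.
have mQ n : measurable (Q n) by exact/Gm/GQ.
have LI A n : measurable A -> L12 (\1_(A `&` Q n) : T -> R).
  move=> mA; apply: L12_indic; first exact: measurableI.
  apply: le_lt_trans (Gfin (GQ n)); apply: le_measure; rewrite ?inE//.
  exact: measurableI.
have LG A : G A -> L12 (\1_A : T -> R).
  by move=> GA; apply: L12_indic; [exact: Gm|exact: Gfin].
have VB f g : L12 f -> L12 g -> V f -> V g -> V (fun x => f x - g x).
  move=> fL gL Vf Vg; rewrite (_ : (fun _ => _) = fun x => f x + -1 * g x).
    by apply: VD => //; [exact: L12Z|exact: VZ].
  by apply/funext => x; rewrite mulN1r.
(* Cutting with [Q n] keeps measures finite, so that differences and increasing limits stay in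
   [L12]. The sets A with this property then form a lambda-system; it contains G because G is closed
   under intersection. *)
have VI : forall A, measurable A -> forall n, V \1_(A `&` Q n).
  pose H := [set A | measurable A /\ forall n, V \1_(A `&` Q n)].
  suff sH : measurable `<=` H by move=> A mA n; have [_] := sH _ mA; exact.
  apply: subset_trans Ggen _.
  apply: lambda_system_subset => //; last first.
    by move=> A GA; split=> [|n]; [exact: Gm|apply: VG; exact: GI].
  split=> //.
  - by split=> // n; rewrite setTI; exact: VG.
  - move=> A B BA [mA VA] [mB VB']; split; first exact: measurableD.
    move=> n; rewrite (_ : \1__ = fun x => \1_(A `&` Q n) x - \1_(B `&` Q n) x).
      by apply: VB => //; exact: LI.
    apply/funext => x; rewrite !indicE in_setI in_setD !in_setI.
    have [xB|xB] := boolP (x \in B); last by rewrite /= andbT subr0.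
    by rewrite (_ : x \in A)/= ?subrr//; move: xB; rewrite !inE; exact: BA.
  - move=> F ndF FH; split; first by apply: bigcupT_measurable => k; exact: (FH k).1.
    move=> n; have mF : measurable (\bigcup_i F i).
      by apply: bigcupT_measurable => k; exact: (FH k).1.
    apply: (Vlim (fun k => \1_(F k `&` Q n))).
    + by move=> k; apply: LI; exact: (FH k).1.
    + by move=> k; exact: (FH k).2.
    + exact: LI.
    apply: (@dominated_cvg12 _ _ (\1_(Q n))).
    + by move=> k; apply: L12_measurable; apply: LI; exact: (FH k).1.
    + exact: LI.
    + exact: LG.
    + move=> x; have [[k _ Fkx]|nF] := pselect ((\bigcup_i F i) x).
        apply: cvg_near_cst; exists k => // l /= kl.
        rewrite !indicE !in_setI; congr ((_ && _)%:R).
        have FlF : F l x by move/subsetPset: (ndF _ _ kl); exact.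
        by rewrite !mem_set//; exists k.
      apply: cvg_near_cst; exists 0%N => // l _; rewrite !indicE !in_setI.
      have nFl : ~ F l x by move=> Flx; apply: nF; exists l.
      by rewrite (memNset nF) (memNset nFl).
    + move=> k x; rewrite !indicE !in_setI; case: (x \in Q n); last first.
        by rewrite !andbF subrr normr0.
      by case: (x \in F k); case: (x \in _ ) => /=;
        rewrite ?subrr ?subr0 ?sub0r ?normrN ?normr1 ?normr0.
have Vsum I (s : seq I) (F : I -> T -> R) : (forall i, L12 (F i)) ->
    (forall i, V (F i)) -> L12 (fun x => \sum_(i <- s) F i x) /\
    V (fun x => \sum_(i <- s) F i x).
  move=> FL FV; elim: s => [|i s [IH1 IH2]].
    rewrite (_ : (fun x => _) = fun x => 0 * \1_(Q 0%N) x); last first.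
      by apply/funext => x; rewrite big_nil mul0r.
    by split; [exact: L12Z (LG _ (GQ 0%N))|exact: VZ (LG _ (GQ 0%N)) (VG _ (GQ 0%N))].
  rewrite (_ : (fun x => _) = fun x => F i x + \sum_(j <- s) F j x); last first.
    by apply/funext => x; rewrite big_cons.
  by split; [exact: L12D|exact: VD].
have Vpos f : L12 f -> (forall x, 0 <= f x) -> V f.
  move=> fL f0.
  have mf : measurable_fun setT (EFin \o f).
    by apply/measurable_EFinP; exact: L12_measurable.
  (* Simple functions below f, cut with [Q n], are finite combinations of indicators already
     treated, and f dominates the error. *)
  pose g n := nnsfun_approx measurableT mf n.
  have VgQ n : L12 (fun x => g n x * \1_(Q n) x) /\ V (fun x => g n x * \1_(Q n) x).
    rewrite (_ : (fun x => _) = fun x =>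
        \sum_(y <- finmap.enum_fset (fset_set (range (g n))))
        (y * \1_(g n @^-1` [set y] `&` Q n) x)).
      by apply: Vsum => y; [apply: L12Z|apply: VZ]; try apply: LI; try apply: VI;
        exact: measurable_funPTI.
    apply/funext => x; rewrite {1}(fimfunE (g n)) fsbig_finite//= mulr_suml.
    by apply: eq_bigr => y _; rewrite -mulrA indicI.
  apply: (Vlim (fun n x => g n x * \1_(Q n) x)) => //.
  - by move=> n; exact: (VgQ n).1.
  - by move=> n; exact: (VgQ n).2.
  apply: (@dominated_cvg12 _ _ f) => //.
  - by move=> n; apply: L12_measurable; exact: (VgQ n).1.
  - move=> x; rewrite -[X in _ --> X]mulr1; apply: cvgM.
      have /fine_cvg := cvg_nnsfun_approx measurableT mf (fun x _ => f0 x) (I : setT x).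
      exact.
    have [k _ Qkx] : (\bigcup_n Q n) x by rewrite QT.
    apply: cvg_near_cst; exists k => // l /= kl.
    by rewrite indicE mem_set//; move/subsetPset: (Qnd kl); exact.
  - move=> n x.
    have gf : g n x <= f x.
      rewrite -lee_fin /g nnsfun_approxE.
      by apply: (le_approx (f := EFin \o f)) => // y _; exact: f0.
    have g0 : 0 <= g n x by [].
    rewrite indicE; case: (x \in Q n); rewrite ?mulr1 ?mulr0 ?sub0r ?normrN//.
    rewrite ler0_norm ?subr_le0// (ger0_norm (f0 x)) opprB.
    by rewrite gerBl.
move=> f fL.
pose fp x := Num.max (f x) 0; pose fn x := Num.max (- f x) 0.
have mf := L12_measurable fL.
have fpL : L12 fp.
  apply: le_L12 fL _; first exact: measurable_maxr.
  move=> x; rewrite /fp; case: (leP (f x) 0) => fx; first by rewrite normr0.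
  by [].
have fnL : L12 fn.
  apply: le_L12 fL _; first by apply: measurable_maxr => //; exact: measurableT_comp.
  move=> x; rewrite /fn; case: (leP (- f x) 0) => fx; first by rewrite normr0.
  by rewrite normrN.
rewrite (_ : f = fun x => fp x - fn x); last first.
  apply/funext => x; rewrite /fp /fn.
  case: (leP (f x) 0) => ?; case: (leP (- f x) 0) => ?; lra.
by apply: VB => //; apply: Vpos => // x; rewrite le_max lexx orbT.
Unshelve. all: by end_near. Qed.

End density.

(** * Half-open boxes as a generating pi-system *)

Section boxes.
Context (R : realType) (d : nat).
Implicit Types (a b : 'I_d -> R).

Definition box a b : set 'rV[R]_d := [set x | forall i, `]a i, b i]%classic (x 0 i)].

Definition boxes : set (set 'rV[R]_d) :=
  [set A | exists a b, (forall i, a i <= b i) /\ A = box a b].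

Lemma boxes_setI : setI_closed boxes.
Proof.
move=> _ _ [a [b [ab ->]]] [a' [b' [ab' ->]]].
exists (fun i => Num.max (a i) (a' i)).
(* The outer [max] collapses an empty intersection to a degenerate box, so that the endpoints stay
   ordered. *)
exists (fun i => Num.max (Num.min (b i) (b' i)) (Num.max (a i) (a' i))).
split=> [i|]; first by rewrite le_max lexx orbT.
apply/seteqP; split => x /=.
  move=> [xB xB'] i; have := xB i; have := xB' i; rewrite /= !in_itv/=.
  by rewrite gt_max le_max le_min => /andP[-> ->] /andP[-> ->].
move=> H.
suff E i : `]a i, b i]%classic (x 0 i) /\ `]a' i, b' i]%classic (x 0 i).
  by split=> i; have [] := E i.
have := H i; rewrite /= !in_itv/= gt_max !le_max le_min.
move=> /andP[/andP[xa xa'] /orP[/andP[xb xb']|/orP[xa2|xa2]]].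
- by rewrite xa xb xa' xb'.
- by move: xa; rewrite ltNge xa2.
- by move: xa'; rewrite ltNge xa2.
Qed.

Lemma measurable_boxes : boxes `<=` measurable.
Proof.
move=> _ [a [b [_ ->]]].
by apply: (@measurable_box R d (fun i => `]a i, b i]%classic)).
Qed.

Lemma boxes_fin A : boxes A -> (lebesgue_rV R d A < +oo)%E.
Proof.
move=> [a [b [ab ->]]].
rewrite (@lebesgue_rV_box R d (fun i => `]a i, b i]%classic))//.
rewrite (eq_bigr (fun i => (b i - a i)%:E)) ?prodEFin ?ltry// => i _.
rewrite lebesgue_measure_itv/= lte_fin.
by move: (ab i); rewrite le_eqVlt => /predU1P[->|->//]; rewrite ltxx subrr.
Qed.

Lemma boxes_cube n : boxes (@cube R d n).
Proof.
exists (fun=> - n%:R), (fun=> n%:R); split=> // i.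
by rewrite (@le_trans _ _ 0)// oppr_le0.
Qed.

Lemma nondecreasing_cube : nondecreasing_seq (@cube R d).
Proof.
move=> m n mn; apply/subsetPset => x xm i; have /= := xm i.
rewrite !in_itv/= => /andP[x1 x2].
have mnR : m%:R <= n%:R :> R by rewrite ler_nat.
by rewrite (le_lt_trans _ x1) ?lerN2// (le_trans x2).
Qed.

Lemma boxes_generate : (measurable : set (set 'rV[R]_d)) `<=` <<s boxes >>.
Proof.
apply: smallest_sub; first exact: smallest_sigma_algebra.
rewrite -bigcup_seq => _ [i _ [Y mY <-]] /=; rewrite setTI.
suff : (measurable : set (set (measurableTypeR R))) `<=`
    [set Y | <<s boxes >> ((fun x : 'rV[R]_d => x 0 i) @^-1` Y)] by apply.
apply: smallest_sub.
  split=> [|B mB|F mF] /=.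
  - by rewrite preimage_set0; exact: sigma_algebra0.
  - by rewrite setTD preimage_setC -setTD; exact: sigma_algebraCD.
  - by rewrite preimage_bigcup; exact: sigma_algebra_bigcup.
move=> _ [[p q] _ <-] /=.
have [qp|pq] := ltP q p.
  by rewrite set_itv_ge ?bnd_simp -?leNgt ?ltW// preimage_set0; exact: sigma_algebra0.
(* A slab in coordinate i is a countable union of boxes that grow in the other coordinates. *)
rewrite (_ : _ @^-1` _ = \bigcup_n
    (box (fun j => if j == i then p else - n%:R) (fun j => if j == i then q else n%:R))).
  apply: sigma_algebra_bigcup => n; apply: sub_sigma_algebra.
  exists (fun j => if j == i then p else - n%:R), (fun j => if j == i then q else n%:R).
  split=> // j; case: ifP => // _.
  by rewrite (@le_trans _ _ 0)// oppr_le0.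
apply/seteqP; split => x /=.
  move=> xi; have : (\bigcup_n @cube R d n) x by rewrite bigcup_cube.
  move=> [n _ xn]; exists n => // j /=.
  by case: eqP => [->//|_]; exact: xn.
by move=> [n _ xn]; have := xn i; rewrite /= eqxx.
Qed.

Lemma indic_box a b (x : 'rV[R]_d) :
  \1_(box a b) x = \prod_(i < d) \1_(`]a i, b i]%classic) (x 0 i) :> R.
Proof.
rewrite indicE; have [xB|xB] := pselect (box a b x).
  by rewrite mem_set// big1// => i _; rewrite indicE mem_set//; exact: xB.
have /existsNP[i nxi] : ~ forall i, `]a i, b i]%classic (x 0 i) by [].
by rewrite memNset// (bigD1 i)//= indicE memNset// mul0r.
Qed.

Lemma L12_box A : boxes A -> L12 (lebesgue_rV R d) (\1_A : 'rV[R]_d -> R).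
Proof.
by move=> GA; apply: L12_indic; [exact: measurable_boxes|exact: boxes_fin].
Qed.

End boxes.

(** * Plancherel theorem *)

Section transform.
Context (R : realType) (d : nat).
Local Notation V := ('rV[R]_d).
Local Notation mu := (lebesgue_rV R d).
Implicit Types (u v f g : V -> R) (x xi : V).

Definition pairing xi x : R := \sum_(i < d) x 0 i * xi 0 i.

Lemma pairingC xi x : pairing xi x = pairing x xi.
Proof. by apply: eq_bigr => i _; rewrite mulrC. Qed.

Lemma pairingN xi x : pairing (- xi) x = - pairing xi x.
Proof. by rewrite /pairing -sumrN; apply: eq_bigr => i _; rewrite mxE mulrN. Qed.

Lemma measurable_pairing2 : measurable_fun setT (fun p : V * V => pairing p.2 p.1).
Proof.
apply: measurable_sum => i; apply: measurable_funM.
  exact: (measurableT_comp (@measurable_rV_coord R d i) measurable_fst).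
exact: (measurableT_comp (@measurable_rV_coord R d i) measurable_snd).
Qed.

Lemma measurable_pairing xi : measurable_fun setT (pairing xi).
Proof.
apply: measurable_sum => i; apply: measurable_funM => //.
exact: measurable_rV_coord.
Qed.

Lemma measurable_cosR : measurable_fun (setT : set (measurableTypeR R)) (@cos R).
Proof. by apply: continuous_measurable_fun; exact: continuous_cos. Qed.

Lemma measurable_sinR : measurable_fun (setT : set (measurableTypeR R)) (@sin R).
Proof. by apply: continuous_measurable_fun; exact: continuous_sin. Qed.

Lemma cos_max (t : R) : `|cos t| <= 1.
Proof. by rewrite ler_norml cos_geN1 cos_le1. Qed.

Definition cosT u xi : R := \int[mu]_x (u x * cos (pairing xi x)).
Definition sinT u xi : R := \int[mu]_x (u x * sin (pairing xi x)).

Lemma fourier_integral_RR u xi :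
  @fourier_integral R d RR u xi = Complex (cosT u xi) (- sinT u xi).
Proof.
by congr (Complex _ (- _)); apply: eq_Rintegral => x _; rewrite /phase/= mul1r.
Qed.

Lemma integrable_bounded_mul u (k : V -> R) :
  mu.-integrable setT (EFin \o u) -> measurable_fun setT k ->
  (forall x, `|k x| <= 1) ->
  mu.-integrable setT (EFin \o (fun x => u x * k x)).
Proof.
move=> Iu mk k1; apply: (le_integrable _ _ _ Iu) => //.
  apply/measurable_EFinP; apply: measurable_funM => //.
  by case/integrableP : Iu => /measurable_EFinP.
by move=> x _; rewrite lee_fin normrM ler_piMr.
Qed.

Lemma integrable_mul_cos u xi : mu.-integrable setT (EFin \o u) ->
  mu.-integrable setT (EFin \o (fun x => u x * cos (pairing xi x))).
Proof.
move=> Iu; apply: integrable_bounded_mul => //; last by move=> x; exact: cos_max.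
exact: (measurableT_comp measurable_cosR (measurable_pairing xi)).
Qed.

Lemma integrable_mul_sin u xi : mu.-integrable setT (EFin \o u) ->
  mu.-integrable setT (EFin \o (fun x => u x * sin (pairing xi x))).
Proof.
move=> Iu; apply: integrable_bounded_mul => //; last by move=> x; exact: sin_max.
exact: (measurableT_comp measurable_sinR (measurable_pairing xi)).
Qed.

Lemma cosTD u v xi : mu.-integrable setT (EFin \o u) ->
  mu.-integrable setT (EFin \o v) ->
  cosT (fun x => u x + v x) xi = cosT u xi + cosT v xi.
Proof.
move=> Iu Iv; rewrite /cosT -RintegralD//; try exact: integrable_mul_cos.
by apply: eq_Rintegral => x _; rewrite mulrDl.
Qed.

Lemma sinTD u v xi : mu.-integrable setT (EFin \o u) ->
  mu.-integrable setT (EFin \o v) ->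
  sinT (fun x => u x + v x) xi = sinT u xi + sinT v xi.
Proof.
move=> Iu Iv; rewrite /sinT -RintegralD//; try exact: integrable_mul_sin.
by apply: eq_Rintegral => x _; rewrite mulrDl.
Qed.

Lemma cosTZ (c : R) u xi : mu.-integrable setT (EFin \o u) ->
  cosT (fun x => c * u x) xi = c * cosT u xi.
Proof.
move=> Iu; rewrite /cosT -RintegralZl//; last exact: integrable_mul_cos.
by apply: eq_Rintegral => x _; rewrite mulrA.
Qed.

Lemma sinTZ (c : R) u xi : mu.-integrable setT (EFin \o u) ->
  sinT (fun x => c * u x) xi = c * sinT u xi.
Proof.
move=> Iu; rewrite /sinT -RintegralZl//; last exact: integrable_mul_sin.
by apply: eq_Rintegral => x _; rewrite mulrA.
Qed.

Lemma cosTB u v xi : mu.-integrable setT (EFin \o u) ->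
  mu.-integrable setT (EFin \o v) ->
  cosT (fun x => u x - v x) xi = cosT u xi - cosT v xi.
Proof.
move=> Iu Iv; rewrite /cosT -RintegralB//; try exact: integrable_mul_cos.
by apply: eq_Rintegral => x _; rewrite mulrBl.
Qed.

Lemma sinTB u v xi : mu.-integrable setT (EFin \o u) ->
  mu.-integrable setT (EFin \o v) ->
  sinT (fun x => u x - v x) xi = sinT u xi - sinT v xi.
Proof.
move=> Iu Iv; rewrite /sinT -RintegralB//; try exact: integrable_mul_sin.
by apply: eq_Rintegral => x _; rewrite mulrBl.
Qed.

Lemma cosTN u xi : cosT u (- xi) = cosT u xi.
Proof. by apply: eq_Rintegral => x _; rewrite pairingN cosN. Qed.

Lemma sinTN u xi : mu.-integrable setT (EFin \o u) -> sinT u (- xi) = - sinT u xi.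
Proof.
move=> Iu; rewrite -mulN1r /sinT -RintegralZl//; last exact: integrable_mul_sin.
by apply: eq_Rintegral => x _; rewrite pairingN sinN mulN1r mulrN.
Qed.

Lemma norm_cosTB u v xi : mu.-integrable setT (EFin \o u) ->
  mu.-integrable setT (EFin \o v) ->
  `|cosT u xi - cosT v xi| <= \int[mu]_x `|u x - v x|.
Proof.
move=> Iu Iv; have Iuv := integrableB measurableT Iu Iv.
rewrite -cosTB//; have Ic := integrable_mul_cos xi Iuv.
apply: le_trans (le_normr_Rintegral _ Ic) _ => //.
apply: le_Rintegral (integrable_norm Ic) (integrable_norm Iuv) _ => //.
by move=> x _ /=; rewrite normrM ler_piMr// cos_max.
Qed.

Lemma norm_sinTB u v xi : mu.-integrable setT (EFin \o u) ->
  mu.-integrable setT (EFin \o v) ->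
  `|sinT u xi - sinT v xi| <= \int[mu]_x `|u x - v x|.
Proof.
move=> Iu Iv; have Iuv := integrableB measurableT Iu Iv.
rewrite -sinTB//; have Is := integrable_mul_sin xi Iuv.
apply: le_trans (le_normr_Rintegral _ Is) _ => //.
apply: le_Rintegral (integrable_norm Is) (integrable_norm Iuv) _ => //.
by move=> x _ /=; rewrite normrM ler_piMr// sin_max.
Qed.

Lemma measurable_cosT u : measurable_fun setT u -> measurable_fun setT (cosT u).
Proof.
move=> mu_; apply: (@measurable_fun_param R _ _ V V (@lebesgue_sf R d)
  (fun p => u p.1 * cos (pairing p.2 p.1))).
apply: measurable_funM; first exact: (measurableT_comp mu_ measurable_fst).
exact: (measurableT_comp measurable_cosR measurable_pairing2).
Qed.

Lemma measurable_sinT u : measurable_fun setT u -> measurable_fun setT (sinT u).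
Proof.
move=> mu_; apply: (@measurable_fun_param R _ _ V V (@lebesgue_sf R d)
  (fun p => u p.1 * sin (pairing p.2 p.1))).
apply: measurable_funM; first exact: (measurableT_comp mu_ measurable_fst).
exact: (measurableT_comp measurable_sinR measurable_pairing2).
Qed.

(* The kernel [cos + sin] of the Hartley transform is symmetric in [x] and [xi],
   and makes the transform of a real function real. *)
Lemma hartley_sym u v : mu.-integrable setT (EFin \o u) ->
  mu.-integrable setT (EFin \o v) ->
  \int[mu]_xi ((cosT u xi + sinT u xi) * v xi) =
  \int[mu]_x (u x * (cosT v x + sinT v x)).
Proof.
move=> Iu Iv.
pose k (p : V * V) := cos (pairing p.2 p.1) + sin (pairing p.2 p.1).
have mk : measurable_fun setT k.
  apply: measurable_funD.
    exact: (measurableT_comp measurable_cosR measurable_pairing2).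
  exact: (measurableT_comp measurable_sinR measurable_pairing2).
pose F p := u p.1 * v p.2 * k p.
have IF : ((@lebesgue_sf R d) \x (@lebesgue_sf R d))%E.-integrable setT (EFin \o F).
  have Iuv := @integrable_tensor _ _ _ _ _ (@lebesgue_sf R d) (@lebesgue_sf R d) _ _ Iu Iv.
  have I2 := integrableZl measurableT 2 Iuv.
  have mu_ : measurable_fun setT u by case/integrableP : Iu => /measurable_EFinP.
  have mv_ : measurable_fun setT v by case/integrableP : Iv => /measurable_EFinP.
  apply: (le_integrable _ _ _ I2) => //.
    apply/measurable_EFinP; apply: measurable_funM => //; apply: measurable_funM.
      exact: (measurableT_comp mu_ measurable_fst).
    exact: (measurableT_comp mv_ measurable_snd).
  move=> p _.
  change (`|F p|%:E <= `|2 * (u p.1 * v p.2)|%:E)%E.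
  rewrite lee_fin /F [leLHS]normrM [leRHS]normrM [leLHS]mulrC; apply: ler_wpM2r => //.
  rewrite (@ger0_norm _ 2)// /k; apply: le_trans (ler_normD _ _) _.
  by apply: (@le_trans _ _ (1 + 1)) => //; apply: lerD; [exact: cos_max|exact: sin_max].
have E1 xi : ((cosT u xi + sinT u xi) * v xi)%:E = (\int[mu]_x (F (x, xi))%:E)%E.
  have Ic := integrable_mul_cos xi Iu; have Is := integrable_mul_sin xi Iu.
  have Ics := integrableD measurableT Ic Is.
  rewrite /cosT /sinT -RintegralD// -RintegralZr//.
  rewrite /Rintegral fineK; last first.
    by apply: integrable_fin_num => //; exact: (integrableZr measurableT (v xi) Ics).
  by apply: eq_integral => x _; congr EFin; rewrite /F /k/=; ring.
have E2 x : (u x * (cosT v x + sinT v x))%:E = (\int[mu]_xi (F (x, xi))%:E)%E.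
  have Ic := integrable_mul_cos x Iv; have Is := integrable_mul_sin x Iv.
  have Ics := integrableD measurableT Ic Is.
  rewrite /cosT /sinT -RintegralD// -RintegralZl//.
  rewrite /Rintegral fineK; last first.
    by apply: integrable_fin_num => //; exact: (integrableZl measurableT (u x) Ics).
  by apply: eq_integral => xi _; congr EFin; rewrite /F /k/= (pairingC x); ring.
rewrite /Rintegral; congr fine.
transitivity (\int[mu]_xi \int[mu]_x (F (x, xi))%:E)%E; first exact: eq_integral.
transitivity (\int[mu]_x \int[mu]_xi (F (x, xi))%:E)%E; last exact: eq_integral.
exact/esym/(Fubini IF).
Qed.

End transform.

Section box_transform.
Context (R : realType) (d : nat).
Local Notation V := ('rV[R]_d).
Local Notation mu := (lebesgue_rV R d).
Local Notation leb := (@lebesgue_measure R).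

Lemma prod_polar I (s : seq I) (r t : I -> R) :
  \prod_(i <- s) Complex (r i * cos (t i)) (- (r i * sin (t i))) =
  Complex ((\prod_(i <- s) r i) * cos (\sum_(i <- s) t i))
          (- ((\prod_(i <- s) r i) * sin (\sum_(i <- s) t i))).
Proof.
elim: s => [|i s IH]; first by rewrite !big_nil cos0 sin0 mulr0 oppr0 mulr1.
rewrite !big_cons IH cosD sinD.
by apply/eqP; rewrite eq_complex/=; apply/andP; split; apply/eqP; ring.
Qed.

Lemma prod_real I (s : seq I) (r : I -> R) :
  \prod_(i <- s) Complex (r i) 0 = Complex (\prod_(i <- s) r i) 0.
Proof.
elim: s => [|i s IH]; first by rewrite !big_nil.
rewrite !big_cons IH.
by apply/eqP; rewrite eq_complex/=; apply/andP; split; apply/eqP; ring.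
Qed.

Lemma prod_mul_conj I (s : seq I) (f g : I -> R[i]) :
  (\prod_(i <- s) f i) * conjc (\prod_(i <- s) g i) =
  \prod_(i <- s) (f i * conjc (g i)).
Proof.
elim: s => [|i s IH]; first by rewrite !big_nil mul1r; apply/eqP; rewrite eq_complex/= oppr0 !eqxx.
by rewrite !big_cons -IH rmorphM; ring.
Qed.

Lemma transform_box (a b : 'I_d -> R) (xi : V) : (forall i, a i <= b i) ->
  Complex (cosT \1_(box a b) xi) (- sinT \1_(box a b) xi) =
  \prod_(i < d) fourier_itv (a i) (b i) (xi 0 i).
Proof.
move=> ab.
pose phi (i : 'I_d) (t : R) : R[i] :=
  Complex (\1_(`]a i, b i]%classic) t * cos (t * xi 0 i))
          (- (\1_(`]a i, b i]%classic) t * sin (t * xi 0 i))).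
have Ic i : leb.-integrable setT (EFin \o
    (fun t => \1_(`]a i, b i]%classic) t * cos (t * xi 0 i))).
  apply: integrable_indicM => [|x]; last exact: cos_max.
  by apply: continuous_measurable_fun; exact: continuous_cosM.
have Is i : leb.-integrable setT (EFin \o
    (fun t => \1_(`]a i, b i]%classic) t * sin (t * xi 0 i))).
  apply: integrable_indicM => [|x]; last exact: sin_max.
  by apply: continuous_measurable_fun; exact: continuous_sinM.
have Iphi i : cintegrable leb (phi i).
  split; first exact: Ic.
  exact: (integrableN (Is i)).
have Ephi i : cint leb (phi i) = fourier_itv (a i) (b i) (xi 0 i).
  rewrite /cint /fourier_itv; congr Complex.
  rewrite -[RHS]mulN1r /sin_itv -(RintegralZl (-1) measurableT (Is i)).
  by apply: eq_Rintegral => t _; rewrite mulN1r.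
have [_ E] := cint_prod Iphi.
rewrite -(eq_bigr _ (fun i _ => Ephi i)) -E.
have phiE (x : V) : \prod_(j < d) phi j (x 0 j) =
    Complex (\1_(box a b) x * cos (pairing xi x)) (- (\1_(box a b) x * sin (pairing xi x))).
  by rewrite prod_polar -indic_box.
have IB : mu.-integrable setT (EFin \o (\1_(box a b) : V -> R)).
  by apply: (L12_box _).1; exists a, b.
rewrite /cint; congr Complex.
  by apply: eq_Rintegral => x _; rewrite phiE.
rewrite -[LHS]mulN1r /sinT -(RintegralZl (-1) measurableT (integrable_mul_sin xi IB)).
by apply: eq_Rintegral => x _; rewrite phiE mulN1r.
Qed.

(** This is (2 pi)^d: one factor for each coordinate. *)
Definition plancherel_cst : R := (2 * versin_cst R) ^+ d.

Lemma plancherel_cst_gt0 : 0 < plancherel_cst.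
Proof. by rewrite exprn_gt0// mulr_gt0// versin_cst_gt0. Qed.

Lemma dot_box (a b c e : 'I_d -> R) :
  dot mu \1_(box a b) \1_(box c e) =
  \prod_(i < d) \int[leb]_t (\1_(`]a i, b i]%classic) t * \1_(`]c i, e i]%classic) t).
Proof.
pose phi (i : 'I_d) (t : R) : R[i] :=
  Complex (\1_(`]a i, b i]%classic) t * \1_(`]c i, e i]%classic) t) 0.
have Iphi i : cintegrable leb (phi i).
  split; last exact: integrable0.
  apply: integrable_indicM; first exact: measurable_indic.
  by move=> x; rewrite indicE; case: (_ \in _); rewrite ?normr1 ?normr0.
have [_] := cint_prod Iphi.
rewrite (eq_bigr (fun i => Complex (\int[leb]_t
    (\1_(`]a i, b i]%classic) t * \1_(`]c i, e i]%classic) t)) 0)); last first.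
  by move=> i _; rewrite /cint; congr Complex; rewrite Rintegral_cst// mul0r.
rewrite prod_real => -[<- _]; apply: eq_Rintegral => x _.
by rewrite prod_real/= !indic_box big_split.
Qed.

Lemma box_isometry (a b c e : 'I_d -> R) :
  (forall i, a i <= b i) -> (forall i, c i <= e i) ->
  let u := \1_(box a b) : V -> R in let v := \1_(box c e) : V -> R in
  mu.-integrable setT (EFin \o (fun xi => cosT u xi * cosT v xi + sinT u xi * sinT v xi)) /\
  \int[mu]_xi (cosT u xi * cosT v xi + sinT u xi * sinT v xi) =
  plancherel_cst * dot mu u v.
Proof.
move=> ab ce u v.
pose phi (i : 'I_d) (t : R) : R[i] :=
  fourier_itv (a i) (b i) t * conjc (fourier_itv (c i) (e i) t).
have Iphi i : cintegrable leb (phi i) := (fourier_itv_isometry (ab i) (ce i)).1.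
have [[I _] E] := cint_prod Iphi.
have phiE (xi : V) : complex.Re (\prod_(j < d) phi j (xi 0 j)) =
    cosT u xi * cosT v xi + sinT u xi * sinT v xi.
  rewrite -prod_mul_conj -!transform_box// Re_mulc/=.
  by rewrite /u /v; ring.
split; first by move: I; rewrite /comp; under eq_fun do rewrite phiE.
move: E; rewrite (eq_bigr _ (fun i _ => (fourier_itv_isometry (ab i) (ce i)).2)).
rewrite prod_real => -[+ _].
rewrite big_split/= prodr_const card_ord -dot_box => <-.
by apply: eq_Rintegral => xi _; rewrite phiE.
Qed.

End box_transform.

(** * From boxes to all integrable and square-integrable functions *)

Section isometry_L12.
Context (R : realType) (d : nat).
Local Notation V := ('rV[R]_d).
Local Notation mu := (lebesgue_rV R d).
Local Notation sq := (Lfun mu 2%:E).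
Local Notation dot := (dot mu).
Local Notation c := (plancherel_cst R d).
Implicit Types (u v f g s : V -> R).

(** The span of the indicators of boxes, as an inductive predicate so that linear facts are proved
    by induction without handling finite sums. *)
Inductive is_step : (V -> R) -> Prop :=
| is_step_box a b : (forall i, a i <= b i) -> is_step \1_(box a b)
| is_stepD u v : is_step u -> is_step v -> is_step (fun x => u x + v x)
| is_stepZ k u : is_step u -> is_step (fun x => k * u x).

Lemma L12_step u : is_step u -> L12 mu u.
Proof.
elim=> [a b ab|? ? _ ? _ ?|? ? _ ?]; [|exact: L12D|exact: L12Z].
by apply: L12_box; exists a, b.
Qed.

Lemma is_stepB u v : is_step u -> is_step v -> is_step (fun x => u x - v x).
Proof.
move=> su sv; rewrite (_ : (fun _ => _) = fun x => u x + -1 * v x).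
  by apply: is_stepD => //; exact: is_stepZ.
by apply/funext => x; rewrite mulN1r.
Qed.

(** For a box, the squares of both transforms lie below the integrand of [box_isometry] with two
    equal boxes; linearity does the rest. *)
Lemma step_Lfun2 u : is_step u -> cosT u \in sq /\ sinT u \in sq.
Proof.
elim=> [a b ab|f g sf [IH1 IH2] sg [IH3 IH4]|k f sf [IH1 IH2]]; last 2 first.
- have [fL _] := L12_step sf; have [gL _] := L12_step sg; split.
    rewrite (_ : cosT _ = fun xi => cosT f xi + cosT g xi); first exact: Lfun2D.
    by apply/funext => xi; exact: cosTD.
  rewrite (_ : sinT _ = fun xi => sinT f xi + sinT g xi); first exact: Lfun2D.
  by apply/funext => xi; exact: sinTD.
- have [fL _] := L12_step sf; split.
    rewrite (_ : cosT _ = fun xi => k * cosT f xi); first exact: Lfun2Z.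
    by apply/funext => xi; exact: cosTZ.
  rewrite (_ : sinT _ = fun xi => k * sinT f xi); first exact: Lfun2Z.
  by apply/funext => xi; exact: sinTZ.
have [I _] := box_isometry ab ab.
have mB : measurable_fun setT (\1_(box a b) : V -> R).
  by apply: L12_measurable; apply: L12_box; exists a, b.
split; apply/Lfun2P.
  split; first exact: measurable_cosT.
  apply: (le_integrable _ _ _ I) => //.
    by apply/measurable_EFinP; apply: measurable_funX; exact: measurable_cosT.
  move=> xi _; rewrite lee_fin -!expr2 !ger0_norm ?addr_ge0 ?sqr_ge0//.
  by rewrite lerDl sqr_ge0.
split; first exact: measurable_sinT.
apply: (le_integrable _ _ _ I) => //.
  by apply/measurable_EFinP; apply: measurable_funX; exact: measurable_sinT.
move=> xi _; rewrite lee_fin -!expr2 !ger0_norm ?addr_ge0 ?sqr_ge0//.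
by rewrite lerDr sqr_ge0.
Qed.

Let isom u v := dot (cosT u) (cosT v) + dot (sinT u) (sinT v) = c * dot u v.

Let isomC u v : isom u v -> isom v u.
Proof. rewrite /isom => E.
by rewrite (dotC _ (cosT v)) (dotC _ (sinT v)) (dotC _ v) E. Qed.

Let isomD u v w : is_step u -> is_step v -> is_step w ->
  isom u w -> isom v w -> isom (fun x => u x + v x) w.
Proof.
move=> su sv sw; rewrite /isom => Eu Ev.
have [uL1 uL2] := L12_step su; have [vL1 vL2] := L12_step sv.
have [wL1 wL2] := L12_step sw.
have [cu du] := step_Lfun2 su; have [cv dv] := step_Lfun2 sv.
have [cw dw] := step_Lfun2 sw.
rewrite (_ : cosT (fun x => u x + v x) = fun xi => cosT u xi + cosT v xi); last first.
  by apply/funext => xi; exact: cosTD.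
rewrite (_ : sinT (fun x => u x + v x) = fun xi => sinT u xi + sinT v xi); last first.
  by apply/funext => xi; exact: sinTD.
by rewrite (dotDl cu cv cw) (dotDl du dv dw) (dotDl uL2 vL2 wL2) mulrDr -Eu -Ev addrACA.
Qed.

Let isomZ k u w : is_step u -> is_step w -> isom u w -> isom (fun x => k * u x) w.
Proof.
move=> su sw; rewrite /isom => Eu.
have [uL1 uL2] := L12_step su; have [wL1 wL2] := L12_step sw.
have [cu du] := step_Lfun2 su; have [cw dw] := step_Lfun2 sw.
rewrite (_ : cosT (fun x => k * u x) = fun xi => k * cosT u xi); last first.
  by apply/funext => xi; exact: cosTZ.
rewrite (_ : sinT (fun x => k * u x) = fun xi => k * sinT u xi); last first.
  by apply/funext => xi; exact: sinTZ.
by rewrite (dotZl k cu cw) (dotZl k du dw) (dotZl k uL2 wL2) mulrCA -Eu mulrDr.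
Qed.

(** Both sides are bilinear and symmetric, so two inductions reduce the identity to a pair of
    boxes. *)
Lemma step_isometry u v : is_step u -> is_step v ->
  dot (cosT u) (cosT v) + dot (sinT u) (sinT v) = c * dot u v.
Proof.
move=> su sv; rewrite -/(isom u v); elim: su => [a b ab|f g sf IHf sg IHg|k f sf IHf].
- have sB := is_step_box ab; apply: isomC; elim: sv => [a' b' ab'|f g sf IHf sg IHg|k f sf IHf].
  + have sB' := is_step_box ab'.
    have [c1 s1] := step_Lfun2 sB; have [c2 s2] := step_Lfun2 sB'.
    rewrite /isom -(box_isometry ab' ab).2; apply: esym.
    exact: (RintegralD measurableT (dot_integrable c2 c1) (dot_integrable s2 s1)).
  + exact: isomD.
  + exact: isomZ.
- exact: isomD.
- exact: isomZ.
Qed.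

Lemma step_dense f : L12 mu f -> exists s : nat -> V -> R,
  (forall n, is_step (s n)) /\ cvg12 mu s f.
Proof.
move=> fL.
(* In this epsilon form, closure under limits needs no diagonal sequence; the sequence is extracted
   once, with e = 1 / (n + 1). *)
pose W g := forall e, 0 < e -> exists s, [/\ is_step s,
  \int[mu]_x `|s x - g x| <= e & dot (fun x => s x - g x) (fun x => s x - g x) <= e].
suff Wf : W f.
  have /choice[s sP] : forall n : nat, exists s, [/\ is_step s,
      \int[mu]_x `|s x - f x| <= n.+1%:R^-1 &
      dot (fun x => s x - f x) (fun x => s x - f x) <= n.+1%:R^-1].
    by move=> n; apply: Wf; rewrite invr_gt0.
  exists s; split=> [n|]; first by have [] := sP n.
  have h0 : (fun n : nat => n.+1%:R^-1 : R) @ \oo --> (0 : R) by exact: cvg_harmonic.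
  split; apply: (cvg0_le _ h0) => n; have [_ s1 s2] := sP n.
    by rewrite ger0_norm// Rintegral_ge0.
  by rewrite ger0_norm// dot_ge0.
have normD g h k : L12 mu g -> L12 mu h -> L12 mu k ->
    \int[mu]_x `|g x - k x| <= \int[mu]_x `|g x - h x| + \int[mu]_x `|h x - k x|.
  move=> gL hL kL; have [gh _] := L12B gL hL; have [hk _] := L12B hL kL.
  have [gk _] := L12B gL kL.
  have ngh := integrable_norm gh; have nhk := integrable_norm hk.
  rewrite -RintegralD//; apply: le_Rintegral => //; first exact: integrable_norm gk.
    exact: (integrableD measurableT ngh nhk).
  by move=> x _; rewrite -(subrKA (h x)) ler_normD.
have dotD' g h k : L12 mu g -> L12 mu h -> L12 mu k ->
    dot (fun x => g x - k x) (fun x => g x - k x) <=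
    2 * dot (fun x => g x - h x) (fun x => g x - h x) +
    2 * dot (fun x => h x - k x) (fun x => h x - k x).
  move=> gL hL kL; have [_ gh] := L12B gL hL; have [_ hk] := L12B hL kL.
  apply: le_trans (dotDD_le gh hk).
  by rewrite le_eqVlt; apply/orP; left; apply/eqP/eq_Rintegral => x _; rewrite subrKA.
apply: (@L12_ind _ _ _ mu (@boxes R d)) fL.
- exact: boxes_setI.
- exact: measurable_boxes.
- exact: boxes_fin.
- exact: boxes_generate.
- exact: boxes_cube.
- exact: nondecreasing_cube.
- exact: bigcup_cube.
- move=> _ [a [b [ab ->]]] e e0; exists \1_(box a b); split.
  + exact: is_step_box.
  + under eq_Rintegral do rewrite subrr normr0.
    by rewrite Rintegral_cst// mul0r ltW.
  + rewrite (_ : (fun _ => _) = fun=> 0) ?dot0l ?ltW//.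
    by apply/funext => x; rewrite subrr.
- move=> g h gL hL Wg Wh e e0; have e4 : 0 < e / 4 by rewrite divr_gt0.
  have [s [s1 s2 s3]] := Wg _ e4; have [t [t1 t2 t3]] := Wh _ e4.
  have sL := L12_step s1; have tL := L12_step t1.
  have [sg1 sg2] := L12B sL gL; have [th1 th2] := L12B tL hL.
  exists (fun x => s x + t x); split; first exact: is_stepD.
  + apply: (@le_trans _ _ (\int[mu]_x (`|s x - g x| + `|t x - h x|))); last first.
      by rewrite RintegralD//; [lra|exact: integrable_norm|exact: integrable_norm].
    have [st _] := L12B (L12D sL tL) (L12D gL hL).
    apply: le_Rintegral => //; first exact: (integrable_norm st).
      exact: (integrableD measurableT (integrable_norm sg1) (integrable_norm th1)).
    by move=> x _; rewrite opprD addrACA ler_normD.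
  + apply: (@le_trans _ _ (2 * (e / 4) + 2 * (e / 4))); last by lra.
    rewrite (_ : (fun x => _) = fun x => (s x - g x) + (t x - h x)); last first.
      by apply/funext => x; rewrite opprD addrACA.
    apply: le_trans (dotDD_le sg2 th2) _.
    by apply: lerD; rewrite ler_pM2l.
- move=> k g gL Wg e e0.
  (* The divisor dominates both |k|, the factor of the L^1 norm, and k^2, the factor of the squared
     L^2 norm; the 1 keeps it positive at k = 0. *)
  have k0 : 0 < 1 + `|k| + k ^+ 2 by rewrite -addrA ltr_pwDl// addr_ge0// sqr_ge0.
  have [s [s1 s2 s3]] := Wg _ (divr_gt0 e0 k0).
  have sL := L12_step s1; have [sg1 sg2] := L12B sL gL.
  exists (fun x => k * s x); split; first exact: is_stepZ.
  + under eq_Rintegral do rewrite -mulrBr normrM.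
    rewrite RintegralZl//; last exact: integrable_norm.
    apply: (@le_trans _ _ (`|k| * (e / (1 + `|k| + k ^+ 2)))); first exact: ler_wpM2l.
    rewrite mulrCA ger_pMr// ler_pdivrMr// mul1r.
    by have := sqr_ge0 k; lra.
  + rewrite (_ : (fun x => _) = fun x => k * (s x - g x)); last first.
      by apply/funext => x; rewrite mulrBr.
    rewrite dotZl ?Lfun2Z// dotZr// mulrA -expr2.
    apply: (@le_trans _ _ (k ^+ 2 * (e / (1 + `|k| + k ^+ 2)))).
      by apply: ler_wpM2l => //; exact: sqr_ge0.
    rewrite mulrCA ger_pMr// ler_pdivrMr// mul1r.
    by have := normr_ge0 k; lra.
- move=> u g uL Wu gL [u1 u2] e e0; have e4 : 0 < e / 4 by rewrite divr_gt0.
  have [N1 _ N1P] := (cvgr0Pnorm_le _).1 u1 _ e4.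
  have [N2 _ N2P] := (cvgr0Pnorm_le _).1 u2 _ e4.
  pose n := maxn N1 N2.
  have {}u1 := N1P n (leq_maxl _ _); have {}u2 := N2P n (leq_maxr _ _).
  have [s [s1 s2 s3]] := Wu n _ e4; have sL := L12_step s1.
  exists s; split=> //.
  + apply: le_trans (normD _ _ _ sL (uL n) gL) _.
    by move: u1 => /=; rewrite ger0_norm ?Rintegral_ge0//; lra.
  + apply: le_trans (dotD' _ _ _ sL (uL n) gL) _.
    by move: u2 => /=; rewrite ger0_norm ?dot_ge0//; lra.
Qed.

(** The isometry on steps makes the transforms of [s n] Cauchy in L^2, while L^1 convergence gives
    their pointwise limit; [cvg2_fatou] shows that this limit is also the L^2 limit. *)
Lemma cvg12_transform (s : nat -> V -> R) u : (forall n, is_step (s n)) -> L12 mu u ->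
  cvg12 mu s u -> [/\ cosT u \in sq, sinT u \in sq,
    cvg2 mu (fun n => cosT (s n)) (cosT u) & cvg2 mu (fun n => sinT (s n)) (sinT u)].
Proof.
move=> ss uL [su1 su2].
have sL n := L12_step (ss n).
have sc : cauchy2 mu s.
  by apply: (cvg2_cauchy _ _ su2); [move=> n; exact: (sL n).2|exact: uL.2].
have E m n :
    dot (fun x => cosT (s m) x - cosT (s n) x) (fun x => cosT (s m) x - cosT (s n) x) +
    dot (fun x => sinT (s m) x - sinT (s n) x) (fun x => sinT (s m) x - sinT (s n) x) =
    c * dot (fun x => s m x - s n x) (fun x => s m x - s n x).
  have smn := is_stepB (ss m) (ss n).
  rewrite -step_isometry//; congr (_ + _).
    by congr dot; apply/funext => xi; rewrite (cosTB _ (sL m).1 (sL n).1).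
  by congr dot; apply/funext => xi; rewrite (sinTB _ (sL m).1 (sL n).1).
have c0 := plancherel_cst_gt0 R d.
have cc : cauchy2 mu (fun n => cosT (s n)).
  by apply: cauchy2_dominated c0 _ sc => m n; rewrite -E lerDl dot_ge0.
have cs : cauchy2 mu (fun n => sinT (s n)).
  by apply: cauchy2_dominated c0 _ sc => m n; rewrite -E lerDr dot_ge0.
have pc xi : cosT (s n) xi @[n --> \oo] --> cosT u xi.
  apply/subr_cvg0; apply: (cvg0_le _ su1) => n.
  by apply: norm_cosTB; [exact: (sL n).1|exact: uL.1].
have ps xi : sinT (s n) xi @[n --> \oo] --> sinT u xi.
  apply/subr_cvg0; apply: (cvg0_le _ su1) => n.
  by apply: norm_sinTB; [exact: (sL n).1|exact: uL.1].
have mu_ := L12_measurable uL.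
have [C1 C2] : cosT u \in sq /\ cvg2 mu (fun n => cosT (s n)) (cosT u).
  apply: (@cvg2_fatou _ _ _ _ _ _ id) => //.
  - by move=> n; exact: (step_Lfun2 (ss n)).1.
  - exact: measurable_cosT.
  - by apply: aeW => xi; exact: pc.
have [S1 S2] : sinT u \in sq /\ cvg2 mu (fun n => sinT (s n)) (sinT u).
  apply: (@cvg2_fatou _ _ _ _ _ _ id) => //.
  - by move=> n; exact: (step_Lfun2 (ss n)).2.
  - exact: measurable_sinT.
  - by apply: aeW => xi; exact: ps.
by [].
Qed.

Lemma transform_Lfun2 u : L12 mu u -> cosT u \in sq /\ sinT u \in sq.
Proof. by move=> uL; have [s [ss su]] := step_dense uL; have [] := cvg12_transform ss uL su. Qed.

Lemma plancherel_L12 u : L12 mu u ->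
  dot (cosT u) (cosT u) + dot (sinT u) (sinT u) = c * dot u u.
Proof.
move=> uL; have [s [ss su]] := step_dense uL.
have [uc us cc cs] := cvg12_transform ss uL su.
have sL n := step_Lfun2 (ss n).
have L1 : (fun n => dot (cosT (s n)) (cosT (s n)) + dot (sinT (s n)) (sinT (s n)))
    @ \oo --> dot (cosT u) (cosT u) + dot (sinT u) (sinT u).
  by apply: cvgD; apply: cvg2_dot => //; by [move=> n; case: (sL n)].
have L2 : (fun n => c * dot (s n) (s n)) @ \oo --> c * dot u u.
  apply: cvgMr; apply: cvg2_dot => //; try exact: uL.2; try exact: su.2;
  by move=> n; exact: (L12_step (ss n)).2.
have E n : dot (cosT (s n)) (cosT (s n)) + dot (sinT (s n)) (sinT (s n)) =
  c * dot (s n) (s n) by exact: step_isometry.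
rewrite -(funext E) in L2.
exact: (cvg_unique _ L1 L2).
Qed.

End isometry_L12.

Section Lnorm_dot.
Context d (T : measurableType d) (R : realType) (mu : {measure set T -> \bar R}).

Lemma Lnorm2_sqrt (g : T -> R) (r : R) : (\int[mu]_x (g x ^+ 2)%:E = r%:E)%E ->
  Lnorm mu 2%:E (EFin \o g) = (Num.sqrt r)%:E.
Proof.
move=> gr; rewrite unlock /Lnorm.
under eq_integral => x _ do rewrite /= powR_mulrn// real_normK ?num_real//.
by rewrite gr poweR_EFin powR12_sqrt// -lee_fin -gr integral_ge0// => x _; rewrite lee_fin sqr_ge0.
Qed.

(** Bridge from the norms that appear in [is_fourier] to squared norms, which are easier to compute
    with. *)
Lemma Lnorm2_cvg (g : nat -> T -> R) (r : nat -> R) :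
  (forall n, \int[mu]_x (g n x ^+ 2)%:E = (r n)%:E)%E ->
  Lnorm mu 2%:E (EFin \o g n) @[n --> \oo] --> 0%E <-> r @ \oo --> (0 : R).
Proof.
move=> gr; have r0 n : 0 <= r n.
  by rewrite -lee_fin -gr integral_ge0// => x _; rewrite lee_fin sqr_ge0.
have -> : (fun n => Lnorm mu 2%:E (EFin \o g n)) = (fun n => (Num.sqrt (r n))%:E).
  by apply/funext => n; exact: Lnorm2_sqrt.
split=> [/fine_cvg /= H|H].
  have -> : r = (fun n => Num.sqrt (r n) * Num.sqrt (r n)).
    by apply/funext => n; rewrite -expr2 sqr_sqrtr.
  by rewrite -(mulr0 0); apply: cvgM.
apply: cvg_EFin; first by near=> n.
rewrite -sqrtr0.
by apply: (@cvg_comp _ _ _ r Num.sqrt _ _ _ H); exact: sqrt_continuous.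
Unshelve. all: by end_near. Qed.

Lemma eq_ae_sym (f g : T -> R) : f = g %[ae mu] -> g = f %[ae mu].
Proof. by apply: filterS => x /[apply]. Qed.

Lemma eq_ae_trans (f g h : T -> R) : f = g %[ae mu] -> g = h %[ae mu] -> f = h %[ae mu].
Proof. by apply: filterS2 => x fg gh xT; rewrite fg// gh. Qed.

Lemma cvg2_ext u (f g : T -> R) : (forall n, u n \in Lfun mu 2%:E) ->
  f \in Lfun mu 2%:E -> g \in Lfun mu 2%:E -> f = g %[ae mu] ->
  cvg2 mu u f -> cvg2 mu u g.
Proof.
move=> uL fL gL fg uf; rewrite /cvg2.
rewrite (_ : (fun n => _) = (fun n =>
  dot mu (fun x => u n x - f x) (fun x => u n x - f x)))//.
apply/funext => n.
have ufL := Lfun2B (uL n) fL; have ugL := Lfun2B (uL n) gL.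
have E : (fun x => u n x - f x) = (fun x => u n x - g x) %[ae mu].
  by apply: filterS fg => x fg xT; rewrite fg.
by rewrite (eq_ae_dot ufL ugL ufL E) dotC (eq_ae_dot ufL ugL ugL E).
Qed.

Lemma cvg2_unique u (f g : T -> R) : (forall n, u n \in Lfun mu 2%:E) ->
  f \in Lfun mu 2%:E -> g \in Lfun mu 2%:E ->
  cvg2 mu u f -> cvg2 mu u g -> f = g %[ae mu].
Proof.
move=> uL fL gL uf ug.
have fgL := Lfun2B fL gL.
have : dot mu (fun x => f x - g x) (fun x => f x - g x) = 0.
  set D := dot _ _ _.
  suff H : (fun _ : nat => D) @ \oo --> (0 : R).
    exact: (cvg_unique _ (@cvg_cst _ _ _ _ _) H).
  apply: (@cvg0_le _ _ (fun n =>
    2 * dot mu (fun x => u n x - f x) (fun x => u n x - f x) +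
    2 * dot mu (fun x => u n x - g x) (fun x => u n x - g x))) => [n|].
    rewrite ger0_norm ?dot_ge0// (dotBBC mu _ f).
    apply: le_trans (dotDD_le (Lfun2B fL (uL n)) (Lfun2B (uL n) gL)).
    by rewrite le_eqVlt; apply/orP; left; apply/eqP/eq_Rintegral => x _; rewrite subrKA.
  rewrite -[X in _ --> X](addr0 0); apply: cvgD; rewrite -(mulr0 2);
  by apply: cvgMr.
move=> /(dot0_ae fgL); apply: filterS => x H xT.
by apply/eqP; rewrite -subr_eq0; apply/eqP; exact: H.
Qed.

End Lnorm_dot.

(** * Cosine and sine parts of the L^2 Fourier transform *)

Section fourier_RR.
Context (R : realType) (d : nat).
Local Notation V := ('rV[R]_d).
Local Notation mu := (lebesgue_rV R d).
Local Notation sq := (Lfun mu 2%:E).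
Local Notation dot := (dot mu).
Local Notation c := (plancherel_cst R d).
Implicit Types (f g C S : V -> R) (u : nat -> V -> R).

(* [C - i S] is the L^2 transform of [f], in the sense of [is_fourier]. *)
Definition is_trig_transform f C S := [/\ C \in sq, S \in sq &
  exists u, [/\ forall n, L12 mu (u n), cvg2 mu u f,
    cvg2 mu (fun n => cosT (u n)) C & cvg2 mu (fun n => sinT (u n)) S]].

Let L12P (u : V -> R) : u \in Lfun mu 1%:E /\ u \in Lfun mu 2%:E <-> L12 mu u.
Proof. by split=> -[u1 u2]; split=> //; apply/Lfun1_integrable. Qed.

Lemma is_fourier_RRP f (F : V -> R[i]) : f \in sq ->
  is_fourier (K := RR) f F <->
  is_trig_transform f (fun xi => complex.Re (F xi)) (fun xi => - complex.Im (F xi)).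
Proof.
move=> fL.
(* The squared modulus of the error splits into the squared errors of the cosine and sine parts; the
   sine part is minus the imaginary part. *)
have key (u : nat -> V -> R) : (forall n, L12 mu (u n)) ->
  (fun xi => complex.Re (F xi)) \in sq -> (fun xi => - complex.Im (F xi)) \in sq ->
  (Lnorm mu 2%:E (fun x => (u n x - f x)%:E) @[n --> \oo] --> 0%E <-> cvg2 mu u f) /\
  (Lnorm mu 2%:E (fun xi =>
     (Normc.normc (@fourier_integral R d RR (u n) xi - F xi))%:E) @[n --> \oo] --> 0%E <->
   (fun n => dot (fun xi => cosT (u n) xi - complex.Re (F xi))
                 (fun xi => cosT (u n) xi - complex.Re (F xi)) +
             dot (fun xi => sinT (u n) xi - - complex.Im (F xi))
                 (fun xi => sinT (u n) xi - - complex.Im (F xi))) @ \oo --> (0 : R)).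
  move=> uL FL1 FL2; split.
    apply: (Lnorm2_cvg (g := fun n x => u n x - f x)) => n.
    by rewrite -dotE//; apply: Lfun2B => //; exact: (uL n).2.
  apply: (Lnorm2_cvg (g := fun n xi =>
    Normc.normc (@fourier_integral R d RR (u n) xi - F xi))) => n.
  have [cL sL] := transform_Lfun2 (uL n).
  have d1 := Lfun2B cL FL1; have d2 := Lfun2B sL FL2.
  rewrite EFinD !dotE// -ge0_integralD//; last first.
  - by apply/measurable_EFinP; apply: measurable_funX; exact: Lfun2_measurable d2.
  - by move=> x _; rewrite lee_fin sqr_ge0.
  - by apply/measurable_EFinP; apply: measurable_funX; exact: Lfun2_measurable d1.
  - by move=> x _; rewrite lee_fin sqr_ge0.
  apply: eq_integral => xi _; rewrite -EFinD; congr EFin.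
  rewrite fourier_integral_RR; case: (F xi) => F1 F2 /=.
  by rewrite sqr_sqrtr ?addr_ge0 ?sqr_ge0//; congr (_ + _); rewrite -sqrrN; congr (_ ^+ 2); ring.
have N2 (g : V -> R) : g \in sq <-> (fun xi => - g xi) \in sq.
  have N (h : V -> R) : h \in sq -> (fun xi => - h xi) \in sq.
    move=> hL; rewrite (_ : (fun _ => _) = fun xi => -1 * h xi); first exact: Lfun2Z.
    by apply/funext => xi; rewrite mulN1r.
  split=> [/N//|/N]; rewrite (_ : (fun xi => _) = g)//.
  by apply/funext => xi; rewrite opprK.
split=> -[F1 F2 [u]].
  move=> [uL uf uF]; split=> //; first exact: ((N2 _).1 F2).
  have {}uL n : L12 mu (u n) by exact/L12P.
  have [k1 k2] := key u uL F1 ((N2 _).1 F2).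
  exists u; move/k2 : uF => uF; split=> //; first exact/k1.
    apply: (cvg0_le _ uF) => n; rewrite ger0_norm ?dot_ge0//.
    by rewrite lerDl dot_ge0.
  apply: (cvg0_le _ uF) => n; rewrite ger0_norm ?dot_ge0//.
  by rewrite lerDr dot_ge0.
move=> [uL uf uC uS]; split=> //; first exact: ((N2 (fun xi => complex.Im (F xi))).2 F2).
have [k1 k2] := key u uL F1 F2.
exists u; split; [by move=> n; apply/L12P|exact/k1|apply/k2].
by rewrite -(addr0 0); exact: cvgD.
Qed.

End fourier_RR.

Section trig_transform.
Context (R : realType) (d : nat).
Local Notation V := ('rV[R]_d).
Local Notation mu := (lebesgue_rV R d).
Local Notation sq := (Lfun mu 2%:E).
Local Notation dot := (dot mu).
Local Notation c := (plancherel_cst R d).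
Implicit Types (f g C S : V -> R) (u : nat -> V -> R).

Let Lcos u : (forall n, L12 mu (u n)) -> forall n, cosT (u n) \in sq.
Proof. by move=> uL n; have [] := transform_Lfun2 (uL n). Qed.

Let Lsin u : (forall n, L12 mu (u n)) -> forall n, sinT (u n) \in sq.
Proof. by move=> uL n; have [] := transform_Lfun2 (uL n). Qed.

Let LL u : (forall n, L12 mu (u n)) -> forall n, u n \in sq.
Proof. by move=> uL n; exact: (uL n).2. Qed.

Lemma trig_transform_plancherel f C S : f \in sq -> is_trig_transform f C S ->
  dot C C + dot S S = c * dot f f.
Proof.
move=> fL [CL SL [u [uL uf uC uS]]].
have L1 : (fun n => dot (cosT (u n)) (cosT (u n)) + dot (sinT (u n)) (sinT (u n)))
    @ \oo --> dot C C + dot S S.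
  by apply: cvgD; [exact: (cvg2_dot (Lcos uL) (Lcos uL) CL CL uC uC)|
                   exact: (cvg2_dot (Lsin uL) (Lsin uL) SL SL uS uS)].
have L2 : (fun n => c * dot (u n) (u n)) @ \oo --> c * dot f f.
  by apply: cvgMr; exact: (cvg2_dot (LL uL) (LL uL) fL fL uf uf).
rewrite -(funext (fun n => plancherel_L12 (uL n))) in L2.
exact: (cvg_unique _ L1 L2).
Qed.

Lemma is_trig_transformD f g C S C' S' : f \in sq -> g \in sq ->
  is_trig_transform f C S -> is_trig_transform g C' S' ->
  is_trig_transform (fun x => f x + g x) (fun x => C x + C' x) (fun x => S x + S' x).
Proof.
move=> fL gL [CL SL [u [uL uf uC uS]]] [CL' SL' [v [vL vf vC vS]]].
split; [exact: Lfun2D|exact: Lfun2D|].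
exists (fun n x => u n x + v n x); split.
- by move=> n; exact: L12D.
- exact: (cvg2D (LL uL) (LL vL) fL gL uf vf).
- rewrite (_ : (fun n => cosT _) = fun n xi => cosT (u n) xi + cosT (v n) xi).
    exact: (cvg2D (Lcos uL) (Lcos vL) CL CL' uC vC).
  by apply/funext => n; apply/funext => xi; exact: cosTD (uL n).1 (vL n).1.
- rewrite (_ : (fun n => sinT _) = fun n xi => sinT (u n) xi + sinT (v n) xi).
    exact: (cvg2D (Lsin uL) (Lsin vL) SL SL' uS vS).
  by apply/funext => n; apply/funext => xi; exact: sinTD (uL n).1 (vL n).1.
Qed.

Lemma is_trig_transformZ k f C S : f \in sq -> is_trig_transform f C S ->
  is_trig_transform (fun x => k * f x) (fun x => k * C x) (fun x => k * S x).
Proof.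
move=> fL [CL SL [u [uL uf uC uS]]].
split; [exact: Lfun2Z|exact: Lfun2Z|].
exists (fun n x => k * u n x); split.
- by move=> n; exact: L12Z.
- exact: (cvg2Z k (LL uL) fL uf).
- rewrite (_ : (fun n => cosT _) = fun n xi => k * cosT (u n) xi).
    exact: (cvg2Z k (Lcos uL) CL uC).
  by apply/funext => n; apply/funext => xi; exact: cosTZ (uL n).1.
- rewrite (_ : (fun n => sinT _) = fun n xi => k * sinT (u n) xi).
    exact: (cvg2Z k (Lsin uL) SL uS).
  by apply/funext => n; apply/funext => xi; exact: sinTZ (uL n).1.
Qed.

Lemma is_trig_transform_ae f C S C' S' : C' \in sq -> S' \in sq ->
  C = C' %[ae mu] -> S = S' %[ae mu] ->
  is_trig_transform f C S -> is_trig_transform f C' S'.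
Proof.
move=> CL' SL' CC' SS' [CL SL [u [uL uf uC uS]]]; split=> //.
exists u; split=> //.
  exact: (cvg2_ext (Lcos uL) CL CL' CC' uC).
exact: (cvg2_ext (Lsin uL) SL SL' SS' uS).
Qed.

(** By linearity the differences form a transform of 0, and Plancherel makes both of them vanish. *)
Lemma trig_transform_unique f C S C' S' : f \in sq ->
  is_trig_transform f C S -> is_trig_transform f C' S' ->
  C = C' %[ae mu] /\ S = S' %[ae mu].
Proof.
move=> fL fCS fCS'; have [CL SL _] := fCS; have [CL' SL' _] := fCS'.
have := is_trig_transformD fL (Lfun2Z (-1) fL) fCS (is_trig_transformZ (-1) fL fCS').
have z : (fun x => f x + -1 * f x) = fun=> 0 by apply/funext => x; rewrite mulN1r subrr.
rewrite z => /(trig_transform_plancherel (Lfun2_0 mu)).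
rewrite dot0l mulr0 => H.
have C0 := dot_ge0 mu (fun x => C x + -1 * C' x).
have S0 := dot_ge0 mu (fun x => S x + -1 * S' x).
have [E1 E2] : dot (fun x => C x + -1 * C' x) (fun x => C x + -1 * C' x) = 0 /\
    dot (fun x => S x + -1 * S' x) (fun x => S x + -1 * S' x) = 0.
  by move: H C0 S0; set p := dot _ _; set q := dot _ _; move=> *; split; lra.
split.
  have := dot0_ae (Lfun2D CL (Lfun2Z (-1) CL')) E1.
  by apply: filterS => x + xT => /(_ xT); rewrite mulN1r => /eqP; rewrite subr_eq0 => /eqP.
have := dot0_ae (Lfun2D SL (Lfun2Z (-1) SL')) E2.
by apply: filterS => x + xT => /(_ xT); rewrite mulN1r => /eqP; rewrite subr_eq0 => /eqP.
Qed.

Lemma trig_transform_inj f g C S : f \in sq -> g \in sq ->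
  is_trig_transform f C S -> is_trig_transform g C S -> f = g %[ae mu].
Proof.
move=> fL gL fCS gCS.
have := is_trig_transformD fL (Lfun2Z (-1) gL) fCS (is_trig_transformZ (-1) gL gCS).
have z (h : V -> R) : (fun x => h x + -1 * h x) = fun=> 0.
  by apply/funext => x; rewrite mulN1r subrr.
rewrite !z => /(trig_transform_plancherel (Lfun2D fL (Lfun2Z (-1) gL))).
rewrite dot0l addr0 => /esym/eqP; rewrite mulf_eq0 gt_eqF ?plancherel_cst_gt0//= => /eqP E.
have := dot0_ae (Lfun2D fL (Lfun2Z (-1) gL)) E.
by apply: filterS => x + xT => /(_ xT); rewrite mulN1r => /eqP; rewrite subr_eq0 => /eqP.
Qed.

(** Cut f to cubes: square-integrable functions are integrable on sets of finite measure, and f^2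
    dominates the squared errors. *)
Lemma L12_dense f : f \in sq -> exists u, (forall n, L12 mu (u n)) /\ cvg2 mu u f.
Proof.
move=> fL; have mf := Lfun2_measurable fL.
have L12I n : L12 mu (fun x => f x * \1_(@cube R d n) x).
  have cL : L12 mu (\1_(@cube R d n) : V -> R) by apply: L12_box; exact: boxes_cube.
  split; first exact: (dot_integrable fL cL.2).
  apply: (@le_Lfun2 _ _ _ _ _ f) => //.
    by apply: measurable_funM => //; exact: L12_measurable cL.
  move=> x; rewrite normrM ler_piMr// indicE.
  by case: (_ \in _); rewrite ?normr1 ?normr0.
exists (fun n x => f x * \1_(@cube R d n) x); split=> //.
rewrite /cvg2 /dot /Rintegral.
apply: fine_cvg; rewrite -[X in _ --> X](@integral0 _ _ _ mu setT).
apply: (@dominated_cvg _ _ _ mu setT measurableT _ _ (fun x => (f x ^+ 2)%:E)) => //.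
- move=> n; apply/measurable_EFinP.
  by apply: measurable_funM; apply: measurable_funB => //; exact: L12_measurable (L12I n).
- move=> x _; apply: cvg_EFin; first by near=> n.
  have [k _ xk] : (\bigcup_n @cube R d n) x by rewrite bigcup_cube.
  apply: cvg_near_cst; exists k => // l /= kl.
  rewrite indicE mem_set; first by rewrite mulr1 subrr mulr0.
  by have /subsetPset/(_ _ xk) := @nondecreasing_cube R d _ _ kl.
- by case/Lfun2P : fL.
- move=> n x _; rewrite lee_fin indicE.
  case: (_ \in _); rewrite ?mulr1 ?mulr0 ?subrr ?sub0r ?normr0 ?mulr0 ?normr0 ?sqr_ge0//.
  by rewrite mulrNN -expr2 ger0_norm// sqr_ge0.
Unshelve. all: by end_near. Qed.

Lemma trig_transform_exists f : f \in sq -> exists C S, is_trig_transform f C S.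
Proof.
move=> fL; have [u [uL uf]] := L12_dense fL.
have uc := cvg2_cauchy (LL uL) fL uf.
have c0 := plancherel_cst_gt0 R d.
have E m n :
    dot (fun x => cosT (u m) x - cosT (u n) x) (fun x => cosT (u m) x - cosT (u n) x) +
    dot (fun x => sinT (u m) x - sinT (u n) x) (fun x => sinT (u m) x - sinT (u n) x) =
    c * dot (fun x => u m x - u n x) (fun x => u m x - u n x).
  rewrite -(plancherel_L12 (L12B (uL m) (uL n))); congr (_ + _).
    by congr dot; apply/funext => xi; rewrite (cosTB _ (uL m).1 (uL n).1).
  by congr dot; apply/funext => xi; rewrite (sinTB _ (uL m).1 (uL n).1).
have cc : cauchy2 mu (fun n => cosT (u n)).
  by apply: cauchy2_dominated c0 _ uc => m n; rewrite -E lerDl dot_ge0.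
have cs : cauchy2 mu (fun n => sinT (u n)).
  by apply: cauchy2_dominated c0 _ uc => m n; rewrite -E lerDr dot_ge0.
have [Phi [CL uC]] := L2_complete (Lcos uL) cc.
have [Psi [SL uS]] := L2_complete (Lsin uL) cs.
exists (fun x => Phi (fun n => cosT (u n) x)), (fun x => Psi (fun n => sinT (u n) x)).
by split=> //; exists u.
Qed.

Lemma dot_opp f g : f \in sq -> g \in sq ->
  dot (fun x => f (- x)) (fun x => g (- x)) = dot f g.
Proof.
move=> /Lfun2_measurable mf /Lfun2_measurable mg; congr fine.
apply: (@integral_rV_opp R d (fun x => (f x * g x)%:E)).
by apply/measurable_EFinP; exact: measurable_funM.
Qed.

Lemma Lfun2_opp f : f \in sq -> (fun x => f (- x)) \in sq.
Proof.
move=> /Lfun2P[mf /integrableP[mf2 If]].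
have mo := @measurable_rV_opp R d.
have mf' : measurable_fun setT (fun x : V => f (- x)) by exact: measurableT_comp mf mo.
apply/Lfun2P; split=> //; apply/integrableP; split.
  by apply/measurable_EFinP; exact: measurable_funX.
rewrite (@ge0_integral_rV_opp R d (fun x => `|(f x ^+ 2)%:E|%E))//.
exact: measurableT_comp.
Qed.

(** The trace left by f being real. For integrable functions the parity is exact; the L^2 limit
    keeps it almost everywhere. *)
Lemma trig_transform_parity f C S : is_trig_transform f C S ->
  (fun xi => C (- xi)) = C %[ae mu] /\ (fun xi => S (- xi)) = (fun xi => - S xi) %[ae mu].
Proof.
move=> [CL SL [u [uL uf uC uS]]]; split.
  apply: (cvg2_unique (Lcos uL) (Lfun2_opp CL) CL _ uC).
  apply: (cvg0_le _ uC) => n.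
  rewrite ger0_norm ?dot_ge0//.
  rewrite -[leRHS](dot_opp (Lfun2B (Lcos uL n) CL) (Lfun2B (Lcos uL n) CL)).
  by under [X in _ <= dot X _]eq_fun do rewrite cosTN;
     under [X in _ <= dot _ X]eq_fun do rewrite cosTN.
have SNL : (fun xi => -1 * S xi) \in sq by exact: Lfun2Z.
have uNL n : (fun xi => -1 * sinT (u n) xi) \in sq by apply: Lfun2Z; exact: Lsin.
suff E : (fun xi => S (- xi)) = (fun xi => -1 * S xi) %[ae mu].
  by apply: filterS E => x + xT => /(_ xT); rewrite mulN1r.
apply: (cvg2_unique uNL (Lfun2_opp SL) SNL); last exact: (cvg2Z (-1) (Lsin uL) SL uS).
apply: (cvg0_le _ uS) => n.
rewrite ger0_norm ?dot_ge0//.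
rewrite -[leRHS](dot_opp (Lfun2B (Lsin uL n) SL) (Lfun2B (Lsin uL n) SL)).
by under [X in _ <= dot X _]eq_fun do rewrite (sinTN _ (uL n).1) -mulN1r;
   under [X in _ <= dot _ X]eq_fun do rewrite (sinTN _ (uL n).1) -mulN1r.
Qed.

(** An even function against an odd one: reflection changes the sign of the inner product. Hence C +
    S has the same norm as the pair (C, S). *)
Lemma trig_transform_orth f C S : is_trig_transform f C S -> dot C S = 0.
Proof.
move=> fCS; have [CL SL _] := fCS; have [PC PS] := trig_transform_parity fCS.
have E : dot C S = - dot C S.
  rewrite -[LHS](dot_opp CL SL) (eq_ae_dot (Lfun2_opp CL) CL (Lfun2_opp SL) PC) dotC.
  have SNL : (fun xi => - S xi) \in sq.
    rewrite (_ : (fun xi => - S xi) = fun xi => -1 * S xi); first exact: Lfun2Z.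
    by apply/funext => xi; rewrite mulN1r.
  rewrite (eq_ae_dot (Lfun2_opp SL) SNL CL PS).
  rewrite (_ : (fun xi => - S xi) = fun xi => -1 * S xi).
    by rewrite (dotZl (-1) SL CL) mulN1r dotC.
  by apply/funext => xi; rewrite mulN1r.
by move: E; set t := dot C S; lra.
Qed.

Lemma hartley_plancherel f C S : f \in sq -> is_trig_transform f C S ->
  dot (fun xi => C xi + S xi) (fun xi => C xi + S xi) = c * dot f f.
Proof.
move=> fL fCS; have [CL SL _] := fCS.
rewrite (dotDD CL SL) (trig_transform_orth fCS) -(trig_transform_plancherel fL fCS).
by rewrite mulr0 addr0.
Qed.

Lemma hartley_sym2 f g C S C' S' : f \in sq -> g \in sq ->
  is_trig_transform f C S -> is_trig_transform g C' S' ->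
  dot (fun xi => C xi + S xi) g = dot f (fun xi => C' xi + S' xi).
Proof.
move=> fL gL [CL SL [u [uL uf uC uS]]] [CL' SL' [v [vL vf vC vS]]].
have uH := cvg2D (Lcos uL) (Lsin uL) CL SL uC uS.
have vH := cvg2D (Lcos vL) (Lsin vL) CL' SL' vC vS.
have L1 := cvg2_dot (fun n => Lfun2D (Lcos uL n) (Lsin uL n)) (LL vL) (Lfun2D CL SL) gL uH vf.
have L2 := cvg2_dot (LL uL) (fun n => Lfun2D (Lcos vL n) (Lsin vL n)) fL (Lfun2D CL' SL') uf vH.
have E n : dot (fun xi => cosT (u n) xi + sinT (u n) xi) (v n) =
    dot (u n) (fun xi => cosT (v n) xi + sinT (v n) xi).
  exact: (hartley_sym (uL n).1 (vL n).1).
rewrite /= -(funext E) in L2.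
exact: (cvg_unique _ L1 L2).
Qed.

(* The Hartley transform H is symmetric and H/sqrt c is isometric, so H H = c. *)
Lemma hartley_inv w : w \in sq -> exists h C S,
  [/\ h \in sq, is_trig_transform h C S & (fun xi => C xi + S xi) = w %[ae mu]].
Proof.
move=> wL; have [C' [S' wCS]] := trig_transform_exists wL; have [CL' SL' _] := wCS.
have HL := Lfun2D CL' SL'.
have c0 := plancherel_cst_gt0 R d.
pose h x := c^-1 * (C' x + S' x).
have hL : h \in sq by exact: Lfun2Z.
have [C [S hCS]] := trig_transform_exists hL; have [CL SL _] := hCS.
exists h, C, S; split=> //.
have CSL := Lfun2D CL SL.
(* With h = H w / c, symmetry and isometry turn each term of |H h - w|^2 = |H h|^2 - 2 <h, H w> +
   |w|^2 into a multiple of |w|^2, with total coefficient 1 - 2 + 1. *)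
have E0 : dot (fun x => (C x + S x) - w x) (fun x => (C x + S x) - w x) = 0.
  rewrite (dotBB CSL wL) (hartley_sym2 hL wL hCS wCS) (hartley_plancherel hL hCS).
  have -> : dot h (fun xi => C' xi + S' xi) = dot w w.
    by rewrite (dotZl c^-1 HL HL) (hartley_plancherel wL wCS) mulrA mulVf ?mul1r// gt_eqF.
  have -> : c * dot h h = dot w w.
    rewrite (dotZl c^-1 HL hL) (dotZr c^-1 HL HL) (hartley_plancherel wL wCS).
    by rewrite mulrA mulfV ?gt_eqF// mul1r mulrA mulVf ?mul1r// gt_eqF.
  by set t := dot w w; lra.
have := dot0_ae (Lfun2B CSL wL) E0.
by apply: filterS => x + xT => /(_ xT) /eqP; rewrite subr_eq0 => /eqP.
Qed.

(** Hartley inversion yields a transform (C', S') with C' + S' = C + S; comparing even and odd parts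
    separates the two components. *)
Lemma trig_transform_surj C S : C \in sq -> S \in sq ->
  (fun xi => C (- xi)) = C %[ae mu] -> (fun xi => S (- xi)) = (fun xi => - S xi) %[ae mu] ->
  exists2 h, h \in sq & is_trig_transform h C S.
Proof.
move=> CL SL PC PS.
have [h [C' [S' [hL hCS E]]]] := hartley_inv (Lfun2D CL SL).
have [PC' PS'] := trig_transform_parity hCS.
have EN := ae_rV_opp E.
exists h => //.
(* The sum is needed at x and at -x, so the exceptional null set is reflected as well. *)
have H : \forall x \ae mu, [/\ C' x + S' x = C x + S x,
    C' (- x) + S' (- x) = C (- x) + S (- x), C (- x) = C x & C' (- x) = C' x] /\
    (S (- x) = - S x /\ S' (- x) = - S' x).
  have H1 : \forall x \ae mu, C' x + S' x = C x + S x /\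
      C' (- x) + S' (- x) = C (- x) + S (- x).
    by apply: filterS2 E EN => x e1 e2; split; [exact: e1|exact: e2].
  have H2 : \forall x \ae mu, C (- x) = C x /\ C' (- x) = C' x.
    by apply: filterS2 PC PC' => x e1 e2; split; [exact: e1|exact: e2].
  have H3 : \forall x \ae mu, S (- x) = - S x /\ S' (- x) = - S' x.
    by apply: filterS2 PS PS' => x e1 e2; split; [exact: e1|exact: e2].
  by apply: filterS3 H1 H2 H3 => x [? ?] [? ?] [? ?].
apply: is_trig_transform_ae hCS => //; apply: filterS H => x [[+ + + +] [+ +]] _;
move: (C x) (S x) (C' x) (S' x) (C (- x)) (S (- x)) (C' (- x)) (S' (- x)) => *; lra.
Qed.

End trig_transform.

(** * Multipliers on R^d *)

Section fourier_multiplier_RR.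
Context (R : realType) (d : nat).
Local Notation V := ('rV[R]_d).
Local Notation mu := (lebesgue_rV R d).
Local Notation sq := (Lfun mu 2%:E).
Local Notation dot := (dot mu).
Implicit Types (f g h : V -> R) (F p q : V -> R[i]).

Let re F := fun xi => complex.Re (F xi).
Let nim F := fun xi => - complex.Im (F xi).

Let reM p F xi : re (fun xi => p xi * F xi) xi = re p xi * re F xi - nim p xi * nim F xi.
Proof. by rewrite /re /nim; case: (p xi) => a b; case: (F xi) => a' b' /=; ring. Qed.

Let nimM p F xi : nim (fun xi => p xi * F xi) xi = re p xi * nim F xi + nim p xi * re F xi.
Proof. by rewrite /re /nim; case: (p xi) => a b; case: (F xi) => a' b' /=; ring. Qed.

Let normcE F xi : Normc.normc (F xi) ^+ 2 = re F xi ^+ 2 + nim F xi ^+ 2.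
Proof.
rewrite /re /nim; case: (F xi) => a b /=.
by rewrite sqr_sqrtr ?addr_ge0 ?sqr_ge0// sqrrN.
Qed.

Let sumM p F xi : re (fun xi => p xi * F xi) xi ^+ 2 + nim (fun xi => p xi * F xi) xi ^+ 2 =
  Normc.normc (p xi) ^+ 2 * Normc.normc (F xi) ^+ 2.
Proof. by rewrite reM nimM !normcE; ring. Qed.

Let cmeasurableE p : cmeasurable p -> measurable_fun setT (re p) /\ measurable_fun setT (nim p).
Proof. by move=> [p1 p2]; split=> //; exact: measurableT_comp. Qed.

Let is_fourier_sq f F : f \in sq -> is_fourier (K := RR) f F ->
  [/\ re F \in sq, nim F \in sq & cmeasurable F].
Proof.
move=> fL fF; have [F1 F2 _] := fF; have [F3 F4 _] := (is_fourier_RRP _ fL).1 fF.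
by split=> //; split; [exact: Lfun2_measurable F1|exact: Lfun2_measurable F2].
Qed.

(** A comparison principle: if the multiplier q sends f to g in L^2 and p is dominated by k q, then
    p also has an image in L^2, with the corresponding bound. Taking a Bessel symbol for q gives the
    action on Sobolev spaces. *)
Lemma multiplier_RR f g F p q k : cmeasurable p -> (forall xi, p (- xi) = conjc (p xi)) ->
  f \in sq -> g \in sq -> is_fourier (K := RR) f F ->
  is_fourier (K := RR) g (fun xi => q xi * F xi) ->
  0 <= k -> (forall xi, Normc.normc (p xi) <= k * Normc.normc (q xi)) ->
  exists h, [/\ h \in sq, is_fourier (K := RR) h (fun xi => p xi * F xi) &
    dot h h <= k ^+ 2 * dot g g].
Proof.
move=> mp ps fL gL fF gG k0 pq.
have [F1 F2 mF] := is_fourier_sq fL fF; have [G1 G2 mG] := is_fourier_sq gL gG.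
have fT := (is_fourier_RRP F fL).1 fF; have gT := (is_fourier_RRP _ gL).1 gG.
have [m1 m2] := cmeasurableE (cmeasurableM mp mF).
have le xi : re (fun xi => p xi * F xi) xi ^+ 2 + nim (fun xi => p xi * F xi) xi ^+ 2 <=
    k ^+ 2 * (re (fun xi => q xi * F xi) xi ^+ 2 + nim (fun xi => q xi * F xi) xi ^+ 2).
  rewrite !sumM mulrA ler_wpM2r ?sqr_ge0// -exprMn lerXn2r ?nnegrE//.
    by rewrite /Normc.normc; case: (p xi) => *; exact: sqrtr_ge0.
  apply: mulr_ge0 => //.
  by rewrite /Normc.normc; case: (q xi) => *; exact: sqrtr_ge0.
have IG : mu.-integrable setT (EFin \o (fun xi =>
    k ^+ 2 * (re (fun xi => q xi * F xi) xi ^+ 2 + nim (fun xi => q xi * F xi) xi ^+ 2))).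
  have [_ i1] := (Lfun2P _ _).1 G1; have [_ i2] := (Lfun2P _ _).1 G2.
  exact: (integrableZl measurableT (k ^+ 2) (integrableD measurableT i1 i2)).
have C1 : re (fun xi => p xi * F xi) \in sq.
  apply/Lfun2P; split=> //; apply: (le_integrable _ _ _ IG) => //.
    by apply/measurable_EFinP; exact: measurable_funX.
  move=> xi _; rewrite lee_fin !ger0_norm ?sqr_ge0 ?mulr_ge0 ?addr_ge0 ?sqr_ge0//.
  by apply: le_trans (le xi); rewrite lerDl sqr_ge0.
have S1 : nim (fun xi => p xi * F xi) \in sq.
  apply/Lfun2P; split=> //; apply: (le_integrable _ _ _ IG) => //.
    by apply/measurable_EFinP; exact: measurable_funX.
  move=> xi _; rewrite lee_fin !ger0_norm ?sqr_ge0 ?mulr_ge0 ?addr_ge0 ?sqr_ge0//.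
  by apply: le_trans (le xi); rewrite lerDr sqr_ge0.
have psE xi : re p (- xi) = re p xi /\ nim p (- xi) = - nim p xi.
  by rewrite /re /nim ps; case: (p xi) => a b /=.
have [PC PS] := trig_transform_parity fT.
have [h hL hT] : exists2 h, h \in sq &
    is_trig_transform h (re (fun xi => p xi * F xi)) (nim (fun xi => p xi * F xi)).
  (* The parity of the parts of p F comes from that of F and from the Hermitian symmetry of p. *)
  apply: trig_transform_surj => //.
    apply: filterS2 PC PS => xi /(_ I) e1 /(_ I) e2 _.
    have [e3 e4] := psE xi.
    rewrite reM [RHS]reM e3 e4; move: e1 e2; rewrite -/(re F (- xi)) -/(nim F (- xi)) => -> ->.
    by rewrite mulrNN.
  apply: filterS2 PC PS => xi /(_ I) e1 /(_ I) e2 _.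
  have [e3 e4] := psE xi.
  rewrite nimM [in RHS]nimM e3 e4; move: e1 e2; rewrite -/(re F (- xi)) -/(nim F (- xi)) => -> ->.
  by rewrite mulrN mulNr opprD.
exists h; split=> //; first exact/is_fourier_RRP.
rewrite -(ler_pM2l (plancherel_cst_gt0 R d)) -(trig_transform_plancherel hL hT).
rewrite mulrCA -(trig_transform_plancherel gL gT) -/(re _) -/(nim _).
rewrite -(RintegralD measurableT (dot_integrable C1 C1) (dot_integrable S1 S1)).
rewrite -(RintegralD measurableT (dot_integrable G1 G1) (dot_integrable G2 G2)).
have IG' := integrableD measurableT (dot_integrable G1 G1) (dot_integrable G2 G2).
rewrite -RintegralZl//.
apply: le_Rintegral => //.
- exact: (integrableD measurableT (dot_integrable C1 C1) (dot_integrable S1 S1)).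
- by move=> xi _; rewrite -!expr2; exact: le.
Qed.

Lemma is_fourier_RRZ k f F : f \in sq -> is_fourier (K := RR) f F ->
  is_fourier (K := RR) (fun x => k * f x) (fun xi => Complex k 0 * F xi).
Proof.
move=> fL /(is_fourier_RRP _ fL) fF; apply/(is_fourier_RRP _ (Lfun2Z k fL)).
have := is_trig_transformZ k fL fF; congr is_trig_transform; apply/funext => xi.
  by case: (F xi) => a b /=; rewrite mul0r subr0.
by case: (F xi) => a b /=; rewrite mul0r addr0 mulrN.
Qed.

Lemma eq_ae_Lfun2 f g : measurable_fun setT g -> f \in sq -> f = g %[ae mu] -> g \in sq.
Proof.
move=> mg /Lfun2P[mf /integrableP[_ If]] fg; apply/Lfun2P; split=> //; apply/integrableP; split.
  by apply/measurable_EFinP; exact: measurable_funX.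
have mg2 : measurable_fun setT (fun x => `|(g x ^+ 2)%:E|%E).
  by apply: measurableT_comp => //; apply/measurable_EFinP; exact: measurable_funX.
have mf2 : measurable_fun setT (fun x => `|(f x ^+ 2)%:E|%E).
  by apply: measurableT_comp => //; apply/measurable_EFinP; exact: measurable_funX.
rewrite (ae_eq_integral (fun x => `|(f x ^+ 2)%:E|%E))//.
by apply: filterS fg => x /(_ I) /= -> _.
Qed.

(** [is_multiplier] hides its transform behind an existential; as transforms are unique almost
    everywhere, the hidden F' can be traded for the F under study. *)
Lemma multiplier_RR_unique f h F F' p : cmeasurable p -> f \in sq -> h \in sq ->
  is_fourier (K := RR) f F -> is_fourier (K := RR) f F' ->
  is_fourier (K := RR) h (fun xi => p xi * F' xi) ->
  is_fourier (K := RR) h (fun xi => p xi * F xi).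
Proof.
move=> mp fL hL fF fF' hF'.
have [_ _ mF] := is_fourier_sq fL fF; have [m1 m2] := cmeasurableE (cmeasurableM mp mF).
have [P1 P2 _] := is_fourier_sq hL hF'.
have hT := (is_fourier_RRP _ hL).1 hF'.
have [E1 E2] := trig_transform_unique fL ((is_fourier_RRP _ fL).1 fF') ((is_fourier_RRP _ fL).1 fF).
have e1 : re (fun xi => p xi * F' xi) = re (fun xi => p xi * F xi) %[ae mu].
  by apply: filterS2 E1 E2 => xi /(_ I) e1 /(_ I) e2 _; rewrite !reM; congr (_ * _ - _ * _).
have e2 : nim (fun xi => p xi * F' xi) = nim (fun xi => p xi * F xi) %[ae mu].
  by apply: filterS2 E1 E2 => xi /(_ I) e3 /(_ I) e2 _; rewrite !nimM; congr (_ * _ + _ * _).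
apply/(is_fourier_RRP _ hL); apply: (is_trig_transform_ae _ _ e1 e2 hT).
  exact: eq_ae_Lfun2 e1.
exact: eq_ae_Lfun2 e2.
Qed.

Lemma is_fourier_RR_inj f g F : f \in sq -> g \in sq ->
  is_fourier (K := RR) f F -> is_fourier (K := RR) g F -> f = g %[ae mu].
Proof.
by move=> fL gL /(is_fourier_RRP _ fL) fF /(is_fourier_RRP _ gL); exact: trig_transform_inj.
Qed.

End fourier_multiplier_RR.

(** * Continuous functions on R^d are measurable *)

Section continuous_rV.
Context (R : realType) (d : nat).
Local Notation V := ('rV[R]_d).

(** The sigma-algebra is generated by coordinates, so U is written as a countable union of cubes
    with rational centres. *)
Lemma open_measurable_rV (U : set V) : open U -> measurable U.
Proof.
move=> oU.
pose B (a : 'rV[rat]_d * nat) : set V :=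
  [set y | forall i, [set z : measurableTypeR R | `|z - ratr (a.1 0 i)| < a.2.+1%:R^-1] (y 0 i)].
have mB a : measurable (B a).
  apply: (@measurable_box R d (fun i => [set z | `|z - ratr (a.1 0 i)| < a.2.+1%:R^-1])) => i.
  rewrite (_ : [set z | _] =
      [set` `]ratr (a.1 0 i) - a.2.+1%:R^-1, ratr (a.1 0 i) + a.2.+1%:R^-1[] )//.
  by apply/seteqP; split => z /=; rewrite in_itv/= ltr_distl.
rewrite (_ : U = \bigcup_a (if `[< B a `<=` U >] then B a else set0)).
  apply: countable_bigcupT_measurable => [|a]; first exact: countableP.
  by case: ifP.
apply/seteqP; split=> [x Ux|x [a _]]; last by case: asboolP => // + Bx; exact.
have [e /= e0 eU] : exists2 e : R, 0 < e & ball x e `<=` U.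
  by have /nbhs_ballP[e /= e0 eU] := open_nbhs_nbhs (conj oU Ux); exists e.
(* A cube of radius 1 / (n + 1) whose centre is within 1 / (n + 1) of x stays in the ball of radius
   e. *)
have [n ne] : exists n : nat, 2 * n.+1%:R^-1 < e.
  have [n _ nP] := near_infty_natSinv_lt (PosNum (divr_gt0 e0 (ltr0n _ 2))).
  have h : n.+1%:R^-1 < e / 2 := nP n (leqnn n).
  by exists n; move: h; set t := _^-1; lra.
have qP i : exists q : rat, `|x 0 i - ratr q| < n.+1%:R^-1.
  have n0 : 0 < n.+1%:R^-1 :> R by rewrite invr_gt0.
  have /rat_in_itvoo[q] : x 0 i < x 0 i + n.+1%:R^-1 by rewrite ltrDl.
  rewrite in_itv/= => /andP[h1 h2]; exists q; rewrite distrC ltr_distl.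
  by rewrite h2 andbT ltrBlDr (lt_trans h1)// ltrDl.
have /choice[q qx] := qP.
exists (\row_i q i, n) => //; rewrite asboolT.
  by move=> i /=; rewrite mxE.
move=> y By; apply: eU; split=> // i j; rewrite ord1 /ball/=.
rewrite (le_lt_trans (ler_distD (ratr (q j)) _ _))// (lt_trans _ ne)// mulr2n mulrDl mul1r ltrD//.
by have := By j; rewrite /= mxE distrC.
Qed.

Lemma continuous_measurable_rV (f : V -> R) : continuous f -> measurable_fun setT f.
Proof.
move=> cf; apply: (measurability _ (RGenOpens.measurableE R)).
move=> _ [_ [a [b ->]] <-]; rewrite setTI.
apply: open_measurable_rV; move/continuousP : cf; apply; exact: interval_open.
Qed.

End continuous_rV.

(** * Fourier series on T^d *)

Section restriction.
Context d (T : measurableType d) (R : realType) (mu : {measure set T -> \bar R}).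
Context (D : set T) (mD : measurable D).

Lemma ge0_integral_mrestr (f : T -> \bar R) : measurable_fun setT f ->
  (forall x, 0 <= f x)%E ->
  (\int[mrestr mu mD]_x f x = \int[mu]_(x in D) f x)%E.
Proof.
move=> mf f0; have mDc := measurableC mD.
have mfD A : measurable_fun A f by exact: measurable_funTS.
(* On subsets of D, mu is the sum of its restrictions to D and to the complement, and the second one
   vanishes there. *)
rewrite (eq_measure_integral (measure_add (mrestr mu mD) (mrestr mu mDc))); last first.
  move=> A mA AD; apply: etrans (esym (measure_addE _ _ _)).
  rewrite /= /mrestr setIidl// (_ : A `&` ~` D = set0) ?measure0 ?adde0//.
  by apply/disjoints_subset; rewrite setCK.
rewrite ge0_integral_measure_add// [X in (_ + X)%E]null_set_integral//; last first.
  by change (mu (D `&` ~` D) = 0%E); rewrite setICr measure0.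
rewrite adde0 -(setvU D) ge0_integral_setU//=; last by rewrite disj_set2E setICl.
rewrite [X in (X + _)%E]null_set_integral ?add0e//.
by change (mu (~` D `&` D) = 0%E); rewrite setICl measure0.
Qed.

Lemma integral_mrestr (f : T -> \bar R) : measurable_fun setT f ->
  (\int[mrestr mu mD]_x f x = \int[mu]_(x in D) f x)%E.
Proof.
move=> mf; rewrite [LHS]integralE [RHS]integralE; congr (_ - _)%E.
  by rewrite ge0_integral_mrestr//; exact: measurable_funepos.
by rewrite ge0_integral_mrestr//; exact: measurable_funeneg.
Qed.

End restriction.

Section torus.
Context (R : realType) (d : nat).
Local Notation V := ('rV[R]_d).
Local Notation Z := ('rV[int]_d).
Local Notation lam := (lebesgue_rV R d).
Local Notation nu := (vol R TT d).
Local Notation ph := (@phase R d TT).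
Local Notation sq := (Lfun nu 2%:E).
Local Notation dot := (dot nu).
Local Notation cube1 := (box (fun=> 0) (fun=> 1) : set V).
Implicit Types (f g h : V -> R) (k l : Z).

Lemma torus_setT : nu setT = 1%E.
Proof.
change (lam (setT `&` @unit_cube R d) = 1%E); rewrite setTI.
rewrite (@lebesgue_rV_box R d (fun=> [set` `[0%R, 1%R[]))// big1// => i _.
by rewrite lebesgue_measure_itv/= lte_fin ltr01 -EFinB subr0.
Qed.

(** The fundamental domain is closed on the left, the boxes on the right; both contain the open
    cube, which already has measure 1. *)
Lemma unit_cube_ae : (\1_(@unit_cube R d) : V -> R) = \1_cube1 %[ae lam].
Proof.
pose c := [set x : V | forall i, `]0, 1[%classic (x 0 i : measurableTypeR R)].
have mc : measurable c by apply: (@measurable_box R d (fun=> `]0, 1[%classic)).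
have c1 : lam c = 1%E.
  rewrite (@lebesgue_rV_box R d (fun=> `]0, 1[%classic))// big1// => i _.
  by rewrite lebesgue_measure_itv/= lte_fin ltr01 -EFinB subr0.
have E (B : set V) : measurable B -> c `<=` B -> lam B = 1%E ->
      (\1_B : V -> R) = \1_c %[ae lam].
  move=> mB cB B1.
  have N : lam (B `\` c) = 0%E.
    have Bfin : (lam B < +oo)%E by rewrite B1 ltry.
    have -> : lam (B `\` c) = (lam B - lam c)%E.
      by rewrite -[in RHS](setIidr cB); exact: (measureD mB mc Bfin).
    by rewrite B1 c1 subee.
  exists (B `\` c); split=> //; first exact: measurableD.
  move=> x /=; apply: contra_notP => nx _; rewrite !indicE.
  case: (pselect (c x)) => cx; first by rewrite (mem_set cx) (mem_set (cB _ cx)).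
  rewrite (memNset cx); case: (pselect (B x)) => Bx; first by exfalso; apply: nx.
  by rewrite (memNset Bx).
apply: (@eq_ae_trans _ _ _ _ _ \1_c).
  apply: E; first exact: (@measurable_unit_cube R d).
    by move=> x cx i; have := cx i; rewrite /= !in_itv/= => /andP[/ltW -> ->].
  rewrite (@lebesgue_rV_box R d (fun=> [set` `[0%R, 1%R[]))// big1// => i _.
  by rewrite lebesgue_measure_itv/= lte_fin ltr01 -EFinB subr0.
apply: eq_ae_sym; apply: E.
- by apply: (@measurable_boxes R d); exists (fun=> 0), (fun=> 1).
- by move=> x cx i; have := cx i; rewrite /= !in_itv/= => /andP[-> /ltW ->].
- rewrite (@lebesgue_rV_box R d (fun=> `]0, 1]%classic))// big1// => i _.
  by rewrite lebesgue_measure_itv/= lte_fin ltr01 -EFinB subr0.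
Qed.

Lemma Rintegral_torus f : measurable_fun setT f ->
  \int[nu]_x f x = \int[lam]_x (\1_cube1 x * f x).
Proof.
move=> mf; congr fine.
have mf' : measurable_fun setT (EFin \o f) by exact/measurable_EFinP.
rewrite (integral_mrestr lam (@measurable_unit_cube R d) mf') integral_mkcond.
have mB : measurable cube1 by apply: (@measurable_boxes R d); exists (fun=> 0), (fun=> 1).
apply: ae_eq_integral => //.
- apply/(measurable_restrictT _ (@measurable_unit_cube R d)); exact: measurable_funTS.
- by apply/measurable_EFinP; apply: measurable_funM => //; exact: measurable_indic.
apply: filterS unit_cube_ae => x /(_ I) E _.
rewrite -E patchE indicE; case: ifP => _; first by rewrite mul1r.
by rewrite mul0r.
Qed.

Lemma bounded_Lfun2 f (c : R) : measurable_fun setT f -> (forall x, `|f x| <= c) ->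
  f \in sq.
Proof.
move=> mf fc; apply/Lfun2P; split=> //.
apply: measurable_bounded_integrable => //.
- by rewrite torus_setT ltry.
- exact: measurable_funX.
- exists (c ^+ 2); split; first exact: num_real.
  move=> y cy x _ /=; rewrite normrX; apply: le_trans (ltW cy).
  by rewrite lerXn2r// nnegrE// (le_trans _ (fc x)).
Qed.

Lemma phaseE k x : ph k x = pairing (2 * pi *: map_mx intr k) x.
Proof.
rewrite /phase /pairing mulr_sumr; apply: eq_bigr => i _.
by rewrite /= !mxE mulrCA.
Qed.

Lemma phaseD k l x : ph (k + l) x = ph k x + ph l x.
Proof.
rewrite /phase -mulrDr -big_split/=; congr (_ * _); apply: eq_bigr => i _.
by rewrite !mxE rmorphD mulrDr.
Qed.

Lemma phaseN k x : ph (- k) x = - ph k x.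
Proof.
rewrite /phase -mulrN -sumrN/=; congr (_ * _); apply: eq_bigr => i _.
by rewrite !mxE rmorphN mulrN.
Qed.

Lemma phase0 x : ph 0 x = 0.
Proof. by rewrite /phase big1 ?mulr0// => i _; rewrite /= !mxE rmorph0 mulr0. Qed.

Definition cosk k x : R := cos (ph k x).
Definition sink k x : R := sin (ph k x).

Lemma measurable_phase k : measurable_fun setT (ph k).
Proof.
rewrite (_ : ph k = pairing (2 * pi *: map_mx intr k)); first exact: measurable_pairing.
by apply/funext => x; exact: phaseE.
Qed.

Lemma measurable_cosk k : measurable_fun setT (cosk k).
Proof. exact: (measurableT_comp (@measurable_cosR R) (measurable_phase k)). Qed.

Lemma measurable_sink k : measurable_fun setT (sink k).
Proof. exact: (measurableT_comp (@measurable_sinR R) (measurable_phase k)). Qed.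

Lemma cosk_Lfun2 k : cosk k \in sq.
Proof. by apply: (@bounded_Lfun2 _ 1) => [|x]; [exact: measurable_cosk|exact: cos_max]. Qed.

Lemma sink_Lfun2 k : sink k \in sq.
Proof. by apply: (@bounded_Lfun2 _ 1) => [|x]; [exact: measurable_sink|exact: sin_max]. Qed.

Lemma cos_sin_2piM (n : int) : cos (2 * pi * n%:~R) = 1 :> R /\ sin (2 * pi * n%:~R) = 0 :> R.
Proof.
have N (m : nat) : cos (2 * pi * m%:R) = 1 :> R /\ sin (2 * pi * m%:R) = 0 :> R.
  have -> : 2 * pi * m%:R = 0 + pi *+ 2 *+ m :> R.
    by rewrite add0r -[RHS]mulr_natr -[pi *+ 2]mulr_natl.
  by rewrite (periodicn (@cosD2pi R)) (periodicn (@sinD2pi R)) cos0 sin0.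
case: n => n; first by rewrite -pmulrn; exact: N.
have [c1 s1] := N n.+1.
by rewrite NegzE mulrNz mulrN -pmulrn cosN sinN c1 s1 oppr0.
Qed.

Let fourier_itv01 (n : int) :
  fourier_itv 0 1 (2 * pi * n%:~R : R) = if n == 0 then 1 else 0.
Proof.
have [->|n0] := eqVneq n 0.
  rewrite mulr0 /fourier_itv /cos_itv /sin_itv; congr (Complex _ _).
    under eq_Rintegral do rewrite mulr0 cos0 mulr1.
    by rewrite Rintegral_indic_itv ?subr0.
  under eq_Rintegral do rewrite mulr0 sin0 mulr0.
  by rewrite Rintegral_cst// mul0r oppr0.
have p0 : 2 * pi * n%:~R != 0 :> R.
  by rewrite !mulf_neq0 ?intr_eq0// gt_eqF// pi_gt0.
have [c1 s1] := cos_sin_2piM n.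
rewrite /fourier_itv cos_itvE// sin_itvE// !mul1r !mul0r c1 s1 cos0 sin0 !subrr !mul0r.
by rewrite oppr0.
Qed.

(** These integrals are the transform on R^d of the unit box at the frequency 2 pi k, a product over
    coordinates with a vanishing factor wherever k_i is nonzero. *)
Lemma integral_trig k : \int[nu]_x cosk k x = (k == 0)%:R /\ \int[nu]_x sink k x = 0.
Proof.
have := @transform_box R d (fun=> 0) (fun=> 1) (2 * pi *: map_mx intr k) (fun=> ler01).
rewrite (eq_bigr (fun i => if k 0 i == 0 then 1 else 0)); last first.
  by move=> i _; rewrite !mxE fourier_itv01.
have -> : \prod_(i < d) (if k 0 i == 0 then 1 else 0) = Complex (k == 0)%:R 0 :> R[i].
  have [->|/rV0Pn[i ki]] := eqVneq k 0; first by rewrite big1// => i _; rewrite mxE eqxx.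
  by rewrite (bigD1 i)//= (negbTE ki) mul0r.
move=> [E1 E2]; split.
  rewrite Rintegral_torus; last exact: measurable_cosk.
  by rewrite -E1; apply: eq_Rintegral => x _; rewrite /cosk phaseE.
rewrite Rintegral_torus; last exact: measurable_sink.
move/eqP: E2; rewrite oppr_eq0 => /eqP; apply: etrans.
by apply: eq_Rintegral => x _; rewrite /sink phaseE.
Qed.

(** Product-to-sum formulas reduce to [integral_trig] at k + l and k - l. The frequencies l and -l
    both contribute because they carry the same real functions up to sign. *)
Lemma dot_trig k l :
  [/\ dot (cosk k) (cosk l) = ((k == l)%:R + (k == - l)%:R) / 2,
      dot (sink k) (sink l) = ((k == l)%:R - (k == - l)%:R) / 2 &
      dot (cosk k) (sink l) = 0].
Proof.
have Ic m : nu.-integrable setT (EFin \o cosk m).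
  apply: measurable_bounded_integrable => //; [by rewrite torus_setT ltry|exact: measurable_cosk|].
  by exists 1; split=> // y y1 x _; apply: le_trans (ltW y1); exact: cos_max.
have Is m : nu.-integrable setT (EFin \o sink m).
  apply: measurable_bounded_integrable => //; [by rewrite torus_setT ltry|exact: measurable_sink|].
  by exists 1; split=> // y y1 x _; apply: le_trans (ltW y1); exact: sin_max.
have [c1 s1] := integral_trig (k + l); have [c2 s2] := integral_trig (k - l).
have e1 : k == - l = (k + l == 0) by rewrite addr_eq0.
have e2 : k == l = (k - l == 0) by rewrite subr_eq0.
have cD x : cosk (k + l) x = cosk k x * cosk l x - sink k x * sink l x.
  by rewrite /cosk phaseD cosD.
have cB x : cosk (k - l) x = cosk k x * cosk l x + sink k x * sink l x.
  by rewrite /cosk phaseD phaseN cosB.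
have sD x : sink (k + l) x = sink k x * cosk l x + cosk k x * sink l x.
  by rewrite /sink phaseD sinD.
have sB x : sink (k - l) x = sink k x * cosk l x - cosk k x * sink l x.
  by rewrite /sink phaseD phaseN sinB.
rewrite e1 e2; split.
- have -> : dot (cosk k) (cosk l) =
      \int[nu]_x (2^-1 * (cosk (k - l) x + cosk (k + l) x)).
    by apply: eq_Rintegral => x _; rewrite cB cD; field.
  rewrite RintegralZl//; last exact: (integrableD measurableT (Ic _) (Ic _)).
  by rewrite RintegralD// c1 c2 mulrC.
- have -> : dot (sink k) (sink l) =
      \int[nu]_x (2^-1 * (cosk (k - l) x - cosk (k + l) x)).
    by apply: eq_Rintegral => x _; rewrite cB cD; field.
  rewrite RintegralZl//; last exact: (integrableB measurableT (Ic _) (Ic _)).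
  by rewrite RintegralB// c1 c2 mulrC.
- have -> : dot (cosk k) (sink l) =
      \int[nu]_x (2^-1 * (sink (k + l) x - sink (k - l) x)).
    by apply: eq_Rintegral => x _; rewrite sB sD; field.
  rewrite RintegralZl//; last exact: (integrableB measurableT (Is _) (Is _)).
  by rewrite RintegralB// s1 s2 subrr mulr0.
Qed.

End torus.

(** * Real Fourier series and the Bessel inequality *)

Section fourier_series.
Context (R : realType) (d : nat).
Local Notation V := ('rV[R]_d).
Local Notation Z := ('rV[int]_d).
Local Notation nu := (vol R TT d).
Local Notation sq := (Lfun nu 2%:E).
Local Notation dot := (dot nu).
Local Notation cosk := (@cosk R d).
Local Notation sink := (@sink R d).
Implicit Types (f g h : V -> R) (k l : Z) (s : seq Z) (a b : Z -> R).

(** The real part of the k-th term of the series with coefficients a - i b. Frequencies range over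
    all of Z^d, so k and -k give the same mode when a is even and b odd. *)
Definition mode a b k : V -> R := fun x => a k * cosk k x + b k * sink k x.

Definition energy a b k := a k ^+ 2 + b k ^+ 2.

Let aL a k : (fun x => a k * cosk k x) \in sq.
Proof. by apply: Lfun2Z; exact: cosk_Lfun2. Qed.

Let bL b k : (fun x => b k * sink k x) \in sq.
Proof. by apply: Lfun2Z; exact: sink_Lfun2. Qed.

Lemma mode_Lfun2 a b k : mode a b k \in sq.
Proof. by apply: Lfun2D; [exact: aL|exact: bL]. Qed.

Lemma dot_mode_cos a b k l : dot (mode a b k) (cosk l) = a k * (((k == l)%:R + (k == - l)%:R) / 2).
Proof.
have [cc _ _] := dot_trig R k l; have [_ _ cs] := dot_trig R l k.
rewrite (dotDl (aL a k) (bL b k) (cosk_Lfun2 _ l)) (dotZl _ (cosk_Lfun2 _ k) (cosk_Lfun2 _ l)).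
by rewrite (dotZl _ (sink_Lfun2 _ k) (cosk_Lfun2 _ l)) cc (dotC _ (sink k)) cs mulr0 addr0.
Qed.

Lemma dot_mode_sin a b k l : dot (mode a b k) (sink l) = b k * (((k == l)%:R - (k == - l)%:R) / 2).
Proof.
have [_ ss cs] := dot_trig R k l.
rewrite (dotDl (aL a k) (bL b k) (sink_Lfun2 _ l)) (dotZl _ (cosk_Lfun2 _ k) (sink_Lfun2 _ l)).
by rewrite (dotZl _ (sink_Lfun2 _ k) (sink_Lfun2 _ l)) ss cs mulr0 add0r.
Qed.

Lemma dot_mode_coef g k : g \in sq ->
  dot g (mode (fun k => dot g (cosk k)) (fun k => dot g (sink k)) k) =
  energy (fun k => dot g (cosk k)) (fun k => dot g (sink k)) k.
Proof.
move=> gL; rewrite (dotDr (aL _ k) (bL _ k) gL) (dotZr _ (cosk_Lfun2 _ k) gL).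
by rewrite (dotZr _ (sink_Lfun2 _ k) gL) -!expr2.
Qed.

Section hermitian.
Context (a b : Z -> R).
Context (aN : forall k, a (- k) = a k) (bN : forall k, b (- k) = - b k).

Lemma dot_mode k l :
  dot (mode a b k) (mode a b l) = ((k == l)%:R + (k == - l)%:R) / 2 * energy a b k.
Proof.
rewrite (dotDr (aL a l) (bL b l) (mode_Lfun2 a b k)).
rewrite (dotZr _ (cosk_Lfun2 _ l) (mode_Lfun2 a b k)) dot_mode_cos.
rewrite (dotZr _ (sink_Lfun2 _ l) (mode_Lfun2 a b k)) dot_mode_sin /energy.
have [<-|kl] := eqVneq k l.
  case: eqP => [kk|_]; last by rewrite /= mulr0n mulr1n; field.
  (* When k = -k both Kronecker symbols are 1, and oddness kills the sine coefficient. *)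
  have bk : b k = 0 by have := bN k; rewrite -kk; lra.
  by rewrite bk /= mulr1n; field.
case: eqP => [->|_]; last by rewrite addr0 subr0 !mul0r !mulr0 addr0.
by rewrite aN bN /= mulr0n mulr1n; field.
Qed.

Let sum_indic (s : seq Z) k : uniq s -> \sum_(l <- s) (k == l)%:R = (k \in s)%:R :> R.
Proof.
elim: s => [|l s IH]; first by rewrite big_nil.
rewrite cons_uniq big_cons in_cons => /andP[ls us]; rewrite IH//.
by have [->|] := eqVneq k l; rewrite ?(negbTE ls) ?addr0 ?add0r.
Qed.

Let energy_ge0 k : 0 <= energy a b k.
Proof. by rewrite addr_ge0 ?sqr_ge0. Qed.

(** The energy at k is weighted by 1 if -k lies in s and by 1/2 otherwise, hence an inequality for
    lists that need not be symmetric. *)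
Lemma dot_sum_mode_le s : uniq s ->
  dot (fun x => \sum_(k <- s) mode a b k x) (fun x => \sum_(k <- s) mode a b k x) <=
  \sum_(k <- s) energy a b k.
Proof.
move=> us.
rewrite (dot_suml s (mode_Lfun2 a b) (Lfun2_sum s (mode_Lfun2 a b))).
apply: ler_sum => k _.
rewrite (dot_sumr s (mode_Lfun2 a b) (mode_Lfun2 a b k)).
under eq_bigr do rewrite dot_mode.
rewrite -mulr_suml -mulr_suml big_split/= sum_indic//.
rewrite (eq_bigr (fun l => (- k == l)%:R)); last by move=> l _; rewrite eqr_oppLR.
rewrite sum_indic// ler_piMl// ler_pdivrMr// mul1r.
by rewrite -natrD ler_nat (leq_add (leq_b1 _) (leq_b1 _)).
Qed.

Let sum_pick (c : Z -> R) s l : uniq s -> l \in s -> \sum_(k <- s) c k * (k == l)%:R = c l.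
Proof.
move=> us ls; rewrite (bigD1_seq l)//= eqxx mulr1 big1 ?addr0// => k /negbTE ->.
by rewrite mulr0.
Qed.

Lemma dot_sum_mode_cos s l : uniq s -> l \in s -> - l \in s ->
  dot (fun x => \sum_(k <- s) mode a b k x) (cosk l) = a l.
Proof.
move=> us ls nls; rewrite (dot_suml s (mode_Lfun2 a b) (cosk_Lfun2 _ l)).
under eq_bigr do rewrite dot_mode_cos mulrA mulrDr.
by rewrite -mulr_suml big_split/= !sum_pick// aN; field.
Qed.

Lemma dot_sum_mode_sin s l : uniq s -> l \in s -> - l \in s ->
  dot (fun x => \sum_(k <- s) mode a b k x) (sink l) = b l.
Proof.
move=> us ls nls; rewrite (dot_suml s (mode_Lfun2 a b) (sink_Lfun2 _ l)).
under eq_bigr do rewrite dot_mode_sin mulrA mulrBr.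
by rewrite -mulr_suml sumrB !sum_pick// bN; field.
Qed.

End hermitian.

Lemma coskN k : cosk (- k) = cosk k.
Proof. by apply/funext => x; rewrite /cosk phaseN cosN. Qed.

Lemma dot_sinkN g k : g \in sq -> dot g (sink (- k)) = - dot g (sink k).
Proof.
move=> gL; rewrite -mulN1r -(dotZr _ (sink_Lfun2 _ k) gL); congr dot.
by apply/funext => x; rewrite /sink phaseN sinN mulN1r.
Qed.

(** Let S be the sum of the modes and r that of the energies: <g, S> = r and |S|^2 <= r, so 0 <= |g
    - S|^2 <= |g|^2 - r. *)
Lemma bessel_inequality g s : g \in sq -> uniq s ->
  \sum_(k <- s) energy (fun k => dot g (cosk k)) (fun k => dot g (sink k)) k <= dot g g.
Proof.
move=> gL us.
set a := fun k => dot g (cosk k); set b := fun k => dot g (sink k).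
have aN k : a (- k) = a k by rewrite /a coskN.
have bN k : b (- k) = - b k by exact: dot_sinkN.
have SL := Lfun2_sum s (mode_Lfun2 a b).
have := dot_ge0 nu (fun x => g x - \sum_(k <- s) mode a b k x).
rewrite (dotBB gL SL) (dot_sumr s (mode_Lfun2 a b) gL).
rewrite (eq_bigr (energy a b)); last by move=> k _; exact: dot_mode_coef.
have := dot_sum_mode_le aN bN us.
set p := dot _ _; set q := dot g g; set r := \sum_(k <- s) _; lra.
Qed.

(** Nested finite sets exhausting Z^d, from its countable encoding; [pmap] skips integers that
    encode nothing. *)
Definition first_freqs n : seq Z := pmap (@pickle_inv Z) (iota 0 n).

Lemma first_freqs_uniq n : uniq (first_freqs n).
Proof. by apply: (pmap_uniq (@pickle_invK Z)); exact: iota_uniq. Qed.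

Lemma mem_first_freqs n k : (k \in first_freqs n) = (pickle k < n)%N.
Proof.
rewrite mem_pmap; apply/mapP/idP => [[m mn ki]|kn]; last first.
  by exists (pickle k); rewrite ?mem_iota ?pickleK_inv.
move: mn; rewrite mem_iota add0n => /= mn; have := @pickle_invK Z m.
by rewrite -ki/= => ->.
Qed.

Lemma first_freqsD m n : exists2 s : seq Z, uniq s & first_freqs (m + n) = first_freqs m ++ s.
Proof.
exists (pmap (@pickle_inv Z) (iota m n)).
  by apply: (pmap_uniq (@pickle_invK Z)); exact: iota_uniq.
by rewrite /first_freqs iotaD pmap_cat.
Qed.

End fourier_series.

(** * Functions with prescribed Fourier coefficients *)

Section riesz_fischer.
Context (R : realType) (d : nat).
Local Notation V := ('rV[R]_d).
Local Notation Z := ('rV[int]_d).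
Local Notation nu := (vol R TT d).
Local Notation sq := (Lfun nu 2%:E).
Local Notation dot := (dot nu).
Local Notation cosk := (@cosk R d).
Local Notation sink := (@sink R d).
Implicit Types (f g h : V -> R) (k l : Z) (s : seq Z) (a b : Z -> R).

Lemma phase_delta k x (i : 'I_d) :
  @phase R d TT k (x + delta_mx 0 i) = @phase R d TT k x + 2 * pi * (k 0 i)%:~R.
Proof.
rewrite /phase -mulrDr; congr (_ * _).
rewrite (bigD1 i)//= [in RHS](bigD1 i)//= !mxE !eqxx mulrDl mul1r -!addrA; congr (_ + _).
rewrite addrC; congr (_ + _); apply: eq_bigr => j ji.
by rewrite !mxE (negbTE ji) addr0.
Qed.

Lemma cosk_periodic k : Defs.periodic (cosk k).
Proof.
move=> x i; have [c1 s1] := @cos_sin_2piM R (k 0 i).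
by rewrite /cosk phase_delta cosD c1 s1 mulr1 mulr0 subr0.
Qed.

Lemma sink_periodic k : Defs.periodic (sink k).
Proof.
move=> x i; have [c1 s1] := @cos_sin_2piM R (k 0 i).
by rewrite /sink phase_delta sinD c1 s1 mulr1 mulr0 addr0.
Qed.

Lemma riesz_fischer a b B : (forall k, a (- k) = a k) -> (forall k, b (- k) = - b k) ->
  (forall s, uniq s -> \sum_(k <- s) energy a b k <= B) ->
  exists h, [/\ h \in sq, Defs.periodic h, dot h h <= B &
    forall l, dot h (cosk l) = a l /\ dot h (sink l) = b l].
Proof.
move=> aN bN Bs.
pose u n x := \sum_(k <- @first_freqs d n) mode a b k x.
pose sg n := \sum_(k <- @first_freqs d n) energy a b k.
have uL n : u n \in sq by apply: Lfun2_sum => k; exact: mode_Lfun2.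
(* Increments of the partial sums are bounded by increments of a bounded monotone sequence, which is
   what makes them Cauchy. *)
have uD m n : (m <= n)%N ->
    dot (fun x => u n x - u m x) (fun x => u n x - u m x) <= sg n - sg m.
  move=> /subnKC <-; have [s us E] := first_freqsD d m (n - m).
  rewrite (_ : (fun x => _) = fun x => \sum_(k <- s) mode a b k x); last first.
    by apply/funext => x; rewrite /u E big_cat/= addrAC subrr add0r.
  by rewrite /sg E big_cat/= addrAC subrr add0r; exact: dot_sum_mode_le.
have sg_nd : nondecreasing_seq sg.
  by move=> m n /uD H; rewrite -subr_ge0; apply: le_trans H; exact: dot_ge0.
have sg_ub : has_ubound (range sg).
  by exists B => _ [n _ <-]; apply: Bs; exact: first_freqs_uniq.
have sg_cvg := nondecreasing_is_cvgn sg_nd sg_ub.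
have uc : cauchy2 nu u.
  move=> e e0; have /cvgrPdist_le/(_ _ e0)[N _ NP] := sg_cvg.
  suff H m n : (N <= m)%N -> (m <= n)%N ->
      dot (fun x => u n x - u m x) (fun x => u n x - u m x) <= e.
    exists N => m n Nm Nn; have [mn|/ltnW nm] := leqP m n; last exact: H.
    by rewrite dotBBC; exact: H.
  move=> Nm mn; apply: le_trans (uD _ _ mn) _.
  have := NP m Nm; have := nondecreasing_cvgn_le sg_nd sg_cvg n.
  by rewrite ler_distl => /= *; lra.
have [Phi [hL uh]] := L2_complete uL uc.
exists (fun x => Phi (u ^~ x)); split=> //.
(* The limit is periodic everywhere since [Phi] reads only the values of the partial sums at x. *)
- move=> x i; congr Phi; apply/funext => n; apply: eq_bigr => k _.
  by rewrite /mode cosk_periodic sink_periodic.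
- apply: (ler_cvg_to (cvg2_dot uL uL hL hL uh uh) (@cvg_cst _ B _ _ _)).
  near=> n; apply: le_trans (Bs _ (first_freqs_uniq d n)).
  exact: (dot_sum_mode_le aN bN (first_freqs_uniq d n)).
- have near_in l : \forall n \near \oo, l \in @first_freqs d n.
    by exists (pickle l).+1 => // n /= ln; rewrite mem_first_freqs.
  move=> l; split.
    have cL (n : nat) := cosk_Lfun2 R l.
    have L1 := cvg2_dot uL cL hL (cosk_Lfun2 R l) uh (cvg2_cst nu (cosk l)).
    suff L2 : (fun n => dot (u n) (cosk l)) @ \oo --> a l by exact: (cvg_unique _ L1 L2).
    apply: cvg_near_cst; near=> n.
    apply: (@dot_sum_mode_cos _ _ a b aN); first exact: first_freqs_uniq.
      by near: n; exact: near_in.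
    by near: n; exact: near_in.
  have sL (n : nat) := sink_Lfun2 R l.
  have L1 := cvg2_dot uL sL hL (sink_Lfun2 R l) uh (cvg2_cst nu (sink l)).
  suff L2 : (fun n => dot (u n) (sink l)) @ \oo --> b l by exact: (cvg_unique _ L1 L2).
    apply: cvg_near_cst; near=> n.
  apply: (@dot_sum_mode_sin _ _ a b bN); first exact: first_freqs_uniq.
    by near: n; exact: near_in.
  by near: n; exact: near_in.
Unshelve. all: by end_near. Qed.

End riesz_fischer.

(** * Approximation of indicators by trigonometric polynomials *)

Section step_approximation.
Context (R : realType).
Implicit Types (t u y z : R) (n : nat).

Lemma bernoulli_1D u n : 0 <= u -> 1 + n%:R * u <= (1 + u) ^+ n.
Proof.
move=> u0; elim: n => [|n IH]; first by rewrite mul0r addr0 expr0.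
rewrite exprS; apply: (@le_trans _ _ ((1 + u) * (1 + n%:R * u))).
  rewrite -natr1; have : 0 <= n%:R * (u * u) by rewrite !mulr_ge0.
  by set N := n%:R; lra.
by rewrite ler_wpM2l// addr_ge0.
Qed.

Lemma bernoulli_1B u n : 0 <= u <= 1 -> 1 - n%:R * u <= (1 - u) ^+ n.
Proof.
move=> /andP[u0 u1]; elim: n => [|n IH]; first by rewrite mul0r subr0 expr0.
rewrite exprS; apply: (@le_trans _ _ ((1 - u) * (1 - n%:R * u))).
  rewrite -natr1; have : 0 <= n%:R * (u * u) by rewrite !mulr_ge0.
  by set N := n%:R; lra.
by rewrite ler_wpM2l// subr_ge0.
Qed.

Lemma cvg_n_expr z : 0 <= z < 1 -> (fun n => n%:R * z ^+ n) @ \oo --> (0 : R).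
Proof.
move=> /andP[z0 z1].
(* [z <= v ^+ 2] with [v < 1] and [n v ^+ n] bounded *)
pose v := (1 + z) / 2; have v0 : 0 < v by rewrite /v; lra.
have v1 : v < 1 by rewrite /v; lra.
have zv : z <= v * v.
  have : 0 <= (1 - z) ^+ 2 by exact: sqr_ge0.
  by rewrite /v expr2; lra.
pose h := v^-1 - 1; have h0 : 0 < h by rewrite subr_gt0 invf_gt1.
have nv n : n%:R * v ^+ n <= h^-1.
  have : v ^+ n * (1 + n%:R * h) <= 1.
    apply: (@le_trans _ _ (v ^+ n * (1 + h) ^+ n)).
      by rewrite ler_wpM2l ?exprn_ge0 ?(ltW v0)// bernoulli_1D// ltW.
    by rewrite -exprMn /h addrC subrK mulfV ?expr1n// gt_eqF.
  rewrite mulrDr mulr1 => H.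
  rewrite -[leRHS]mul1r ler_pdivlMr// mulrAC mulrC; apply: le_trans H.
  by rewrite lerDr exprn_ge0// ltW.
have V : (fun n => v ^+ n) @ \oo --> (0 : R) by apply: cvg_expr; rewrite gtr0_norm.
have {}V : (fun n => h^-1 * v ^+ n) @ \oo --> (0 : R) by rewrite -(mulr0 h^-1); exact: cvgMr.
apply: (cvg0_le _ V) => n.
rewrite ger0_norm ?mulr_ge0 ?exprn_ge0//.
apply: (@le_trans _ _ (n%:R * (v * v) ^+ n)).
  by rewrite ler_wpM2l// lerXn2r// nnegrE// mulr_ge0// ltW.
by rewrite exprMn mulrA ler_wpM2r// exprn_ge0// ltW.
Qed.

(* Polynomials in [y] converging on [0, 1] to the indicator of [y < 1 / 2]. *)
Definition half_step n y : R := (1 - y ^+ n) ^+ (n * 2 ^ n).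

Lemma half_step_itv n y : 0 <= y <= 1 -> 0 <= half_step n y <= 1.
Proof.
move=> /andP[y0 y1]; have yn0 := exprn_ge0 n y0.
have yn1 : y ^+ n <= 1 by rewrite exprn_ile1.
by rewrite /half_step exprn_ge0 ?subr_ge0//= exprn_ile1 ?subr_ge0// gerBl.
Qed.

(** The exponent times y^n is n (2 y)^n: it tends to 0 for y < 1/2 and is at least n for y >= 1/2.
    Bernoulli's inequalities turn the two cases into the limits 1 and 0. *)
Lemma cvg_half_step y : 0 <= y <= 1 ->
  (fun n => half_step n y) @ \oo --> ((y < 1 / 2)%R%:R : R).
Proof.
move=> y01; have /andP[y0 y1] := y01.
have E n : (n * 2 ^ n)%:R * y ^+ n = n%:R * (2 * y) ^+ n by rewrite natrM natrX -mulrA -exprMn.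
case: ltP => yh.
  have V : (fun n => n%:R * (2 * y) ^+ n) @ \oo --> (0 : R).
    by apply: cvg_n_expr; rewrite mulr_ge0//=; lra.
  apply/subr_cvg0.
  apply: (cvg0_le _ V) => n /=.
  have /andP[h0 h1] := half_step_itv n y01.
  rewrite ler0_norm ?subr_le0// opprB -E lerBlDr addrC -lerBlDr.
  by apply: bernoulli_1B; rewrite exprn_ge0//= exprn_ile1.
have V : (fun n : nat => n.+1%:R^-1 : R) @ \oo --> (0 : R) by exact: cvg_harmonic.
apply: (cvg0_le _ V) => n; have /andP[h0 h1] := half_step_itv n y01.
rewrite ger0_norm// -[leRHS]mul1r ler_pdivlMr//.
(* The new factor is at least n + 1, and its product with [half_step] is a power of 1 - y^(2n),
   hence at most 1. *)
apply: (@le_trans _ _ (half_step n y * (1 + y ^+ n) ^+ (n * 2 ^ n))).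
  rewrite ler_wpM2l//; apply: le_trans (bernoulli_1D _ (exprn_ge0 n y0)).
  rewrite E -natr1 addrC lerD2l ler_peMr// exprn_ege1//; lra.
rewrite /half_step -exprMn exprn_ile1//.
  by apply: mulr_ge0; [rewrite subr_ge0 exprn_ile1|rewrite addr_ge0 ?exprn_ge0].
have := sqr_ge0 (y ^+ n); rewrite expr2; set w := y ^+ n; lra.
Qed.

End step_approximation.

Section torus_step.
Context (R : realType).
Implicit Types (t x : R) (n : nat).

(* The arc (t, 1) has midpoint (1 + t) / 2 and half-width (1 - t) / 2, so that it is cut out by
   [arc_level t x < 1 / 2]. *)
Definition arc_level t x : R :=
  (cos (pi * (1 - t)) - cos (2 * pi * (x - (1 + t) / 2))) / 4 + 1 / 2.

Lemma arc_level_itv t x : 0 <= arc_level t x <= 1.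
Proof.
rewrite /arc_level; set a := cos _; set b := cos _.
have : `|a| <= 1 by exact: cos_max.
have : `|b| <= 1 by exact: cos_max.
by rewrite !ler_norml; lra.
Qed.

Lemma arc_levelE t x : 0 <= t < 1 -> 0 <= x < 1 -> (arc_level t x < 1 / 2) = (t < x).
Proof.
move=> /andP[t0 t1] /andP[x0 x1].
have -> : (arc_level t x < 1 / 2) = (cos (pi * (1 - t)) < cos (2 * pi * (x - (1 + t) / 2))).
  by rewrite /arc_level; set a := cos _; set b := cos _; apply/idP/idP; lra.
have p0 := @pi_gt0 R.
have in_pi (r : R) : 0 <= r <= 1 -> pi * r \in `[0, pi].
  move=> /andP[r0 r1]; rewrite in_itv/= mulr_ge0 ?(ltW p0)//=.
  by rewrite -[leRHS]mulr1 ler_pM2l.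
have th : pi * (1 - t) \in `[0, pi] by apply: in_pi; lra.
(* For 2 x < t the angle lies below -pi and is shifted by one period; otherwise its absolute value
   is in [0, pi]. In both cases cos is decreasing on the range reached. *)
have [xt|tx] := ltP (2 * x) t.
  have -> : cos (2 * pi * (x - (1 + t) / 2)) = cos (pi * (2 * x + 1 - t)).
    by rewrite -cosD2pi; congr cos; rewrite -mulr_natl; field.
  rewrite ltr_cos//; last by apply: in_pi; lra.
  by rewrite ltr_pM2l//; apply/idP/idP; lra.
have -> : cos (2 * pi * (x - (1 + t) / 2)) = cos (pi * `|2 * x - 1 - t|).
  have [h|h] := ger0P (2 * x - 1 - t); first by congr cos; field.
  by rewrite -cosN; congr cos; field.
rewrite ltr_cos//; last by apply: in_pi; rewrite normr_ge0/= ler_norml; lra.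
by rewrite ltr_pM2l// ltr_norml; apply/idP/idP; lra.
Qed.

(** For t outside [0, 1) the indicator of t < x is constant on the fundamental domain, so constants
    serve there. *)
Definition torus_step t n x : R :=
  if t < 0 then 1 else if 1 <= t then 0 else half_step n (arc_level t x).

Lemma torus_step_itv t n x : 0 <= torus_step t n x <= 1.
Proof.
rewrite /torus_step; case: ifP => _; first by rewrite ler01 lexx.
by case: ifP => _; [rewrite lexx ler01|apply: half_step_itv; exact: arc_level_itv].
Qed.

Lemma cvg_torus_step t x : 0 <= x < 1 ->
  torus_step t n x @[n --> \oo] --> ((t < x)%R%:R : R).
Proof.
move=> x01; have /andP[x0 x1] := x01; rewrite /torus_step; case: (ltP t 0) => t0.
  by rewrite (lt_le_trans t0 x0); exact: cvg_cst.
case: (leP 1 t) => t1.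
  by rewrite ltNge (ltW (lt_le_trans x1 t1)); exact: cvg_cst.
rewrite -arc_levelE ?t0//; apply: cvg_half_step; exact: arc_level_itv.
Qed.

End torus_step.

Section trigonometric_polynomials.
Context (R : realType) (d : nat).
Local Notation V := ('rV[R]_d).
Local Notation Z := ('rV[int]_d).
Local Notation nu := (vol R TT d).
Local Notation sq := (Lfun nu 2%:E).
Local Notation dot := (dot nu).
Local Notation cosk := (@cosk R d).
Local Notation sink := (@sink R d).
Implicit Types (f g h : V -> R) (k l : Z).

Inductive trigpoly : (V -> R) -> Prop :=
| trigpoly_cos k : trigpoly (cosk k)
| trigpoly_sin k : trigpoly (sink k)
| trigpolyD f g : trigpoly f -> trigpoly g -> trigpoly (fun x => f x + g x)
| trigpolyZ c f : trigpoly f -> trigpoly (fun x => c * f x).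

Lemma trigpolyM f g : trigpoly f -> trigpoly g -> trigpoly (fun x => f x * g x).
Proof.
move=> tf tg.
have D (f1 f2 g' : V -> R) : trigpoly (fun x => f1 x * g' x) ->
    trigpoly (fun x => f2 x * g' x) -> trigpoly (fun x => (f1 x + f2 x) * g' x).
  by move=> h1 h2; under eq_fun do rewrite mulrDl; exact: trigpolyD.
have Zl c (f1 g' : V -> R) : trigpoly (fun x => f1 x * g' x) ->
    trigpoly (fun x => (c * f1 x) * g' x).
  by move=> h1; under eq_fun do rewrite -mulrA; exact: trigpolyZ.
have C (f1 g1 : V -> R) : trigpoly (fun x => f1 x * g1 x) -> trigpoly (fun x => g1 x * f1 x).
  by under eq_fun do rewrite mulrC.
have cc k l : trigpoly (fun x => cosk k x * cosk l x).
  rewrite (_ : (fun x => _) = fun x => 2^-1 * cosk (k + l) x + 2^-1 * cosk (k + - l) x).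
    by apply: trigpolyD; apply: trigpolyZ; exact: trigpoly_cos.
  by apply/funext => x; rewrite /cosk !phaseD phaseN cosD cosB; field.
have ss k l : trigpoly (fun x => sink k x * sink l x).
  rewrite (_ : (fun x => _) = fun x => - 2^-1 * cosk (k + l) x + 2^-1 * cosk (k + - l) x).
    by apply: trigpolyD; apply: trigpolyZ; exact: trigpoly_cos.
  by apply/funext => x; rewrite /cosk /sink !phaseD phaseN cosD cosB; field.
have sc k l : trigpoly (fun x => sink k x * cosk l x).
  rewrite (_ : (fun x => _) = fun x => 2^-1 * sink (k + l) x + 2^-1 * sink (k + - l) x).
    by apply: trigpolyD; apply: trigpolyZ; exact: trigpoly_sin.
  by apply/funext => x; rewrite /cosk /sink !phaseD phaseN sinD sinB; field.
(* By linearity in the first factor, only products of single modes with h have to be treated. *)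
have E h : (forall l, trigpoly (fun x => cosk l x * h x)) ->
    (forall l, trigpoly (fun x => sink l x * h x)) -> trigpoly (fun x => f x * h x).
  move=> kc ks; elim: tf => [//|//|f1 f2 _ IH1 _ IH2|c f1 _ IH1]; [exact: D|exact: Zl].
elim: tg => [k|k|g1 g2 _ IH1 _ IH2|c g1 _ IH1].
- exact: E.
- by apply: E => // l; exact: C.
- exact: (C _ _ (D _ _ _ (C _ _ IH1) (C _ _ IH2))).
- exact: (C _ _ (Zl c _ _ (C _ _ IH1))).
Qed.

Lemma trigpoly_cst (c : R) : trigpoly (fun=> c).
Proof.
rewrite (_ : (fun=> c) = fun x => c * cosk 0 x); first by apply: trigpolyZ; exact: trigpoly_cos.
by apply/funext => x; rewrite /cosk phase0 cos0 mulr1.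
Qed.

Lemma trigpolyB f g : trigpoly f -> trigpoly g -> trigpoly (fun x => f x - g x).
Proof.
move=> tf tg; rewrite (_ : (fun x => _) = fun x => f x + -1 * g x).
  by apply: trigpolyD => //; exact: trigpolyZ.
by apply/funext => x; rewrite mulN1r.
Qed.

Lemma trigpolyX f n : trigpoly f -> trigpoly (fun x => f x ^+ n).
Proof.
move=> tf; elim: n => [|n IH]; first exact: (trigpoly_cst 1).
by under eq_fun do rewrite exprS; exact: trigpolyM.
Qed.

Lemma trigpoly_prod I (s : seq I) (F : I -> V -> R) : (forall i, trigpoly (F i)) ->
  trigpoly (fun x => \prod_(i <- s) F i x).
Proof.
move=> tF; elim: s => [|i s IH].
  by under eq_fun do rewrite big_nil; exact: trigpoly_cst.
by under eq_fun do rewrite big_cons; exact: trigpolyM.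
Qed.

Lemma trigpoly_Lfun2 f : trigpoly f -> f \in sq.
Proof.
elim=> [k|k|f1 f2 _ IH1 _ IH2|c f1 _ IH].
- exact: cosk_Lfun2.
- exact: sink_Lfun2.
- exact: Lfun2D.
- exact: Lfun2Z.
Qed.

Lemma trigpoly_orth g f : g \in sq -> (forall k, dot g (cosk k) = 0) ->
  (forall k, dot g (sink k) = 0) -> trigpoly f -> dot g f = 0.
Proof.
move=> gL gc gs; elim=> [k|k|f1 f2 t1 IH1 t2 IH2|c f1 t1 IH] //.
  by rewrite (dotDr (trigpoly_Lfun2 t1) (trigpoly_Lfun2 t2) gL) IH1 IH2 addr0.
by rewrite (dotZr c (trigpoly_Lfun2 t1) gL) IH mulr0.
Qed.

Lemma trigpoly_torus_step t n (i : 'I_d) : trigpoly (fun x => torus_step t n (x 0 i)).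
Proof.
rewrite /torus_step; case: (t < 0); first exact: (trigpoly_cst 1).
case: (1 <= t); first exact: (trigpoly_cst 0).
have tl : trigpoly (fun x => arc_level t (x 0 i)).
  pose a := 2 * pi * ((1 + t) / 2) : R.
  rewrite (_ : (fun x => _) = fun x => (cos (pi * (1 - t)) / 4 + 1 / 2) -
      (cos a / 4 * cosk (delta_mx 0 i) x + sin a / 4 * sink (delta_mx 0 i) x)).
    apply: trigpolyB; first exact: trigpoly_cst.
    by apply: trigpolyD; apply: trigpolyZ; [exact: trigpoly_cos|exact: trigpoly_sin].
  apply/funext => x; rewrite /arc_level [2 * pi * (_ - _)]mulrBr -/a.
  have -> : 2 * pi * x 0 i = @phase R d TT (delta_mx 0 i) x.
    rewrite /phase (bigD1 i)//= !mxE !eqxx mulr1 big1 ?addr0// => j ji.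
    by rewrite !mxE (negbTE ji) andbF mulr0.
  rewrite [cos (_ - a)]cosB -/(cosk _ _) -/(sink _ _).
  by set c1 := cosk _ _; set s1 := sink _ _; field.
apply: trigpolyX; apply: trigpolyB; first exact: (trigpoly_cst 1).
exact: trigpolyX.
Qed.

End trigonometric_polynomials.

Section fourier_series_unique.
Context (R : realType) (d : nat).
Local Notation V := ('rV[R]_d).
Local Notation nu := (vol R TT d).
Local Notation sq := (Lfun nu 2%:E).
Local Notation dot := (dot nu).
Local Notation cosk := (@cosk R d).
Local Notation sink := (@sink R d).
Implicit Types (f g h : V -> R).

Lemma torus_Lfun2_integrable g : g \in sq -> nu.-integrable setT (EFin \o g).
Proof.
move=> gL.
have oL : (fun=> 1) \in sq by apply: (@bounded_Lfun2 R d _ 1) => // x; rewrite normr1.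
have := dot_integrable gL oL.
by rewrite (_ : (fun x => g x * 1) = g)//; apply/funext => x; rewrite mulr1.
Qed.

Lemma torus_ae : \forall x \ae nu, @unit_cube R d x.
Proof.
have mc := @measurable_unit_cube R d.
exists (~` @unit_cube R d); split=> //; first exact: measurableC.
by change (lebesgue_rV R d (~` @unit_cube R d `&` @unit_cube R d) = 0%E); rewrite setICl measure0.
Qed.

Let box_approx (a b : 'I_d -> R) n (x : V) : R :=
  \prod_(i < d) (torus_step (a i) n (x 0 i) - torus_step (b i) n (x 0 i)).

Let trigpoly_box_approx a b n : trigpoly (box_approx a b n).
Proof. by apply: trigpoly_prod => i; apply: trigpolyB; exact: trigpoly_torus_step. Qed.

Let norm_box_approx a b n x : `|box_approx a b n x| <= 1.
Proof.
rewrite normr_prod; apply: prodr_ile1 => i _; rewrite normr_ge0/= ler_norml.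
have := torus_step_itv (a i) n (x 0 i); have := torus_step_itv (b i) n (x 0 i).
by move: (torus_step _ _ _) (torus_step _ _ _) => r1 r2; lra.
Qed.

Let cvg_box_approx (a b : 'I_d -> R) (x : V) : (forall i, a i <= b i) -> @unit_cube R d x ->
  box_approx a b n x @[n --> \oo] --> (\1_(box a b) x : R).
Proof.
move=> ab xc; rewrite indic_box.
(* As a <= b, the indicator of ]a, b] is a difference of two steps. *)
rewrite (eq_bigr (fun i => (a i < x 0 i)%R%:R - (b i < x 0 i)%R%:R)); last first.
  move=> i _; rewrite indicE; case: (ltP (b i) (x 0 i)) => bx.
    rewrite (le_lt_trans (ab i) bx) subrr memNset//= in_itv/= => /andP[_].
    by rewrite leNgt bx.
  rewrite [RHS]subr0; case: (ltP (a i) (x 0 i)) => ax.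
    by rewrite mem_set//= in_itv/= ax bx.
  by rewrite memNset//= in_itv/= ltNge ax.
apply: cvg_big; first exact: mul_continuous.
move=> i _; have := xc i; rewrite /= in_itv/= => xi.
by apply: cvgB; exact: cvg_torus_step.
Qed.

(** The functions orthogonal to g include trigonometric polynomials, hence boxes by bounded
    approximation, hence all of [L12] by the monotone class argument. Finally g itself is such a
    function. *)
Lemma torus_fourier_inj g : g \in sq -> (forall k, dot g (cosk k) = 0) ->
  (forall k, dot g (sink k) = 0) -> g = (fun=> 0) %[ae nu].
Proof.
move=> gL gc gs; apply: dot0_ae => //.
have Ig := torus_Lfun2_integrable gL; have mg := Lfun2_measurable gL.
apply: (@L12_ind _ _ _ nu (@boxes R d) _ _ _ _ (@cube R d) _ _ _ (fun f => dot g f = 0)).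
- exact: boxes_setI.
- exact: measurable_boxes.
- move=> A bA; apply: (@le_lt_trans _ _ (nu setT)); last by rewrite torus_setT ltry.
  by apply: le_measure => //; rewrite inE//; exact: measurable_boxes.
- exact: boxes_generate.
- exact: boxes_cube.
- exact: nondecreasing_cube.
- exact: bigcup_cube.
- move=> A [a [b [ab ->]]].
  have mB : measurable_fun setT (\1_(box a b) : V -> R).
    by apply: measurable_indic; apply: (@measurable_boxes R d); exists a, b.
  have tP n : box_approx a b n \in sq := trigpoly_Lfun2 (trigpoly_box_approx a b n).
  have mgP n : measurable_fun setT (fun x => (g x * box_approx a b n x)%:E).
    by apply/measurable_EFinP; apply: measurable_funM => //; exact: Lfun2_measurable (tP n).
  have mgB : measurable_fun setT (fun x => (g x * \1_(box a b) x)%:E).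
    by apply/measurable_EFinP; exact: measurable_funM.
  (* The approximants converge on the unit cube, which carries the whole measure. *)
  have cvgP : \forall x \ae nu, setT x ->
      (fun n => (g x * box_approx a b n x)%:E) @ \oo --> (g x * \1_(box a b) x)%:E.
    apply: filterS torus_ae => x xc _; apply: cvg_EFin; first by near=> n.
    by apply: cvgMr; exact: cvg_box_approx.
  have leP : \forall x \ae nu, forall n, setT x ->
      (`|(g x * box_approx a b n x)%:E| <= `|(g x)%:E|)%E.
    by apply: aeW => x n _; rewrite lee_fin normrM ler_piMr.
  have [_ _ K] := dominated_convergence measurableT mgP mgB cvgP (integrable_abse Ig) leP.
  have E n : (\int[nu]_x (g x * box_approx a b n x)%:E = 0)%E.
    rewrite -[RHS]/(0%:E) -(trigpoly_orth gL gc gs (trigpoly_box_approx a b n)) fineK//.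
    by apply: integrable_fin_num => //; exact: (dot_integrable gL (tP n)).
  have {}K : (fun _ : nat => 0%E) @ \oo --> (\int[nu]_x (g x * \1_(box a b) x)%:E)%E.
    rewrite (_ : (fun _ => _) = fun n => (\int[nu]_x (g x * box_approx a b n x)%:E)%E).
      exact: K.
    by apply/funext => n; rewrite E.
  have I0 : (\int[nu]_x (g x * \1_(box a b) x)%:E = 0)%E.
    have K0 : (fun _ : nat => 0%E : \bar R) @ \oo --> (0%E : \bar R) by exact: cvg_cst.
    exact: (cvg_unique _ K K0).
  exact: (congr1 fine I0).
- by move=> f h [_ fL] [_ hL] f0 h0; rewrite (dotDr fL hL gL) f0 h0 addr0.
- by move=> c f [_ fL] f0; rewrite (dotZr c fL gL) f0 mulr0.
- move=> u f uL u0 [_ fL] [_ uf].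
  have L1 := cvg2_dot (fun=> gL) (fun n => (uL n).2) gL fL (cvg2_cst nu g) uf.
  rewrite (_ : (fun n => _) = fun=> 0) in L1; last by apply/funext => n; exact: u0.
  have L0 : (fun _ : nat => 0 : R) @ \oo --> (0 : R) by exact: cvg_cst.
  exact: (cvg_unique _ L1 L0).
- by split=> //; exact: torus_Lfun2_integrable.
Unshelve. all: by end_near. Qed.

End fourier_series_unique.

(** * Multipliers on T^d and on K^d *)

Section multiplier_TT.
Context (R : realType) (d : nat).
Local Notation V := ('rV[R]_d).
Local Notation Z := ('rV[int]_d).
Local Notation nu := (vol R TT d).
Local Notation sq := (Lfun nu 2%:E).
Local Notation dot := (dot nu).
Local Notation cosk := (@cosk R d).
Local Notation sink := (@sink R d).
Implicit Types (f g h : V -> R) (F p q : Z -> R[i]).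

Lemma fourier_integral_TT f k :
  @fourier_integral R d TT f k = Complex (dot f (cosk k)) (- dot f (sink k)).
Proof. by []. Qed.

Lemma is_fourier_TTP f F : is_fourier (K := TT) f F <->
  forall k, dot f (cosk k) = complex.Re (F k) /\ dot f (sink k) = - complex.Im (F k).
Proof.
split=> [-> k|H]; first by rewrite fourier_integral_TT/= opprK.
apply/funext => k; rewrite fourier_integral_TT.
by have [-> ->] := H k; rewrite opprK; case: (F k).
Qed.

(** The Bessel inequality for g bounds the energies of p F by c^2 |g|^2, and Riesz-Fischer realizes
    these coefficients with the same bound on the norm. *)
Lemma multiplier_TT f g F p q (c : R) : (forall k, p (- k) = conjc (p k)) ->
  f \in sq -> g \in sq -> is_fourier (K := TT) f F ->
  is_fourier (K := TT) g (fun k => q k * F k) ->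
  0 <= c -> (forall k, Normc.normc (p k) <= c * Normc.normc (q k)) ->
  exists h, [/\ h \in sq, Defs.periodic h, is_fourier (K := TT) h (fun k => p k * F k) &
    dot h h <= c ^+ 2 * dot g g].
Proof.
move=> ps fL gL /is_fourier_TTP fF /is_fourier_TTP gF c0 pq.
have FN k : F (- k) = conjc (F k).
  have [c1 s1] := fF (- k); have [c2 s2] := fF k.
  move: c1 s1; rewrite coskN dot_sinkN// c2 s2 opprK.
  by case: (F (- k)) => a b; case: (F k) => a' b' /= -> ->; rewrite opprK.
pose a k := complex.Re (p k * F k); pose b k := - complex.Im (p k * F k).
have pFN k : p (- k) * F (- k) = conjc (p k * F k) by rewrite ps FN rmorphM.
have [|||h [hL hp hle hE]] := @riesz_fischer R d a b (c ^+ 2 * dot g g).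
- by move=> k; rewrite /a pFN; case: (_ * _).
- by move=> k; rewrite /b pFN; case: (_ * _).
- move=> s us; apply: le_trans (ler_wpM2l (sqr_ge0 c) (bessel_inequality gL us)).
  rewrite mulr_sumr; apply: ler_sum => k _.
  have [cg sg] := gF k; rewrite /energy cg sg /a /b.
  have normE (z : R[i]) : complex.Re z ^+ 2 + (- complex.Im z) ^+ 2 = Normc.normc z ^+ 2.
    by case: z => x y /=; rewrite sqr_sqrtr ?addr_ge0 ?sqr_ge0// sqrrN.
  have norm0 (z : R[i]) : 0 <= Normc.normc z by case: z => x y /=; exact: sqrtr_ge0.
  rewrite !normE !Normc.normcM -exprMn lerXn2r// ?nnegrE ?mulr_ge0//.
  by rewrite mulrA ler_wpM2r.
exists h; split=> //; apply/is_fourier_TTP => k; have [-> ->] := hE k.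
by rewrite /a /b.
Qed.

Lemma is_fourier_TTZ c f F : f \in sq -> is_fourier (K := TT) f F ->
  is_fourier (K := TT) (fun x => c * f x) (fun k => Complex c 0 * F k).
Proof.
move=> fL /is_fourier_TTP fF; apply/is_fourier_TTP => k.
have [c1 s1] := fF k; rewrite (dotZl c fL (cosk_Lfun2 _ k)) (dotZl c fL (sink_Lfun2 _ k)) c1 s1.
by case: (F k) => x y /=; rewrite !mul0r subr0 addr0 mulrN.
Qed.

Lemma is_fourier_TT_inj f g F : f \in sq -> g \in sq ->
  is_fourier (K := TT) f F -> is_fourier (K := TT) g F -> f = g %[ae nu].
Proof.
move=> fL gL /is_fourier_TTP fF /is_fourier_TTP gF.
have := @torus_fourier_inj R d _ (Lfun2B fL gL).
case=> [k|k|N [mN N0 Nfg]].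
- by rewrite (dotBl fL gL (cosk_Lfun2 _ k)) (fF k).1 (gF k).1 subrr.
- by rewrite (dotBl fL gL (sink_Lfun2 _ k)) (fF k).2 (gF k).2 subrr.
exists N; split=> //; apply: subset_trans Nfg => x /=; apply: contra_not => H xT.
by apply/eqP; rewrite -subr_eq0; apply/eqP; exact: H.
Qed.

End multiplier_TT.

Section multiplier.
Context (R : realType) (K : base_space) (d : nat).
Local Notation V := ('rV[R]_d).
Local Notation W := (freq R d K).
Local Notation dot := (dot (vol R K d)).
Implicit Types (f g h : V -> R) (F p q : W -> R[i]).

(** On the discrete group Z^d every symbol is admissible. *)
Definition symbol_measurable : (W -> R[i]) -> Prop :=
  match K return (freq R d K -> R[i]) -> Prop with
  | RR => fun p : V -> R[i] => cmeasurable p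
  | TT => fun=> True
  end.

Definition hermitian p := symbol_measurable p /\ forall xi, p (- xi) = conjc (p xi).

Definition transform F f := L2 K f /\ is_fourier f F.

End multiplier.

Section multiplier_theory.
Context (R : realType) (d : nat).
Local Notation V := ('rV[R]_d).
Implicit Types (f g h : V -> R) (c : R).

Lemma transformZ K c f (F : freq R d K -> R[i]) : transform F f ->
  transform (fun xi => Complex c 0 * F xi) (fun x => c * f x).
Proof.
case: K F => F [[fL fp] fF]; split; first (split=> //; exact: Lfun2Z).
- exact: is_fourier_RRZ.
- by split=> [|_ x i]; [exact: Lfun2Z|rewrite fp].
- exact: is_fourier_TTZ.
Qed.

Lemma transform_inj K f g (F : freq R d K -> R[i]) : transform F f -> transform F g ->
  f = g %[ae vol R K d].
Proof.
case: K F => F [[fL _] fF] [[gL _] gF]; first exact: is_fourier_RR_inj fF gF.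
exact: is_fourier_TT_inj fF gF.
Qed.

Lemma transform_mul K f g (F p q : freq R d K -> R[i]) c :
  hermitian p -> transform F f -> transform (fun xi => q xi * F xi) g ->
  0 <= c -> (forall xi, Normc.normc (p xi) <= c * Normc.normc (q xi)) ->
  exists2 h, transform (fun xi => p xi * F xi) h &
    dot (vol R K d) h h <= c ^+ 2 * dot (vol R K d) g g.
Proof.
case: K F p q => F p q [mp ps] [[fL _] fF] [[gL _] gF] c0 pq.
  have [h [hL hF hN]] := multiplier_RR mp ps fL gL fF gF c0 pq.
  by exists h => //; split=> //; split.
have [h [hL hp hF hN]] := multiplier_TT ps fL gL fF gF c0 pq.
by exists h => //; split=> //; split.
Qed.

Lemma transform_unique K f h (F F' p : freq R d K -> R[i]) : hermitian p ->
  transform F f -> transform F' f -> transform (fun xi => p xi * F' xi) h ->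
  transform (fun xi => p xi * F xi) h.
Proof.
case: K F F' p => F F' p [mp _] [[fL fp] fF] [_ fF'] [[hL hp] hF].
  split; first by split.
  exact: multiplier_RR_unique fF fF' hF.
split; first by split.
by move: hF; rewrite [F]fF [F']fF'.
Qed.

(** The witness h ensures that [OP p f] is a genuine image instead of the default value; uniqueness
    then expresses it with the given F. *)
Lemma transform_OP K f h (F p : freq R d K -> R[i]) : hermitian p ->
  transform F f -> transform (fun xi => p xi * F xi) h ->
  transform (fun xi => p xi * F xi) (OP p f).
Proof.
move=> hp fF hF.
have : is_multiplier p f (OP p f).
  rewrite /OP; apply: xgetPex; exists h; split; [exact: fF.1|exact: hF.1|].
  by exists F; split; [exact: fF.2|exact: hF.2].
move=> [_ OL [F' [fF' OF']]].
apply: (transform_unique hp fF (F' := F')); first by split=> //; exact: fF.1.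
by split.
Qed.

End multiplier_theory.

(** * Symbol seminorms compared with Bessel symbols *)

Section symbol_bounds.
Context (R : realType) (d : nat).
Local Notation V := ('rV[R]_d).
Implicit Types (r s : R).

Lemma symbol_diff0 K (p : freq R d K -> R[i]) : symbol_diff (fun=> 0%N) p = p.
Proof.
case: K p => p; apply/funext => xi /=.
  rewrite /partial; have -> : flatten [seq nseq 0 i | i <- enum 'I_d] = [::].
    by elim: (enum 'I_d).
  by rewrite /=; case: (p xi).
have m0 : mabs (fun _ : 'I_d => 0%N) = 0%N by rewrite /mabs big1.
have v0 (g : {ffun 'I_d -> 'I_(mabs (fun _ : 'I_d => 0%N)).+1}) i : g i = 0%N :> nat.
  by have := ltn_ord (g i); rewrite [X in (_ < X.+1)%N]m0 ltnS leqn0 => /eqP.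
rewrite /difference (big_pred1 [ffun=> ord0]).
  rewrite (_ : (\sum_(i < d) _)%N = 0%N); last by rewrite big1// => i _; rewrite sub0n.
  rewrite (_ : (\prod_(i < d) _)%N = 1%N); last by rewrite big1// => i _; rewrite v0 bin0.
  rewrite expr0 !mul1r; congr p; apply/rowP => i; rewrite !mxE v0; exact: addr0.
move=> g; apply/forallP/eqP => [_|-> i]; last by rewrite v0.
by apply/ffunP => i; apply/val_inj; rewrite /= !v0.
Qed.

Lemma sqnorm_ge0 K (xi : freq R d K) : 0 <= sqnorm xi.
Proof. by apply: sumr_ge0 => i _; exact: sqr_ge0. Qed.

Lemma sqnormN K (xi : freq R d K) : sqnorm (- xi) = sqnorm xi.
Proof.
case: K xi => xi; apply: eq_bigr => i _ /=; first by rewrite mxE sqrrN.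
by rewrite !mxE rmorphN sqrrN.
Qed.

Lemma normc_bessel K r (xi : freq R d K) :
  Normc.normc (bessel r xi) = (1 + sqnorm xi) `^ (r / 2).
Proof. by rewrite /bessel /= expr0n addr0 sqrtr_sqr ger0_norm// powR_ge0. Qed.

Lemma normc_ge0 (z : R[i]) : 0 <= Normc.normc z.
Proof. by case: z => x y; exact: sqrtr_ge0. Qed.

Lemma besselD K r s (xi : freq R d K) :
  bessel (r + s) xi = bessel r xi * bessel s xi.
Proof.
have e0 : 1 + sqnorm xi != 0 by rewrite gt_eqF// ltr_pwDl// sqnorm_ge0.
rewrite /bessel mulrDl powRD; last by rewrite e0 implybT.
by apply/eqP; rewrite eq_complex /= !mul0r !mulr0 subr0 addr0 !eqxx.
Qed.

Lemma normc_bessel_le K r s (xi : freq R d K) : r <= s ->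
  Normc.normc (bessel r xi) <= Normc.normc (bessel s xi).
Proof.
move=> rs; rewrite !normc_bessel ler_powR// ?lerDl ?sqnorm_ge0//.
by rewrite ler_pM2r.
Qed.

Lemma hermitian_bessel K r : @hermitian R K d (bessel r).
Proof.
split; last by move=> xi; rewrite /bessel sqnormN /= oppr0.
case: K => //=; split; last exact: measurable_cst.
apply: (@measurableT_comp _ _ _ _ _ _ (fun t : R => t `^ (r / 2))); first exact: measurable_powR.
apply: measurable_funD; first exact: measurable_cst.
apply: measurable_sum => i; apply: measurable_funX; exact: measurable_rV_coord.
Qed.

Lemma hermitianM K (p q : freq R d K -> R[i]) : hermitian p -> hermitian q ->
  hermitian (fun xi => p xi * q xi).
Proof.
move=> [mp ps] [mq qs]; split; last by move=> xi; rewrite ps qs rmorphM.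
by case: K p q mp mq ps qs => //= p q mp mq _ _; exact: cmeasurableM.
Qed.

Lemma S0_hermitian K r (p : freq R d K -> R[i]) : S0 r p -> hermitian p.
Proof.
move=> [sp ps _]; split=> //; case: K p sp ps => //= p [s1 s2] _.
by split; apply: continuous_measurable_rV; [case: (s1 [::])|case: (s2 [::])].
Qed.

(** The seminorm of order 0 carries the weight (1 + |xi|)^r; the factor 2^(r/2) comes from (1 +
    |xi|)^2 <= 2 (1 + |xi|^2). *)
Lemma seminorm_bound K r (p : freq R d K -> R[i]) (B : R) : 0 <= r ->
  (seminorm r (fun=> 0%N) p <= B%:E)%E ->
  forall xi, Normc.normc (p xi) <= `|B| * 2 `^ (r / 2) * Normc.normc (bessel r xi).
Proof.
move=> r0 pB xi.
have m0 : mabs (fun _ : 'I_d => 0%N) = 0%N by rewrite /mabs big1.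
have e0 : 0 < 1 + eucl xi by rewrite ltr_pwDl// sqrtr_ge0.
have H : Normc.normc (p xi) * (1 + eucl xi) `^ (- r) <= B.
  rewrite -lee_fin; apply: le_trans pB; apply: ereal_sup_ubound; exists xi => //.
  by rewrite symbol_diff0 m0 subr0.
have {}H : Normc.normc (p xi) <= `|B| * (1 + eucl xi) `^ r.
  have e1 : (1 + eucl xi) `^ (- r) * (1 + eucl xi) `^ r = 1.
    by rewrite -powRD ?addNr ?powRr0// (gt_eqF e0) implybT.
  apply: (@le_trans _ _ (Normc.normc (p xi) * (1 + eucl xi) `^ (- r) * (1 + eucl xi) `^ r)).
    by rewrite -mulrA e1 mulr1.
  by rewrite ler_wpM2r ?powR_ge0// (le_trans H)// ler_norm.
apply: le_trans H _; rewrite -mulrA ler_wpM2l// normc_bessel.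
rewrite -powRM ?ler0n ?addr_ge0 ?sqnorm_ge0//.
have -> : (1 + eucl xi) `^ r = ((1 + eucl xi) `^ 2) `^ (r / 2).
  by rewrite -powRrM mulrCA mulfV ?mulr1.
rewrite ge0_ler_powR ?nnegrE ?powR_ge0 ?divr_ge0 ?mulr_ge0 ?addr_ge0 ?sqnorm_ge0//.
rewrite powR_mulrn ?(ltW e0)//.
have E : eucl xi ^+ 2 = sqnorm xi by rewrite sqr_sqrtr ?sqnorm_ge0.
have := sqr_ge0 (1 - eucl xi); rewrite !expr2; move: E; rewrite expr2.
by set e := eucl xi; set q := sqnorm xi; lra.
Qed.

End symbol_bounds.

(** * Energy estimates *)

Section scalar_estimates.
Context (R : realType) (K : base_space) (d : nat).
Local Notation V := ('rV[R]_d).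
Local Notation W := (freq R d K).
Local Notation mu := (vol R K d).
Local Notation dot := (dot mu).
Implicit Types (f g h : V -> R) (p q : W -> R[i]) (r s t c e : R).

(** Order r with an explicit constant, so that uniformity in k and n can be followed through
    products. *)
Definition tame r c p := [/\ hermitian p, 0 <= c &
  forall xi, Normc.normc (p xi) <= c * Normc.normc (bessel r xi)].

Lemma tame_bessel r : tame r 1 (bessel r).
Proof. by split=> // [|xi]; [exact: hermitian_bessel|rewrite mul1r]. Qed.

Lemma tame_le r s c p : r <= s -> tame r c p -> tame s c p.
Proof.
move=> rs [hp c0 pc]; split=> // xi; apply: le_trans (pc xi) _.
by rewrite ler_wpM2l// normc_bessel_le.
Qed.

Lemma tameM r s c e p q : tame r c p -> tame s e q ->
  tame (r + s) (c * e) (fun xi => p xi * q xi).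
Proof.
move=> [hp c0 pc] [hq e0 qe]; split; [exact: hermitianM|exact: mulr_ge0|move=> xi].
rewrite besselD !Normc.normcM mulrACA.
by apply: ler_pM => //; exact: normc_ge0.
Qed.

Lemma tame_cst (a : R) : tame 0 `|a| (fun=> Complex a 0).
Proof.
split=> // [|xi].
  split; last by move=> xi /=; rewrite oppr0.
  by case: K => //; split; exact: measurable_cst.
by rewrite normc_bessel mul0r powRr0 mulr1 /= expr0n addr0 sqrtr_sqr.
Qed.

Section transforms.
Context (f0 : V -> R) (F : W -> R[i]).
Context (f0F : transform F f0).

(** All functions are measured against the single F: applying operators multiplies symbols, so
    commutation becomes commutativity of products. *)
Definition tr p f := transform (fun xi => p xi * F xi) f.

Lemma tr_ext p q f : (forall xi, p xi = q xi) -> tr p f -> tr q f.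
Proof. by move=> /funext ->. Qed.

Lemma tr_L2 p f : tr p f -> f \in Lfun mu 2%:E.
Proof. by case=> -[]. Qed.

Lemma tr_OP p q f h : hermitian p -> tr q f -> tr (fun xi => p xi * q xi) h ->
  tr (fun xi => p xi * q xi) (OP p f).
Proof.
rewrite /tr; have -> : (fun xi => p xi * q xi * F xi) = fun xi => p xi * (q xi * F xi).
  by apply/funext => xi; rewrite mulrA.
exact: transform_OP.
Qed.

Lemma tr_OP0 p h : hermitian p -> tr p h -> tr p (OP p f0).
Proof. by move=> hp; exact: transform_OP. Qed.

Lemma trZ (a : R) p f : tr p f -> tr (fun xi => Complex a 0 * p xi) (fun x => a * f x).
Proof.
move=> /(transformZ a); rewrite /tr.
have -> // : (fun xi => Complex a 0 * p xi * F xi) = fun xi => Complex a 0 * (p xi * F xi).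
by apply/funext => xi; rewrite mulrA.
Qed.

Lemma tr_dot p f f' g : tr p f -> tr p f' -> g \in Lfun mu 2%:E -> dot f g = dot f' g.
Proof.
move=> fp f'p gL; apply: eq_ae_dot => //; [exact: tr_L2 fp|exact: tr_L2 f'p|].
exact: transform_inj fp f'p.
Qed.

Lemma tr_norm_le p q f g c : hermitian p -> tr p f -> tr q g -> 0 <= c ->
  (forall xi, Normc.normc (p xi) <= c * Normc.normc (q xi)) ->
  dot f f <= c ^+ 2 * dot g g.
Proof.
move=> hp fp gq c0 pq; have [h hp' hN] := transform_mul hp f0F gq c0 pq.
by rewrite (tr_dot fp hp' (tr_L2 fp)) dotC (tr_dot fp hp' (tr_L2 hp')).
Qed.

(** For [f0] in H^t every symbol of order at most t has an image, by comparison with the Bessel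
    symbol of order t. *)
Lemma tame_attained r t c p h : tr (bessel t) h -> r <= t -> tame r c p -> exists g, tr p g.
Proof.
move=> ht rt /(tame_le rt)[hp c0 pc].
by have [g gp _] := transform_mul hp f0F ht c0 pc; exists g.
Qed.

Lemma tr_Hs r p f h : tr p f -> tr (fun xi => bessel r xi * p xi) h ->
  exists g, is_multiplier (bessel r : W -> R[i]) f g.
Proof.
move=> [fL fF] [hL hF]; exists h; split=> //; exists (fun xi => p xi * F xi); split=> //.
by move: hF; congr is_fourier; apply/funext => xi; rewrite mulrA.
Qed.

End transforms.

Lemma Hs_transform r f h : is_multiplier (bessel r : W -> R[i]) f h ->
  exists F, transform F f /\ tr F (bessel r) h.
Proof. by move=> [fL hL [F [fF hF]]]; exists F. Qed.

Section operators.
Context (alpha s : R) (cA cM cP : R) (pA pM pP : W -> R[i]).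
Context (alpha0 : 0 <= alpha) (s0 : 0 <= s).
Context (tA : tame alpha cA pA) (tM : tame 0 cM pM) (tP : tame s cP pP).
Let A := OP pA.
Let M := OP pM.
Let P := OP pP.
Local Notation H r f := (exists h, is_multiplier (bessel r : W -> R[i]) f h).

Context (adjoint : forall phi psi, H alpha phi -> H alpha psi ->
  dot (A phi) psi = dot phi (fun x => M psi x - A psi x)).

Let hA : hermitian pA. Proof. by case: tA. Qed.
Let hM : hermitian pM. Proof. by case: tM. Qed.
Let hP : hermitian pP. Proof. by case: tP. Qed.

Let norm_bound F f p h g : transform F f -> hermitian p ->
  tr F p h -> tr F (fun xi => pM xi * p xi) g -> dot g g <= cM ^+ 2 * dot h h.
Proof.
move=> fF hp hp' gp; have [_ c0 Mc] := tM.
apply: (tr_norm_le fF (hermitianM hM hp) gp hp' c0) => xi.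
rewrite Normc.normcM ler_wpM2r ?normc_ge0//; apply: le_trans (Mc xi) _.
by rewrite normc_bessel mul0r powRr0 mulr1.
Qed.

(** Used with e = |phi|^2 and x = <phi, M phi>, after Cauchy-Schwarz and |M phi|^2 <= c^2 e. *)
Let sqr_bound (x c e : R) : 0 <= c -> 0 <= e -> x ^+ 2 <= e * (c ^+ 2 * e) -> `|x| <= c * e.
Proof.
move=> c0 e0 H1; rewrite -(@ler_pXn2r _ 2)// ?nnegrE ?mulr_ge0//.
by rewrite real_normK ?num_real// exprMn [e ^+ 2]expr2 mulrCA.
Qed.

Let norm_le_double (x : R) : `|x| <= `|2 * x|.
Proof. by rewrite normrM (ger0_norm (ler0n _ 2)) ler_peMl// ler1n. Qed.

Let first_order_bound (a u x z c : R) :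
  u = a * x -> 2 * x = z -> `|z| <= c -> `|u| <= `|a| * c.
Proof. by move=> -> <- h; rewrite normrM ler_wpM2l// (le_trans (norm_le_double _)). Qed.

Let second_order_bound (a u v x y z c : R) : u = a ^+ 2 * x -> v = a ^+ 2 * y ->
  2 * (x + y) = z -> 0 <= z -> z <= c -> `|u + v| <= a ^+ 2 * c.
Proof.
move=> -> -> xy z0 zc; rewrite -mulrDr normrM ger0_norm ?sqr_ge0// ler_wpM2l ?sqr_ge0//.
by apply: le_trans (norm_le_double _) _; rewrite xy ger0_norm.
Qed.

(** Here x1 = <A A phi, phi>, x2 = <A phi, M phi>, x3 = <A phi, A phi>, x5 = <A M phi, phi>, x6 =
    <phi, M A phi> and x7 = <M phi, M phi>. Both x2 and x7 - x2 equal x1 + x3. *)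
Let combine_adjoints (x1 x2 x3 x5 x6 x7 : R) : x1 = x2 - x3 -> x3 = x6 - x1 -> x6 = x5 ->
  x5 = x7 - x2 -> 2 * (x1 + x3) = x7.
Proof. lra. Qed.

Section fixed_function.
Context (t : R) (f b : V -> R) (F : W -> R[i]).
Context (fF : transform F f) (bF : tr F (bessel t) b) (s_t : s <= t).

Let OPtr r c p r' c' q g : tame r c p -> tame r' c' q -> r + r' <= t -> tr F q g ->
  tr F (fun xi => p xi * q xi) (OP p g).
Proof.
move=> tp tq rt qg; have [h hpq] := tame_attained fF bF rt (tameM tp tq).
by case: tp => hp _ _; exact (tr_OP hp qg hpq).
Qed.

Let OPtr0 r c p : tame r c p -> r <= t -> tr F p (OP p f).
Proof.
move=> tp rt; have [h hp] := tame_attained fF bF rt tp.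
by case: tp => hp' _ _; exact (tr_OP0 fF hp' hp).
Qed.

Let trH r c p g : tame r c p -> alpha + r <= t -> tr F p g -> H alpha g.
Proof.
move=> tp rt pg; have [h hp] := tame_attained fF bF rt (tameM (tame_bessel alpha) tp).
exact (tr_Hs pg hp).
Qed.

Let phiF : tr F pP (P f). Proof. exact (OPtr0 tP s_t). Qed.

Let N := dot (OP (bessel s : W -> R[i]) f) (OP (bessel s : W -> R[i]) f).

Let cM0 : 0 <= cM. Proof. by case: tM. Qed.

Let MphiF : tr F (fun xi => pM xi * pP xi) (M (P f)).
Proof. by apply: (OPtr tM tP _ phiF); rewrite add0r. Qed.

Let dot_phi_le : dot (P f) (P f) <= cP ^+ 2 * N.
Proof.
have BF := OPtr0 (tame_bessel s) s_t; have [hp cP0 Pc] := tP.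
exact: (tr_norm_le fF hp phiF BF cP0 Pc).
Qed.

Let dot_Mphi_le : dot (M (P f)) (M (P f)) <= cM ^+ 2 * dot (P f) (P f).
Proof. exact (norm_bound fF hP phiF MphiF). Qed.

Lemma first_order_estimate a : s + alpha <= t ->
  `|dot (P (fun x => a * A f x)) (P f)| <= `|a| * (cM * cP ^+ 2 * N).
Proof.
move=> st; have ts : alpha + s <= t by rewrite addrC.
have at' : alpha <= t by apply: le_trans st; rewrite lerDr.
have AphiF : tr F _ (A (P f)) := OPtr tA tP ts phiF.
have st0 : s + (0 + alpha) <= t by rewrite add0r.
have PaAF : tr F _ (P (fun x => a * A f x)) :=
  OPtr tP (tameM (tame_cst a) tA) st0 (trZ a (OPtr0 tA at')).
have Hphi : H alpha (P f) := trH tP ts phiF.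
have phiL := tr_L2 phiF; have AL := tr_L2 AphiF; have ML := tr_L2 MphiF.
(* P and A are exchanged because both functions have the symbol a pA pP relative to F. *)
have E1 : dot (P (fun x => a * A f x)) (P f) = a * dot (A (P f)) (P f).
  rewrite -(dotZl a AL phiL); apply: (tr_dot PaAF _ phiL).
  by apply: tr_ext (trZ a AphiF) => xi; rewrite [RHS]mulrCA [pP xi * _]mulrC.
have E2 : 2 * dot (A (P f)) (P f) = dot (P f) (M (P f)).
  have := adjoint Hphi Hphi; rewrite (dotBr ML AL phiL) (dotC _ (P f) (A _)).
  by move: (dot (A (P f)) (P f)) (dot (P f) (M (P f))) => u v; lra.
apply: (first_order_bound E1 E2).
have X : `|dot (P f) (M (P f))| <= cM * dot (P f) (P f).
  apply: sqr_bound => //; first exact: dot_ge0.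
  apply: le_trans (cauchy_schwarz phiL ML) _.
  by rewrite ler_wpM2l ?dot_ge0.
by apply: le_trans X _; rewrite -mulrA ler_wpM2l.
Qed.

Lemma second_order_estimate a : s + 2 * alpha <= t ->
  `|dot (P (fun x => a * A (fun y => a * A f y) x)) (P f) +
    dot (P (fun x => a * A f x)) (P (fun x => a * A f x))| <=
  a ^+ 2 * (cM ^+ 2 * cP ^+ 2 * N).
Proof.
move=> st2.
(* Bookkeeping of orders: every composition below has total order at most s + 2 alpha, so it is
   attained. *)
have aas : alpha + (alpha + s) <= t by apply: le_trans st2; rewrite addrA addrC mulr_natl mulr2n.
have ts : alpha + s <= t by apply: le_trans aas; rewrite lerDr.
have at' : alpha <= t by apply: le_trans ts; rewrite lerDl.
have AphiF : tr F _ (A (P f)) := OPtr tA tP ts phiF.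
have AAphiF : tr F _ (A (A (P f))) := OPtr tA (tameM tA tP) aas AphiF.
have z1 : 0 + (alpha + s) <= t by rewrite add0r.
have z2 : alpha + (0 + s) <= t by rewrite add0r.
have z4 : s + (0 + alpha) <= t by rewrite add0r addrC.
have z5 : alpha + (0 + alpha) <= t.
  by rewrite add0r; apply: le_trans aas; rewrite lerD2l lerDl.
have z6 : s + (0 + (alpha + (0 + alpha))) <= t by rewrite !add0r addrCA (addrC s).
have MAphiF : tr F _ (M (A (P f))) := OPtr tM (tameM tA tP) z1 AphiF.
have AMphiF : tr F _ (A (M (P f))) := OPtr tA (tameM tM tP) z2 MphiF.
have Hphi : H alpha (P f) := trH tP ts phiF.
have HA : H alpha (A (P f)) := trH (tameM tA tP) aas AphiF.
have HM : H alpha (M (P f)) := trH (tameM tM tP) z2 MphiF.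
have aAfF := trZ a (OPtr0 tA at').
have tcA := tameM (tame_cst a) tA.
have PaAF : tr F _ (P (fun x => a * A f x)) := OPtr tP tcA z4 aAfF.
have aAaAF : tr F _ (fun x => a * A (fun y => a * A f y) x) := trZ a (OPtr tA tcA z5 aAfF).
have PaAaAF : tr F _ (P (fun x => a * A (fun y => a * A f y) x)) :=
  OPtr tP (tameM (tame_cst a) (tameM tA tcA)) z6 aAaAF.
have phiL := tr_L2 phiF; have AL := tr_L2 AphiF; have ML := tr_L2 MphiF.
have AAL := tr_L2 AAphiF; have MAL := tr_L2 MAphiF.
have PaAL := tr_L2 PaAF; have aAL := Lfun2Z a AL.
have E1 : dot (P (fun x => a * A (fun y => a * A f y) x)) (P f) =
    a ^+ 2 * dot (A (A (P f))) (P f).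
  rewrite -(dotZl (a ^+ 2) AAL phiL); apply: (tr_dot PaAaAF _ phiL).
  have -> : (fun x => a ^+ 2 * A (A (P f)) x) = fun x => a * (a * A (A (P f)) x).
    by apply/funext => x; rewrite mulrA.
  by apply: tr_ext (trZ a (trZ a AAphiF)) => xi; ring.
have aAphiF : tr F (fun xi => pP xi * (Complex a 0 * pA xi)) (fun x => a * A (P f) x).
  by apply: tr_ext (trZ a AphiF) => xi; ring.
have E2 : dot (P (fun x => a * A f x)) (P (fun x => a * A f x)) =
    a ^+ 2 * dot (A (P f)) (A (P f)).
  rewrite (tr_dot PaAF aAphiF PaAL) dotC (tr_dot PaAF aAphiF aAL).
  by rewrite (dotZl a AL aAL) (dotZr a AL AL) mulrA.
(* The adjoint relation is used at the pairs (A phi, phi), (phi, A phi) and (M phi, phi); [e3] links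
   the last two through M A = A M. *)
have e1 := adjoint HA Hphi; rewrite (dotBr ML AL AL) in e1.
have e3 : dot (P f) (M (A (P f))) = dot (A (M (P f))) (P f).
  rewrite dotC; apply: (tr_dot MAphiF _ phiL).
  by apply: tr_ext AMphiF => xi; rewrite mulrCA.
have e4 := adjoint Hphi HA; rewrite (dotBr MAL AAL phiL) in e4.
have {}e4 := etrans e4 (congr1 (fun z => _ - z) (dotC mu (P f) (A (A (P f))))).
have e5 := adjoint HM Hphi; rewrite (dotBr ML AL ML) in e5.
have {}e5 := etrans e5 (congr1 (fun z => _ - z) (dotC mu (M (P f)) (A (P f)))).
apply: (second_order_bound E1 E2 (combine_adjoints e1 e4 e3 e5) (dot_ge0 mu _)).
by apply: le_trans dot_Mphi_le _; rewrite -mulrA ler_wpM2l// sqr_ge0.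
Qed.

End fixed_function.

End operators.

End scalar_estimates.

Lemma bounded_tame (R : realType) (K : base_space) (d : nat) (r : R) (T : nat -> operator R d) :
  0 <= r -> bounded_OPS0 K r T -> exists (c : R) (p : nat -> freq R d K -> R[i]),
  0 <= c /\ forall k, tame r c (p k) /\ T k = OP (p k).
Proof.
move=> r0 [p [pS /(_ (fun=> 0%N))[B pB] Tp]].
exists (`|B| * 2 `^ (r / 2)), p; split; first by rewrite mulr_ge0// powR_ge0.
move=> k; split=> //; split; first exact: S0_hermitian (pS k).
  by rewrite mulr_ge0// powR_ge0.
exact: seminorm_bound (pB k).
Qed.

Lemma tame_bound_le (R : realType) (K : base_space) (d : nat) (r c e : R)
  (p : freq R d K -> R[i]) : c <= e -> tame r c p -> tame r e p.
Proof.
move=> ce [hp c0 pc]; split=> // [|xi]; first exact: le_trans ce.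
by apply: le_trans (pc xi) _; rewrite ler_wpM2r// normc_ge0.
Qed.

(** * Passage to components and summation *)

Section slot.
Context (R : realType) (K : base_space) (d m : nat).
Implicit Types (i : 'I_m) (phi psi : 'rV[R]_d -> R).

Definition slot i phi : vfun R d m := fun j => if j == i then phi else fun=> 0.

Lemma slot_Hs r i phi h : is_multiplier (bessel r : freq R d K -> R[i]) phi h ->
  Hs K r (slot i phi).
Proof.
move=> bh j; rewrite /slot; case: eqP => _; first by exists h.
have [F [phiF hF]] := Hs_transform bh.
(* The zero components are treated as 0 times phi, whose transform is known by linearity. *)
have [[zL zF] [zL' zF']] := (transformZ 0 phiF, transformZ 0 hF).
have z g : (fun x : 'rV[R]_d => 0 * g x) = fun=> 0 :> R by apply/funext => x; rewrite mul0r.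
rewrite !z in zL zF zL' zF'; exists (fun=> 0); split=> //.
exists (fun xi => Complex 0 0 * F xi); split=> //.
by move: zF'; congr is_fourier; apply/funext => xi; rewrite mulrCA.
Qed.

Lemma ip_slotr i psi (g : vfun R d m) : ip K g (slot i psi) = dot (vol R K d) (g i) psi.
Proof.
rewrite /ip (bigD1 i)//= big1 ?addr0 => [|j /negbTE ji].
  by rewrite /slot eqxx.
by rewrite -[RHS](dot0r (vol R K d) (g j)); apply: eq_Rintegral => x _; rewrite /slot ji.
Qed.

Lemma ip_slotl i psi (g : vfun R d m) : ip K (slot i psi) g = dot (vol R K d) psi (g i).
Proof.
rewrite /ip (bigD1 i)//= big1 ?addr0 => [|j /negbTE ji].
  by rewrite /slot eqxx.
by rewrite -[RHS](dot0l (vol R K d) (g j)); apply: eq_Rintegral => x _; rewrite /slot ji.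
Qed.

(** With both functions supported in component i, all other terms of the two inner products
    vanish. *)
Lemma adjoint_slot r (S T : 'I_m -> operator R d) :
  (forall g, Hs K r g ->
    adjoint_rel K (Hs K r) (diag_op S) g (sub_op (diag_op T) (diag_op S) g)) ->
  forall i phi psi, (exists h, is_multiplier (bessel r : freq R d K -> R[i]) phi h) ->
    (exists h, is_multiplier (bessel r : freq R d K -> R[i]) psi h) ->
  dot (vol R K d) (S i phi) psi = dot (vol R K d) phi (fun x => T i psi x - S i psi x).
Proof.
move=> adj i phi psi [h hphi] [h' hpsi].
have [_ _ /(_ _ (slot_Hs i hphi))] := adj _ (slot_Hs i hpsi).
rewrite ip_slotr ip_slotl /diag_op /sub_op.
by rewrite /slot !eqxx.
Qed.

End slot.

(** The sum of all (y_i - y_j)^2 is twice the difference of the two sides. *)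
Lemma sqr_sum_le (R : realType) (m : nat) (y : 'I_m -> R) :
  (\sum_(i < m) y i) ^+ 2 <= m%:R * \sum_(i < m) y i ^+ 2.
Proof.
have : 0 <= \sum_(i < m) \sum_(j < m) (y i - y j) ^+ 2.
  by apply: sumr_ge0 => i _; apply: sumr_ge0 => j _; exact: sqr_ge0.
have -> : \sum_(i < m) \sum_(j < m) (y i - y j) ^+ 2 =
    2 * (m%:R * (\sum_(i < m) y i ^+ 2) - (\sum_(i < m) y i) ^+ 2).
  set Q := \sum_(i < m) y i ^+ 2; set S := \sum_(i < m) y i.
  rewrite (eq_bigr (fun i => m%:R * y i ^+ 2 + (- (2 * S * y i) + Q))) => [|i _]; last first.
    rewrite (eq_bigr (fun j => y i ^+ 2 + (- (2 * y i * y j) + y j ^+ 2))); last first.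
      by move=> j _; ring.
    rewrite !big_split/= sumr_const card_ord sumrN -mulr_sumr mulr_natl -/S -/Q.
    by congr (_ + (- _ + _)); ring.
  rewrite !big_split/= -mulr_sumr sumrN -mulr_sumr sumr_const card_ord -/S -/Q -mulr_natl.
  by ring.
by rewrite pmulr_rge0// subr_ge0.
Qed.

Lemma ler_sqr_norm (R : realType) (x y c : R) : 0 <= c -> `|x| <= `|y| * c ->
  x ^+ 2 <= c ^+ 2 * y ^+ 2.
Proof.
move=> c0 xy; rewrite -(real_normK (num_real x)) -(real_normK (num_real y)) -exprMn mulrC.
by rewrite lerXn2r ?nnegrE// mulr_ge0.
Qed.

Lemma nneseries_le_scale (R : realType) (u b : nat -> R) (c e : R) : 0 <= c -> 0 <= e ->
  (forall k, 0 <= u k) -> (forall k, 0 <= b k) -> (forall k, u k <= c * e * b k) ->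
  (\sum_(k <oo) (u k)%:E <= c%:E * (\sum_(k <oo) (b k)%:E) * e%:E)%E.
Proof.
move=> c0 e0 u0 b0 ub; rewrite muleAC -EFinM.
rewrite -nneseriesZl//; last by move=> k _; rewrite lee_fin.
  by apply: lee_nneseries => [k _|k _]; rewrite ?lee_fin// -EFinM lee_fin.
Qed.

Theorem theorem3p2 (R : realType) (K : base_space) (d m : nat)
  (hd : (1 <= d)%N) (hm : (1 <= m)%N) (alpha : R) (halpha : 0 <= alpha)
  (a : nat -> 'I_m -> R)
  (ha : forall i, (\sum_(k <oo) (a k i ^+ 2)%:E < +oo)%E)
  (A : nat -> 'I_m -> operator R d)
  (hA : forall i, bounded_OPS0 K alpha (fun k => A k i))
  (M : nat -> 'I_m -> operator R d)
  (hM : forall i, bounded_OPS0 K 0 (fun k => M k i))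
  (hadj : forall k g, Hs K alpha g ->
     adjoint_rel K (Hs K alpha) (diag_op (A k)) g
       (sub_op (diag_op (M k)) (diag_op (A k)) g))
  (s : R) (hs : 0 <= s) (P : nat -> operator R d)
  (hP : bounded_OPS0 K s P) :
  let aA k := scale_op (a k) (diag_op (A k)) in
  exists2 C : R, 0 < C & forall n : nat,
    let Pn := scalar_op (P n) in
    (forall f : vfun R d m, Hs K (s + alpha) f ->
      (\sum_(k <oo) (ip K (Pn (aA k f)) (Pn f) ^+ 2)%:E
        <= C%:E * sqnorm_l2 a * (norm_Hs K s f ^+ 4)%:E)%E) /\
    (forall f : vfun R d m, Hs K (s + 2 * alpha) f ->
      (\sum_(k <oo) `|ip K (Pn (aA k (aA k f))) (Pn f)
                     + ip K (Pn (aA k f)) (Pn (aA k f))|%:E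
        <= C%:E * sqnorm_l2 a * (norm_Hs K s f ^+ 2)%:E)%E).
Proof.
move=> aA.
have /choice[cA /choice[pA pAP]] := fun i => bounded_tame halpha (hA i).
have /choice[cM' /choice[pM pMP]] := fun i => bounded_tame (lexx 0) (hM i).
have [cP [pP [cP0 pPP]]] := bounded_tame hs hP.
(* A sum of nonnegative constants serves as a common bound for all components. *)
pose cM := \sum_(i < m) cM' i.
have cM0 : 0 <= cM by apply: sumr_ge0 => i _; case: (pMP i).
have tA k i : tame alpha (cA i) (pA i k) by case: (pAP i) => _ /(_ k)[].
have tM k i : tame 0 cM (pM i k).
  have [_ /(_ k)[tMk _]] := pMP i; apply: tame_bound_le tMk.
  by rewrite /cM (bigD1 i)//= lerDl sumr_ge0// => j _; case: (pMP j).
have tP n : tame s cP (pP n) by case: (pPP n).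
have EA k i : A k i = OP (pA i k) by case: (pAP i) => _ /(_ k)[].
have EM k i : M k i = OP (pM i k) by case: (pMP i) => _ /(_ k)[].
have EP n : P n = OP (pP n) by case: (pPP n).
have adj k i phi psi : (exists h, is_multiplier (bessel alpha : freq R d K -> R[i]) phi h) ->
    (exists h, is_multiplier (bessel alpha : freq R d K -> R[i]) psi h) ->
    dot (vol R K d) (OP (pA i k) phi) psi =
    dot (vol R K d) phi (fun x => OP (pM i k) psi x - OP (pA i k) psi x).
  by move=> Hphi Hpsi; rewrite -EA -EM; exact: (adjoint_slot (hadj k) i Hphi Hpsi).
pose C1 := cM * cP ^+ 2; pose C2 := cM ^+ 2 * cP ^+ 2.
have C1_0 : 0 <= C1 by rewrite mulr_ge0 ?sqr_ge0.
have C2_0 : 0 <= C2 by rewrite mulr_ge0 ?sqr_ge0.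
have C0 : 0 <= m%:R * C1 ^+ 2 by rewrite mulr_ge0 ?sqr_ge0.
(* The first term serves the first inequality, where the square of a sum over i costs a factor m;
   the second serves the other inequality, and 1 makes the constant positive. *)
exists (m%:R * C1 ^+ 2 + C2 + 1); first by rewrite ltr_wpDl// addr_ge0.
move=> n Pn.
pose N (f : vfun R d m) i := dot (vol R K d) (OP (bessel s : freq R d K -> R[i]) (f i))
                                   (OP (bessel s : freq R d K -> R[i]) (f i)).
have N0 f i : 0 <= N f i by exact: dot_ge0.
have normE f : norm_Hs K s f ^+ 2 = \sum_(i < m) N f i.
  by rewrite /norm_Hs /norm_L2 sqr_sqrtr//; apply: sumr_ge0 => i _; exact: dot_ge0.
have N_le f i : N f i <= norm_Hs K s f ^+ 2.
  by rewrite normE (bigD1 i)//= lerDl sumr_ge0.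
have b0 k : 0 <= \sum_(i < m) a k i ^+ 2 by apply: sumr_ge0 => i _; exact: sqr_ge0.
have s_le r : 0 <= r -> s <= s + r by rewrite lerDl.
have al2 : 0 <= 2 * alpha by rewrite mulr_ge0.
split=> f Hf; apply: nneseries_le_scale => //.
- by rewrite addr_ge0// addr_ge0.
- by rewrite -[4%N]/(2 * 2)%N exprM sqr_ge0.
- by move=> k; exact: sqr_ge0.
- move=> k.
  have E i : `|dot (vol R K d) (P n (fun x => a k i * A k i (f i) x)) (P n (f i))| <=
      `|a k i| * (C1 * N f i).
    have [h /Hs_transform[F [fF bF]]] := Hf i; rewrite EA EP.
    exact (first_order_estimate hs (tA k i) (tM k i) (tP n) (adj k i) fF bF
      (s_le _ halpha) (a k i) (lexx _)).
  apply: le_trans (sqr_sum_le _) _.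
  apply: (@le_trans _ _ (m%:R * \sum_(i < m) (C1 * norm_Hs K s f ^+ 2) ^+ 2 * a k i ^+ 2)).
    rewrite ler_wpM2l//; apply: ler_sum => i _.
    apply: ler_sqr_norm; first by rewrite mulr_ge0 ?sqr_ge0.
    by apply: le_trans (E i) _; rewrite ler_wpM2l// ler_wpM2l.
  rewrite -mulr_sumr exprMn -exprM mulrA [m%:R * _]mulrA ler_wpM2r//.
  rewrite ler_wpM2r//; first by rewrite -[(2 * 2)%N]/4%N -[4%N]/(2 * 2)%N exprM sqr_ge0.
  by rewrite -addrA lerDl addr_ge0.
- by rewrite addr_ge0// addr_ge0.
- by rewrite sqr_ge0.
- move=> k.
  have E i : `|dot (vol R K d)
        (P n (fun x => a k i * A k i (fun y => a k i * A k i (f i) y) x)) (P n (f i)) +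
      dot (vol R K d) (P n (fun x => a k i * A k i (f i) x))
        (P n (fun x => a k i * A k i (f i) x))| <=
      a k i ^+ 2 * (C2 * N f i).
    have [h /Hs_transform[F [fF bF]]] := Hf i; rewrite EA EP.
    exact (second_order_estimate halpha hs (tA k i) (tM k i) (tP n) (adj k i) fF bF
      (s_le _ al2) (a k i) (lexx _)).
  (* The two inner products are merged component by component before taking absolute values, since
     only their sum is free of derivative loss. *)
  rewrite /ip -big_split/=; apply: le_trans (ler_norm_sum _ _ _) _.
  apply: (@le_trans _ _ (\sum_(i < m) C2 * norm_Hs K s f ^+ 2 * a k i ^+ 2)).
    apply: ler_sum => i _; apply: le_trans (E i) _.
    by rewrite mulrC ler_wpM2r ?sqr_ge0// ler_wpM2l.
  rewrite -mulr_sumr ler_wpM2r// ler_wpM2r ?sqr_ge0//.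
  by rewrite addrAC lerDr addr_ge0.
Qed.
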